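(* Let $F\in\mathbb{R}[x,y,t,s]$ be square-free, with no factor depending only on $(t,s)$, and such that the leading coefficient of $F$ with respect to $y$ does not depend on $x$. Let $M(x,t,s)=\sqrt{D_y(F)}$ and $R(t,s)=D_x(M)$, and assume $R$ is not identically zero. Let $\mathcal{R}=\{(t,s)\in\mathbb{R}^2: R(t,s)=0\}$ and let $\mathcal{L}_1,\dots,\mathcal{L}_p$ be the connected components of $\mathbb{R}^2\setminus\mathcal{R}$. Then for each $i$, the topology type of the curve $F(x,y,t,s)=0$ stays invariant as $(t,s)$ ranges over $\mathcal{L}_i$.
   Context: For a polynomial $G$ and a variable $w$, $D_w(G):=\mathrm{Res}_w(G,\partial G/\partial w)$, and $\sqrt{G}$ denotes the square-free part of $G$. By convention $M:=0$ if $\deg_y F=0$ and $R:=0$ if $\deg_x M=0$. Two real plane curves have the same topology type if there is a homeomorphism of $\mathbb{R}^2$ onto itself mapping the real zero set of one onto the real zero set of the other. *)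

(* Defs.v *)
From HB Require Import structures.
From mathcomp Require Import all_boot all_order all_algebra.
From mathcomp Require Import all_classical all_reals all_analysis.
From mathcomp Require Import Rstruct Rstruct_topology.
Set Implicit Arguments. Unset Strict Implicit. Unset Printing Implicit Defensive.
Import Order.TTheory GRing.Theory Num.Theory.
Local Open Scope ring_scope.
Local Open Scope classical_set_scope.

Notation RR := Rdefinitions.R.

(* Polynomial rings, as iterated univariate polynomials:
   P_ts  = R[t,s]   (outer variable s, inner variable t)
   P_xts = R[t,s][x]
   P_all = R[t,s][x][y]  (isomorphic to R[x,y,t,s]) *)
Definition P_ts := {poly {poly RR}}.
Definition P_xts := {poly P_ts}.
Definition P_all := {poly P_xts}.

(* divisibility in a commutative ring (not pseudo-division) *)
Definition rdvd (A : comNzRingType) (a b : A) : Prop := exists c : A, b = c * a.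

Definition squarefree (A : comUnitRingType) (a : A) : Prop :=
  a != 0 /\ forall p : A, rdvd (p * p) a -> p \is a GRing.unit.

(* M is a square-free part sqrt(G) of G (defined up to a unit): M divides G,
   G divides a power of M, and M is square-free; for G = 0 we take M = 0. *)
Definition is_sqfree_part (A : comUnitRingType) (G M : A) : Prop :=
  if G == 0 then M = 0
  else [/\ rdvd M G, (exists n : nat, rdvd G (M ^+ n)) & squarefree M].

Definition Dres (A : comNzRingType) (G : {poly A}) : A := resultant G G^`().

Definition eval_ts (q : P_ts) (t s : RR) : RR := (q.[s%:P]).[t].

Definition spec_ts (F : P_all) (t s : RR) : {poly {poly RR}} :=
  map_poly (fun c : P_xts => map_poly (fun q : P_ts => eval_ts q t s) c) F.

Definition curve (F : P_all) (t s : RR) : set (RR * RR) :=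
  [set xy | ((spec_ts F t s).[xy.2%:P]).[xy.1] = 0].

Definition same_topology_type (Z1 Z2 : set (RR * RR)) : Prop :=
  exists (f g : RR * RR -> RR * RR),
    [/\ continuous f, continuous g, cancel f g, cancel g f & f @` Z1 = Z2].

(* Main.v *)
(* Where R does not vanish, the leading coefficient of F in y is a nonzero constant,
   M has simple complex roots in x, of constant number, and they are the roots of
   the discriminant D_y F, whose degree and multiplicities are locally constant.
   Over a noncritical x the fibre F(x, y) = 0 has simple roots. Over a critical a,
   the orders at a of the polar resultants Res_y(F_x + lam F, F_y), for generic lam,
   and of D_y F differ by the number of roots lost in the fibre: this follows from
   Puiseux series v of F along the roots of F_y, because dv/dx = F_x there. As the
   order of the polar resultant can only drop under perturbation and the number of
   distinct roots can only grow, that number is locally constant along each critical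
   point. Hence the real roots in the fibres vary continuously with (t,s), and so
   does the way the branches meet over the critical points. A homeomorphism (x, y) |->
   (phi x, H(x, y)) between nearby curves is then written down by piecewise linear
   interpolation, and connectedness of the component concludes. *)
Require Import Defs.
From HB Require Import structures.
From mathcomp Require Import all_boot all_order all_algebra.
From mathcomp Require Import separable complex polyrcf ring lra zify.
From mathcomp Require Import all_classical all_reals all_analysis.
From mathcomp Require Import Rstruct Rstruct_topology.
Set Implicit Arguments. Unset Strict Implicit. Unset Printing Implicit Defensive.
Import Order.TTheory GRing.Theory Num.Theory.
Import numFieldNormedType.Exports.
Local Open Scope classical_set_scope.
Local Open Scope ring_scope.

(** * Resultants and truncated Puiseux series *)

(** The order of [D_y F] at a critical point does not by itself give the number of roots lost there:
    order 2 occurs for one node, which loses one root, and for two folds over the same abscissa,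
    which lose two. The polar resultant has order 1 in the first case and 0 in the second. Its
    summand [lam F] has two purposes. It makes the leading coefficient in [y] a nonzero constant, so
    that resultants commute with specialization; and for all but finitely many [lam] it keeps the
    roots of [F_y] at which [F] does not vanish from contributing to the order. All orders compared
    are bounded in advance by that of [D_y F], so Puiseux series enter only as polynomials in [w],
    with [u = w ^ N], modulo a power of [w]. The plane maps are kept increasing on vertical lines
    and of bounded displacement there: the second property makes them onto by intermediate values,
    the first makes their inverses continuous. *)

Section NewtonBasis.
Variable A : idomainType.

(** Beyond the length of [hs] the default entry [0] contributes factors [X], so the family is a
    basis in every degree, and the rows [P * X ^ i] of a Sylvester matrix are multiples of its
    members. *)
Definition newton_poly (hs : seq A) k : {poly A} :=
  \prod_(l < k) ('X - (hs`_l)%:P).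

Lemma newton_polyS hs k :
  newton_poly hs k.+1 = newton_poly hs k * ('X - (hs`_k)%:P).
Proof. by rewrite /newton_poly big_ord_recr. Qed.

Lemma size_newton_poly hs k : size (newton_poly hs k) = k.+1.
Proof. by rewrite size_prod_XsubC /index_enum -enumT size_enum_ord. Qed.

Lemma monic_newton_poly hs k : newton_poly hs k \is monic.
Proof. exact: monic_prod_XsubC. Qed.

Lemma newton_poly_size hs i :
  newton_poly hs (size hs + i) = \prod_(x <- hs) ('X - x%:P) * 'X^i.
Proof.
elim: i => [|i IH].
  by rewrite addn0 mulr1 (big_nth 0) big_mkord.
by rewrite addnS newton_polyS IH nth_default ?leq_addr // subr0 exprSr mulrA.
Qed.

(** Divided differences: subtracting from [r] its value at the [j]-th node leaves a multiple of the
    corresponding linear factor, and the quotient, of smaller size, is expanded from index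
    [j.+1]. *)
Lemma newton_expansion hs N n j (r : {poly A}) :
    (size r <= n)%N -> (j + n <= N)%N ->
  exists c : nat -> A,
    [/\ newton_poly hs j * r = \sum_(k < N) c k *: newton_poly hs k,
        forall k, (k < j)%N -> c k = 0 & c j = r.[hs`_j]].
Proof.
elim: n j r => [|n IH] j r sz_r le_jn.
  move: sz_r; rewrite leqn0 size_poly_eq0 => /eqP->; exists (fun=> 0).
  by rewrite mulr0 horner0 big1 // => i _; rewrite scale0r.
have /factor_theorem[r' Dr'] : root (r - (r.[hs`_j])%:P) hs`_j.
  by rewrite rootE hornerD hornerN hornerC subrr.
have sz_r' : (size r' <= n)%N.
  have [->|r'_n0] := eqVneq r' 0; first by rewrite size_poly0.
  have : (size (r - (r.[hs`_j])%:P)%R <= n.+1)%N.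
    rewrite (leq_trans (size_polyD _ _)) // geq_max sz_r size_polyN.
    by rewrite (leq_trans (size_polyC_leq1 _)).
  by rewrite Dr' size_Mmonic ?monicXsubC // size_XsubC addn2.
have [|c [Dc c0 cj]] := IH j.+1 r' sz_r'; first by rewrite addSnnS.
exists (fun k => if k == j then r.[hs`_j] else c k); split=> [||].
- have lt_jN : (j < N)%N by rewrite (leq_trans _ le_jn) // -addSnnS leq_addr.
  rewrite (bigD1 (Ordinal lt_jN)) //= eqxx.
  have -> : r = (r.[hs`_j])%:P + r' * ('X - (hs`_j)%:P).
    by rewrite -Dr' addrC subrK.
  rewrite hornerD hornerM hornerXsubC subrr mulr0 addr0 hornerC.
  rewrite mulrDr mulrC mul_polyC; congr (_ + _).
  rewrite [r' * _]mulrC mulrA -newton_polyS Dc (bigD1 (Ordinal lt_jN)) //=.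
  rewrite c0 // scale0r add0r; apply: eq_bigr => i.
  by rewrite -val_eqE /= => /negPf->.
- by move=> k lt_kj; rewrite ltn_eqF // c0 // (leq_trans lt_kj).
- by rewrite eqxx.
Qed.

(* In the Newton basis attached to the roots of [P], the rows [newton_poly hs k * Q]
   of the Sylvester matrix become triangular, with diagonal [Q.[hs`_k]]. *)
Lemma resultant_prod_XsubC (Q P : {poly A}) (a : A) hs :
    a != 0 -> P = a *: \prod_(x <- hs) ('X - x%:P) ->
  resultant Q P = a ^+ (size Q).-1 * \prod_(x <- hs) Q.[x].
Proof.
move=> a_n0 DP; have sz_P : (size P).-1 = size hs.
  by rewrite DP size_scale // size_prod_XsubC.
rewrite /resultant; set m := (size Q).-1; set S := Sylvester_mx Q P.
set n := (size P).-1 in S *.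
pose Mx N (b : 'I_N -> {poly A}) : 'M[A]_N := \matrix_(i, j) (b i)`_j.
(* [L] is unitriangular: it turns the rows [X ^ l * Q] into [newton_poly hs k * Q] and keeps the
   rows coming from [P]. *)
pose L : 'M[A]_(n + m) := block_mx (Mx n (fun k => newton_poly hs k)) 0 0 1%:M.
have det_newton N : \det (Mx N (fun k => newton_poly hs k)) = 1.
  rewrite det_trig.
    rewrite big1 // => i _; rewrite mxE.
    by have /monicP := monic_newton_poly hs i;
      rewrite lead_coefE size_newton_poly.
  apply/is_trig_mxP => i j lt_ij; rewrite mxE nth_default //.
  by rewrite size_newton_poly.
have det_L : \det L = 1 by rewrite det_ublock det_newton det1 mulr1.
have [c c_P] : exists c : nat -> nat -> A, forall j, (j < n)%N ->
    [/\ newton_poly hs j * Q = \sum_(k < n + m) c j k *: newton_poly hs k,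
        forall k, (k < j)%N -> c j k = 0 & c j j = Q.[hs`_j]].
  have cP (j : 'I_n) : exists cj : {ffun 'I_(n + m).+1 -> A},
    [/\ newton_poly hs j * Q =
           \sum_(k < n + m) cj (inord k) *: newton_poly hs k,
        forall k, (k < j)%N -> cj (inord k) = 0 & cj (inord j) = Q.[hs`_j]].
    have [||cj [D1 D2 D3]] := @newton_expansion hs (n + m) m.+1 j Q.
    - exact: leqSpred.
    - by rewrite addnS -addSn leq_add2r.
    exists [ffun k : 'I_(n + m).+1 => cj k]; split=> [||].
    - rewrite D1; apply: eq_bigr => k _; rewrite ffunE inordK //.
      by rewrite (leq_trans (ltn_ord k)).
    - move=> k lt_kj; rewrite ffunE inordK ?D2 //.
      by have := ltn_ord j; lia.
    - by rewrite ffunE inordK ?D3 //; have := ltn_ord j; lia.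
  have [f fP] := fin_all_exists cP.
  exists (fun j k => if insub j is Some j' then f j' (inord k) else 0).
  by move=> j lt_jn; rewrite insubT /=; apply: (fP (Ordinal lt_jn)).
(* Coordinates of the new rows in the Newton basis; [P * X ^ i] is [a] times the member of index
   [n + i], whence the scalar block. *)
pose T : 'M[A]_(n + m) := block_mx (\matrix_(i, j) c i j)
   (\matrix_(i, j) c i (n + j)%N) 0 (a%:M).
pose U := Mx (n + m)%N (fun k => newton_poly hs k).
have eqLS : L *m S = T *m U.
  apply/matrixP=> i j; rewrite !mxE.
  transitivity ((if fintype.split i is inl k then newton_poly hs k * Q
                 else P * 'X^(i - n))`_j).
    case: splitP => k Dk.
      rewrite (_ : i = lshift m k); last exact: val_inj.
      rewrite big_split_ord /= [X in _ + X]big1 ?addr0; last first.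
        by move=> l _; rewrite block_mxEur mxE mul0r.
      have Dnk : newton_poly hs k = \poly_(l < n) (newton_poly hs k)`_l.
        apply/polyP => l; rewrite coef_poly; case: ltnP => // le_nl.
        by rewrite nth_default // size_newton_poly (leq_trans (ltn_ord k)).
      rewrite {1}Dnk poly_def mulr_suml coef_sum; apply: eq_bigr => l _.
      rewrite block_mxEul mxE Sylvester_mxE.
      rewrite (_ : fintype.split _ = inl l); last exact: (@unsplitK _ _ (inl l)).
      by rewrite -scalerAl coefZ coefXnM; case: leqP; rewrite ?mulr0.
    rewrite (_ : i = rshift n k); last exact: val_inj.
    rewrite big_split_ord /= [X in X + _]big1 ?add0r; last first.
      by move=> l _; rewrite block_mxEdl mxE mul0r.
    rewrite (bigD1 k) //= block_mxEdr mxE eqxx mul1r big1 ?addr0; last first.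
      by move=> l /negPf nlk; rewrite block_mxEdr mxE eq_sym nlk mul0r.
    rewrite Sylvester_mxE.
    rewrite (_ : fintype.split _ = inr k); last exact: (@unsplitK _ _ (inr k)).
    by rewrite addKn coefMXn; case: leqP.
  case: splitP => k Dk.
    rewrite (_ : i = lshift m k); last exact: val_inj.
    have [-> _ _] := c_P k (ltn_ord k).
    rewrite coef_sum big_split_ord [RHS]big_split_ord; congr (_ + _).
      by apply: eq_bigr => l _; rewrite /T /U block_mxEul !mxE coefZ.
    by apply: eq_bigr => l _; rewrite /T /U block_mxEur !mxE coefZ.
  rewrite (_ : i = rshift n k); last exact: val_inj.
  rewrite big_split_ord /= [X in X + _]big1 ?add0r; last first.
    by move=> l _; rewrite /T block_mxEdl mxE mul0r.
  rewrite (bigD1 k) //= /T block_mxEdr mxE eqxx big1 ?addr0; last first.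
    by move=> l /negPf nlk; rewrite block_mxEdr mxE eq_sym nlk mul0r.
  rewrite addKn mxE /= mulr1n.
  have -> : newton_poly hs (n + k) = newton_poly hs (size hs + k).
    by rewrite -sz_P.
  by rewrite newton_poly_size DP -scalerAl coefZ.
have := congr1 determinant eqLS; rewrite !det_mulmx det_L det_newton mul1r mulr1.
move=> ->.
rewrite /T det_ublock det_scalar mulrC; congr (_ * _).
rewrite -det_tr det_trig; last first.
  apply/is_trig_mxP => i j lt_ij; rewrite !mxE.
  by have [_ c0 _] := c_P j (ltn_ord j); apply: c0.
rewrite (big_nth 0) big_mkord -sz_P; apply: eq_bigr => i _; rewrite !mxE.
by have [_ _ ->] := c_P i (ltn_ord i).
Qed.

End NewtonBasis.

Lemma size_monic_sub (A : nzRingType) (p q : {poly A}) :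
  p \is monic -> q \is monic -> size p = size q ->
  (size (p - q)%R < size p)%N.
Proof.
move=> mon_p mon_q eq_sz; have p_gt0 : (0 < size p)%N.
  by rewrite lt0n size_poly_eq0 monic_neq0.
rewrite -(prednK p_gt0) ltnS; apply/leq_sizeP => j; rewrite leq_eqVlt coefB.
case/predU1P=> [<-|]; last first.
  by rewrite prednK // => lt_j; rewrite !nth_default ?subrr // -eq_sz.
by rewrite {2}eq_sz -!lead_coefE (monicP mon_p) (monicP mon_q) subrr.
Qed.

Lemma coef_XsubC_expSn (A : comNzRingType) (c : A) n :
  (('X - c%:P) ^+ n.+1)`_n = - (c *+ n.+1).
Proof.
have := @coefPn_prod_XsubC _ (nseq n.+1 c).
by rewrite size_nseq big_nseq iter_mulr_1 big_nseq iter_addr addr0; apply.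
Qed.

Section Puiseux.
Variable C : numClosedFieldType.
Implicit Types (P Q g : {poly {poly C}}) (a b : {poly C}).

(** Congruence to 0 modulo [u ^ K]: the inner variable is the local parameter [u], the outer one the
    unknown of the equation. *)
Definition dvX K P := forall i, 'X^K %| P`_i.

Local Notation ev0 := (map_poly (horner_eval (0 : C))).

Lemma dvX_scale K P : dvX K ('X^K *: P).
Proof. by move=> i; rewrite coefZ dvdp_mulr. Qed.

Lemma dvXP K P : dvX K P -> exists2 r, P = 'X^K *: r & (size r <= size P)%N.
Proof.
move=> dvP; exists (\poly_(i < size P) (P`_i %/ 'X^K)); last exact: size_poly.
apply/polyP=> i; rewrite coefZ coef_poly; case: ltnP => [_|le_i].
  by rewrite mulrC divpK.
by rewrite mulr0 nth_default.
Qed.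

Lemma dvX_ev0 P : ev0 P = 0 -> dvX 1 P.
Proof.
move=> P0 i; rewrite expr1 -[X in X %| _]subr0 dvdp_XsubCl rootE.
by have /(congr1 (fun p : {poly C} => p`_i)) := P0; rewrite coef_map coef0 /= /horner_eval => ->.
Qed.

Lemma ev0_lift a : ev0 (map_poly polyC a) = a.
Proof.
by apply/polyP => i; rewrite !coef_map /= /horner_eval hornerC.
Qed.

Lemma ev0Z a P : ev0 (a *: P) = a.[0] *: ev0 P.
Proof. by apply/polyP => i; rewrite coefZ !coef_map coefZ /= /horner_eval hornerM. Qed.

(** The factors are corrected one order at a time. A Bezout relation between [a] and [b] solves the
    linearized equation, with corrections of smaller size than the factors, which therefore stay
    monic. *)
Lemma hensel K g a b : g \is monic -> a \is monic -> b \is monic ->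
    coprimep a b -> ev0 g = a * b ->
  exists A B : {poly {poly C}}, [/\ A \is monic /\ B \is monic,
    ev0 A = a /\ ev0 B = b, size A = size a, size B = size b
    & dvX K (g - A * B)].
Proof.
move=> mon_g mon_a mon_b cop_ab Dg.
(* The exponent is raised by one so that the induction starts from the given factorization modulo
   [u]. *)
suff [A [B [monAB evAB sA sB dv]]] : exists A B : {poly {poly C}},
  [/\ A \is monic /\ B \is monic,
    ev0 A = a /\ ev0 B = b, size A = size a, size B = size b
    & dvX K.+1 (g - A * B)].
  by exists A, B; split=> // i; apply: dvdp_trans (dv i); rewrite dvdp_exp2l.
elim: K => [|K [A [B [[monA monB] [evA evB] sA sB dv]]]].
  have mon_lift p : p \is monic -> map_poly polyC p \is monic.
    exact: monic_map.
  exists (map_poly polyC a), (map_poly polyC b); split=> //.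
  - by rewrite !mon_lift.
  - by rewrite !ev0_lift.
  - by rewrite size_map_polyC.
  - by rewrite size_map_polyC.
  - by apply: dvX_ev0; rewrite rmorphB rmorphM /= !ev0_lift Dg subrr.
have sz_g : size g = size (A * B).
  rewrite -(size_map_poly_id0 (f := horner_eval 0) (p := g)); last first.
    by rewrite (monicP mon_g) /= /horner_eval hornerC oner_neq0.
  rewrite [map_poly _ g]Dg !size_monicM ?monic_neq0 //.
  by rewrite sA sB.
have mon_AB : A * B \is monic by rewrite monicMl.
have lt_gAB := size_monic_sub mon_g mon_AB sz_g.
have [r Dr sz_r] := dvXP dv.
pose r0 : {poly C} := ev0 r.
have lt_r0 : (size r0 < size (a * b)%R)%N.
  rewrite (leq_ltn_trans (size_poly _ _)) // (leq_ltn_trans sz_r) //.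
  by rewrite (leq_trans lt_gAB) // sz_g !size_monicM ?monic_neq0 ?sA ?sB.
have /Bezout_eq1_coprimepP[[u v] /= Duv] := cop_ab.
(* Reduction modulo [a] bounds the size of [t]; the quotient is absorbed by [s], whose size is then
   bounded by comparing degrees in [Dst]. *)
pose t : {poly C} := (r0 * v) %% a; pose s : {poly C} := r0 * u + (r0 * v) %/ a * b.
have Dst : r0 - t * b = a * s.
  have Dt : t = r0 * v - (r0 * v) %/ a * a.
    by apply/eqP; rewrite eq_sym subr_eq [t + _]addrC -divp_eq.
  rewrite Dt /s -{1}[r0]mulr1 -Duv; ring.
have lt_t : (size t < size a)%N by rewrite ltn_modp monic_neq0.
clearbody t s.
have [a_n0 b_n0] := (monic_neq0 mon_a, monic_neq0 mon_b).
have lt_s : (size s < size b)%N.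
  have [->|s_n0] := eqVneq s 0.
    by rewrite size_poly0 lt0n size_poly_eq0 monic_neq0.
  have : (size (a * s)%R < size (a * b)%R)%N.
    rewrite -Dst (leq_ltn_trans (size_polyD _ _)) // gtn_max lt_r0 size_polyN.
    have [->|t_n0] := eqVneq t 0.
      by rewrite mul0r size_poly0 lt0n size_poly_eq0 mulf_neq0 ?monic_neq0.
    rewrite !size_mul //.
    move: lt_t b_n0 t_n0; rewrite -!size_poly_gt0.
    by clear=> /=; move: (size t) (size a) (size b) => x y z; lia.
  rewrite !size_mul //.
  move: a_n0 s_n0; rewrite -!size_poly_gt0; clear=> /=.
  by move: (size a) (size s) (size b) => x y z; lia.
pose S : {poly {poly C}} := map_poly polyC s; pose T : {poly {poly C}} := map_poly polyC t.
have lt_T : (size ('X^(K.+1) *: T)%R < size A)%N.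
  by rewrite (leq_ltn_trans (size_scale_leq _ _)) // size_map_polyC sA.
have lt_S : (size ('X^(K.+1) *: S)%R < size B)%N.
  by rewrite (leq_ltn_trans (size_scale_leq _ _)) // size_map_polyC sB.
exists (A + 'X^(K.+1) *: T), (B + 'X^(K.+1) *: S); split.
- by rewrite !monicE !lead_coefDl // (monicP monA) (monicP monB) eqxx.
- rewrite !rmorphD /= !ev0Z evA evB.
  by rewrite !hornerXn !expr0n /= !scale0r !addr0.
- by rewrite size_polyDl.
- by rewrite size_polyDl.
have Dw : g - (A + 'X^(K.+1) *: T) * (B + 'X^(K.+1) *: S) =
    'X^(K.+1) *: (r - T * B - A * S - 'X^(K.+1) *: (T * S)).
  rewrite !scalerBr -Dr scalerA -!mul_polyC; ring.
have /dvX_ev0/dvXP[w Dw' _] : ev0 (r - T * B - A * S - 'X^(K.+1) *: (T * S)) = 0.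
  rewrite !rmorphB /= ev0Z hornerXn expr0n scale0r subr0 !rmorphM /=.
  by rewrite !ev0_lift evA evB -/r0 Dst subrr.
by rewrite Dw Dw' scalerA -exprSr; apply: dvX_scale.
Qed.

Lemma dvXD K P Q : dvX K P -> dvX K Q -> dvX K (P + Q).
Proof. by move=> dP dQ i; rewrite coefD dvdp_addl. Qed.

Lemma dvXM K P Q : dvX K P -> dvX K (P * Q).
Proof.
move=> dP i; rewrite coefM; apply: (big_ind (fun x => 'X^K %| x)).
- exact: dvdp0.
- by move=> x y dx dy; rewrite dvdp_addl.
- by move=> j _; rewrite dvdp_mulr.
Qed.

Local Notation ramify N := (map_poly (comp_poly ('X^N : {poly C}))).

Lemma coef_ramify N P i : (ramify N P)`_i = P`_i \Po 'X^N.
Proof. exact: coef_map. Qed.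

Lemma ramify_mul M N P : ramify M (ramify N P) = ramify (N * M) P.
Proof.
apply/polyP => i; rewrite !coef_ramify -comp_polyA; congr (_ \Po _).
by rewrite comp_Xn_poly -exprM mulnC.
Qed.

Lemma dvX_ramify N K P : dvX K P -> dvX (N * K) (ramify N P).
Proof.
move=> dvP i; rewrite coef_ramify; have /dvdpP[q ->] := dvP i.
by rewrite comp_polyM comp_Xn_poly -exprM dvdp_mull.
Qed.

Lemma ramify_prod_XsubC N (hs : seq {poly C}) :
  ramify N (\prod_(h <- hs) ('X - h%:P)) =
  \prod_(h <- [seq h \Po 'X^N | h <- hs]) ('X - h%:P).
Proof.
rewrite rmorph_prod big_map; apply: eq_bigr => h _.
by rewrite rmorphB /= map_polyX map_polyC.
Qed.

(** The coefficient of index [i] is homogeneous of degree [size hs - i] in the roots. *)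
Lemma coef_prod_scaled_roots (A : comNzRingType) (t : A) (hs : seq A) i :
    (i <= size hs)%N ->
  (\prod_(h <- hs) ('X - (t * h)%:P))`_i =
  t ^+ (size hs - i) * (\prod_(h <- hs) ('X - h%:P))`_i.
Proof.
elim: hs i => [|h hs IH] i /= le_i; first by rewrite !big_nil mul1r.
rewrite !big_cons !mulrBl !coefB !coefXM !coefCM; case: i le_i => [|i] le_i /=.
  by rewrite IH // !subn0 exprS; ring.
rewrite subSS IH // mulrBr; congr (_ - _).
have [->|ne_i] := eqVneq i (size hs).
  by rewrite !nth_default ?mulr0 // size_prod_XsubC.
have lt_i : (i < size hs)%N by rewrite ltn_neqAle ne_i.
by rewrite IH // -(subnSK lt_i) exprS; ring.
Qed.

(* One step of the Newton polygon: a Tschirnhausen polynomial that is not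
   already [X ^ n] modulo [u ^ K] becomes, after ramification and rescaling of
   the roots, a product of two coprime factors at the origin. *)
Lemma newton_polygon_step n K g : g \is monic -> size g = n.+2 ->
    g`_n = 0 -> (exists2 i, (i <= n)%N & ~~ ('X^K %| g`_i)) ->
  exists N k (g1 : {poly {poly C}}), [/\ (0 < N)%N, g1 \is monic, size g1 = n.+2,
    forall i, (i <= n.+1)%N ->
      (ramify N g)`_i = 'X^(k * (n.+1 - i)) * g1`_i
    & exists a b, [/\ a \is monic, b \is monic, coprimep a b, ev0 g1 = a * b
      & (1 < size a < n.+2)%N]].
Proof.
move=> mon_g sz_g gn0 [i0 le_i0n ndv_i0].
have i0_n0 : g`_i0 != 0 by apply: contraNneq ndv_i0 => ->; rewrite dvdp0.
(* The factorial is divisible by every [n.+1 - i], so all slopes [o i / (n.+1 - i)] become integers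
   after ramification; [weight] is [N] times the slope. *)
pose N := n.+1 `!; pose o i := mup 0 g`_i.
have N_gt0 : (0 < N)%N by rewrite fact_gt0.
pose weight i := (o i * (N %/ (n.+1 - i)))%N.
pose i1 := [arg min_(i < Ordinal (le_i0n : (i0 < n.+1)%N) | g`_i != 0) weight i].
pose k := weight i1.
have [i1_n0 k_min] : g`_i1 != 0 /\
    forall i, (i <= n)%N -> g`_i != 0 -> (k <= weight i)%N.
  rewrite /k /i1; case: arg_minnP => //= i i_n0 minw; split=> // j le_jn.
  exact: (minw (Ordinal (le_jn : (j < n.+1)%N))).
have weightK i : (i <= n)%N -> (weight i * (n.+1 - i) = N * o i)%N.
  move=> le_in; rewrite /weight -mulnA divnK ?[(N * _)%N]mulnC //.
  by rewrite dvdn_fact // subn_gt0 ltnS le_in leq_subr.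
have Dg i : g`_i != 0 -> exists2 q : {poly C},
    q.[0] != 0 & g`_i \Po 'X^N = 'X^(N * o i) * q.
  move=> gi_n0; have [m [q]] := multiplicity_XsubC g`_i 0.
  rewrite gi_n0 /= => nr_q Dgi; exists (q \Po 'X^N).
    by rewrite horner_comp hornerXn expr0n gtn_eqF.
  have -> : o i = m.
    by rewrite /o Dgi mupMr // mup_XsubCX eqxx.
  by rewrite Dgi subr0 comp_polyM comp_Xn_poly exprM mulrC.
pose g1 := \poly_(i < n.+2) ((g`_i \Po 'X^N) %/ 'X^(k * (n.+1 - i))).
have gn1 : g`_n.+1 = 1 by have /monicP := mon_g; rewrite lead_coefE sz_g.
have g1n1 : g1`_n.+1 = 1.
  rewrite coef_poly ltnSn gn1 subnn muln0 expr0 divp1.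
  by rewrite comp_polyC.
have sz_g1 : size g1 = n.+2.
  rewrite size_poly_eq //=; have := g1n1; rewrite coef_poly ltnSn => ->.
  exact: oner_neq0.
have mon_g1 : g1 \is monic by rewrite monicE lead_coefE sz_g1 g1n1.
exists N, k, g1; split=> //.
  move=> i; rewrite leq_eqVlt => /predU1P[->|].
    by rewrite coef_ramify g1n1 gn1 comp_polyC subnn muln0 mulr1.
  rewrite ltnS => le_in; rewrite coef_ramify coef_poly ltnS leqW //.
  rewrite mulrC divpK //.
  have [->|gi_n0] := eqVneq g`_i 0; first by rewrite comp_poly0 dvdp0.
  have [q _ ->] := Dg i gi_n0; rewrite dvdp_mulr // dvdp_exp2l //.
  by rewrite -weightK // leq_mul2r k_min ?orbT.
have le_i1n : (i1 <= n)%N by rewrite -ltnS ltn_ord.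
(* At an index of minimal slope the division removes exactly the power of [X] present, so this
   coefficient survives at the origin. *)
have ev_i1 : (ev0 g1)`_i1 != 0.
  have [q q0 Dq] := Dg i1 i1_n0.
  rewrite coef_map coef_poly ltnS leqW // Dq -weightK // mulKp ?q0 //.
  by rewrite monic_neq0 ?monicXn.
pose f := ev0 g1.
have mon_f : f \is monic by apply: monic_map.
have sz_f : size f = n.+2.
  by rewrite size_map_poly_id0 // (monicP mon_g1) /= /horner_eval hornerC oner_neq0.
have fn0 : f`_n = 0.
  by rewrite coef_map coef_poly leqnSn gn0 comp_poly0 div0p /= /horner_eval horner0.
have [c /rootP/rootP rfc] : exists c, root f c.
  by apply/closed_rootP; rewrite sz_f.
have [m [b]] := multiplicity_XsubC f c.
rewrite monic_neq0 //= => nr_b Df.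
have mon_Xc : ('X - c%:P) ^+ m \is monic by rewrite monic_exp ?monicXsubC.
have mon_b : b \is monic by move: mon_f; rewrite Df monicMr.
have m_gt0 : (0 < m)%N.
  by case: m Df {mon_Xc} => // Df; rewrite Df mulr1 (negPf nr_b) in rfc.
exists (('X - c%:P) ^+ m), b; split=> //.
- by rewrite coprimep_expl // coprimep_sym coprimep_XsubC.
- by rewrite mulrC -Df.
rewrite size_exp_XsubC ltnS m_gt0 /= ltnS ltnNge.
(* Otherwise the reduction is [(X - c) ^ n.+1]; its vanishing coefficient of index [n] forces
   [c = 0], against [ev_i1]. *)
apply/negP => le_nm.
have sz_b : size b = 1%N.
  have : (size f).-1 = (size b + m).-1.
    by rewrite Df size_Mmonic ?monic_neq0 // size_exp_XsubC addnS.
  move: (monic_neq0 mon_b); rewrite -size_poly_gt0 sz_f /=.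
  by move: (size b) le_nm => x; clear; lia.
have b1 : b = 1.
  have := monicP mon_b; rewrite lead_coefE sz_b /= => b0.
  by rewrite [b]size1_polyC ?sz_b // b0.
have Dm : m = n.+1.
  have : (size f).-1 = m by rewrite Df b1 mul1r size_exp_XsubC.
  by rewrite sz_f.
have c0 : c = 0.
  have /eqP := fn0; rewrite Df b1 mul1r Dm coef_XsubC_expSn.
  by rewrite oppr_eq0 mulrn_eq0 => /eqP.
case/negP: ev_i1; rewrite -/f Df b1 Dm c0 mul1r subr0 coefXn.
by rewrite ltn_eqF // ltnS.
Qed.

End Puiseux.

Section Puiseux.
Variable C : numClosedFieldType.
Implicit Types (P Q g : {poly {poly C}}) (a b : {poly C}).
Local Notation ev0 := (map_poly (horner_eval (0 : C))).
Local Notation ramify N := (map_poly (comp_poly ('X^N : {poly C}))).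

Lemma ramify_prod_dvX M N K g (hs : seq {poly C}) :
    dvX (N * K) (ramify N g - \prod_(h <- hs) ('X - h%:P)) ->
  dvX (N * M * K) (ramify (N * M) g
     - \prod_(h <- [seq h \Po 'X^M | h <- hs]) ('X - h%:P)).
Proof.
move=> dv; rewrite -ramify_mul -ramify_prod_XsubC -rmorphB.
by rewrite mulnAC mulnC; apply: dvX_ramify.
Qed.

(* Newton--Puiseux, truncated: [u = w ^ N], and the roots are found modulo
   [w ^ (N * K)], i.e. with precision [u ^ K]. *)
Lemma truncated_puiseux n K g : g \is monic -> size g = n.+1 ->
  exists N (hs : seq {poly C}), [/\ (0 < N)%N, size hs = n
    & dvX (N * K) (ramify N g - \prod_(h <- hs) ('X - h%:P))].
Proof.
elim/ltn_ind: n K g => -[_|n IH] K g mon_g sz_g.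
  exists 1%N, [::]; split=> //; rewrite big_nil => i.
  by have := size_monic_sub mon_g (monic1 _); rewrite sz_g size_poly1 => /(_ erefl);
     rewrite ltnS leqn0 size_poly_eq0 subr_eq0 => /eqP->; rewrite rmorph1 subrr coef0 dvdp0.
(* Tschirnhausen translation: the mean of the roots is moved to 0. *)
wlog gn0 : g mon_g sz_g / g`_n = 0.
  move=> wlog_gn; pose c : {poly C} := n.+1%:R^-1 *: g`_n.
  pose g' := g \Po ('X - c%:P).
  have sz_g' : size g' = n.+2 by rewrite size_comp_poly2 // size_XsubC.
  have gn1 : g`_n.+1 = 1 by have /monicP := mon_g; rewrite lead_coefE sz_g.
  have mon_g' : g' \is monic.
    by rewrite monicE lead_coef_comp ?size_XsubC // lead_coefXsubC expr1n mulr1.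
  have g'n0 : g'`_n = 0.
    rewrite coef_comp_poly sz_g !big_ord_recr /= big1 ?add0r => [|i _].
      rewrite gn1 mul1r coef_XsubC_expSn.
      have := monicP (monic_exp n (monicXsubC c)).
      rewrite lead_coefE size_exp_XsubC /= => ->.
      by rewrite mulr1 /c -scaler_nat scalerA mulfV ?pnatr_eq0 // scale1r subrr.
    by rewrite [X in _ * X]nth_default ?mulr0 // size_exp_XsubC.
  have [N [hs [N_gt0 sz_hs dv]]] := wlog_gn g' mon_g' sz_g' g'n0.
  pose cN := c \Po 'X^N.
  exists N, [seq h - cN | h <- hs]; split; rewrite ?size_map //.
  have -> : ramify N g = (ramify N g') \Po ('X + cN%:P).
    rewrite /g' map_comp_poly rmorphB /= map_polyX map_polyC /=.
    have := comp_polyXaddC_K (ramify N g) (- cN).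
    by rewrite polyCN opprK => ->.
  have -> : \prod_(h <- [seq h - cN | h <- hs]) ('X - h%:P) =
      (\prod_(h <- hs) ('X - h%:P)) \Po ('X + cN%:P).
    rewrite rmorph_prod big_map; apply: eq_bigr => h _ /=.
    by rewrite comp_polyB comp_polyX comp_polyC polyCB opprB addrA addrAC.
  rewrite -rmorphB /=; have [r -> _] := dvXP dv.
  by rewrite comp_polyZ; apply: dvX_scale.
(* If all lower coefficients vanish to precision [u ^ K], the root 0 repeated [n.+1] times is
   accurate enough, without ramification. *)
have [dvg|] := boolP [forall i : 'I_n.+1, 'X^K %| g`_i].
  exists 1%N, (nseq n.+1 0); rewrite size_nseq big_nseq iter_mulr_1 subr0.
  split=> // i; rewrite mul1n coefB coefXn coef_map expr1 /= comp_polyXr.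
  have [lt_in|gt_in|->] := ltngtP i n.+1.
  - by rewrite subr0; apply: (forallP dvg (Ordinal lt_in)).
  - by rewrite subr0 nth_default ?sz_g ?dvdp0.
  - have /monicP := mon_g; rewrite lead_coefE sz_g /= => ->.
    by rewrite subrr dvdp0.
rewrite negb_forall => /existsP[i0 ndv].
have [|N [k [g1 [N_gt0 mon_g1 sz_g1 Dg1 [a [b]]]]]] :=
  @newton_polygon_step _ n K g mon_g sz_g gn0.
  by exists i0; rewrite // -ltnS.
move=> [mon_a mon_b cop_ab Dab /andP[a_gt1 a_ltn]].
(* Precision [N * K] in the ramified variable is precision [K] in the original one. *)
have [A [B [[monA monB] [evA evB] sA sB dvAB]]] :=
  hensel (N * K) mon_g1 mon_a mon_b cop_ab Dab.
have sz_ab : (size a + size b = n.+3)%N.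
  have : size (a * b) = n.+2.
    rewrite -Dab size_map_poly_id0 // (monicP mon_g1).
    by rewrite /= /horner_eval hornerC oner_neq0.
  rewrite size_mul ?monic_neq0 //.
  move: (monic_neq0 mon_b); rewrite -size_poly_gt0; move: a_gt1; clear=> /=.
  by move: (size a) (size b) => x y; lia.
have [||NA [hA [NA_gt0 sz_hA dvA]]] := IH (size a).-1 _ (N * K)%N A monA.
- by move: a_gt1 a_ltn; clear=> /=; move: (size a) => x; lia.
- by rewrite sA prednK // (ltn_trans _ a_gt1).
have [||NB [hB [NB_gt0 sz_hB dvB]]] := IH (size b).-1 _ (N * K)%N B monB.
- by move: a_gt1 a_ltn sz_ab; clear=> /=; move: (size a) (size b) => x y; lia.
- by rewrite sB prednK // size_poly_gt0 monic_neq0.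
(* The two factors are brought to the common ramification [NA * NB]. *)
have {dvA} dvA := ramify_prod_dvX NB dvA.
have {dvB} dvB := ramify_prod_dvX NA dvB.
rewrite [(NB * NA)%N]mulnC in dvB; set P := (NA * NB)%N in dvA dvB.
set hA' := map _ hA in dvA; set hB' := map _ hB in dvB.
(* Multiplication by [t] undoes the rescaling of the roots made by [newton_polygon_step]. *)
pose t : {poly C} := 'X^(k * P); pose hs := hA' ++ hB'.
have sz_hs : size hs = n.+1.
  rewrite size_cat !size_map sz_hA sz_hB.
  by move: a_gt1 a_ltn sz_ab; clear=> /=; move: (size a) (size b) => x y; lia.
have dvg1 : dvX (P * (N * K)) (ramify P g1 - \prod_(h <- hs) ('X - h%:P)).
  have -> : ramify P g1 - \prod_(h <- hs) ('X - h%:P) =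
     ramify P (g1 - A * B)
     + (ramify P A - \prod_(h <- hA') ('X - h%:P)) * ramify P B
     + (ramify P B - \prod_(h <- hB') ('X - h%:P))
        * \prod_(h <- hA') ('X - h%:P).
    by rewrite big_cat rmorphB rmorphM /=; ring.
  apply: dvXD; last exact: dvXM.
  by apply: dvXD; [apply: dvX_ramify | apply: dvXM].
exists (N * P)%N, [seq t * h | h <- hs]; split.
- by rewrite !muln_gt0 N_gt0 NA_gt0.
- by rewrite size_map.
move=> i; rewrite coefB.
have [le_in|lt_ni] := leqP i n.+1; last first.
  by rewrite !nth_default ?subrr ?dvdp0 // ?size_prod_XsubC ?size_map ?sz_hs //
     (leq_trans (size_poly _ _)) ?sz_g.
rewrite big_map coef_prod_scaled_roots ?sz_hs // -ramify_mul coef_map Dg1 //=.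
rewrite comp_polyM comp_Xn_poly -exprM.
have -> : (P * (k * (n.+1 - i)) = k * P * (n.+1 - i))%N by ring.
rewrite [X in X * _]exprM -mulrBr dvdp_mull //.
by rewrite mulnAC mulnC -coef_ramify -coefB; apply: dvg1.
Qed.

End Puiseux.

(** * Roots of the derivative, and orders of vanishing at the origin *)

Lemma sum_count_mem (T : eqType) (u s : seq T) : uniq u ->
  (\sum_(c <- u) count_mem c s)%N = count (mem u) s.
Proof.
move=> uniq_u; elim: s => [|x s IH] /=; first by rewrite big1.
rewrite big_split /= IH; congr (_ + _)%N.
rewrite -(count_uniq_mem x uniq_u) -sum1_count [RHS]big_mkcond /=.
by apply: eq_bigr => c _; rewrite eq_sym; case: (_ == _).
Qed.

(** A root of multiplicity [m] of [f] is one of multiplicity [m - 1] of its derivative; summing over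
    the distinct roots counts the critical points lying on the zero set. *)
Lemma count_deriv_roots (C : numClosedFieldType) (f : {poly C}) l k rs hs :
    l != 0 -> k != 0 -> f = l *: \prod_(c <- rs) ('X - c%:P) ->
    f^`() = k *: \prod_(c <- hs) ('X - c%:P) ->
  (count (root f) hs + size (undup rs) = size rs)%N.
Proof.
move=> l_n0 k_n0 Df Df'.
have mup_scale a (p : {poly C}) x : a != 0 -> mup x (a *: p) = mup x p.
  by move=> a_n0; rewrite -mul_polyC mupMr // rootC.
have f_n0 : f != 0.
  by rewrite Df scaler_eq0 (negPf l_n0) /= monic_neq0 // monic_prod_XsubC.
have mup_f c : mup c f = count_mem c rs by rewrite Df mup_scale // mu_prod_XsubC.
have mup_f' c : mup c f^`() = count_mem c hs.
  by rewrite Df' mup_scale // mu_prod_XsubC.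
have root_f c : root f c = (c \in undup rs).
  by rewrite mem_undup Df rootZ // root_prod_XsubC.
have count_f c : c \in undup rs -> (count_mem c hs).+1 = count_mem c rs.
  rewrite -root_f => rfc; rewrite -mup_f' -mup_f.
  have [[|m] [q]] := multiplicity_XsubC f c; rewrite f_n0 /= => nr_q Dfc.
    by rewrite Dfc mulr1 (negPf nr_q) in rfc.
  rewrite {2}Dfc mupMr // mup_XsubCX eqxx.
  rewrite Dfc !derivCE exprS mul1r mulrnAr -mulrnAl mulrA -mulrDl.
  rewrite mupMr ?mup_XsubCX ?eqxx // rootE !(hornerE, hornerMn).
  by rewrite subrr mulr0 add0r mulrn_eq0.
rewrite (@eq_count _ _ (mem (undup rs))) // -sum_count_mem ?undup_uniq //.
rewrite -[X in _ = X]count_predT -(@eq_in_count _ (mem (undup rs)) predT); last first.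
  by move=> c c_rs /=; rewrite mem_undup c_rs.
rewrite -sum_count_mem ?undup_uniq // -sum1_size -big_split /=.
by apply: eq_big_seq => c /count_f <-; rewrite addn1.
Qed.

Section Order.
Variable C : numClosedFieldType.
Implicit Types (P Q g : {poly {poly C}}) (a b : {poly C}).
Local Notation ev0 := (map_poly (horner_eval (0 : C))).
Local Notation ramify N := (map_poly (comp_poly ('X^N : {poly C}))).

Lemma dvdX_prod (I : Type) (s : seq I) (F G : I -> {poly C}) K :
    (forall i, 'X^K %| F i - G i) ->
  'X^K %| \prod_(i <- s) F i - \prod_(i <- s) G i.
Proof.
move=> dFG; elim: s => [|i s IH]; first by rewrite !big_nil subrr dvdp0.
rewrite !big_cons.
have -> : F i * \prod_(j <- s) F j - G i * \prod_(j <- s) G j =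
  (F i - G i) * \prod_(j <- s) F j
  + G i * (\prod_(j <- s) F j - \prod_(j <- s) G j) by ring.
by apply: dvdp_add; [apply: dvdp_mulr | apply: dvdp_mull].
Qed.

Lemma dvdX_det n (A B : 'M[{poly C}]_n) K :
  (forall i j, 'X^K %| A i j - B i j) -> 'X^K %| \det A - \det B.
Proof.
move=> dAB; rewrite -sumrB; apply: (big_ind (fun x => 'X^K %| x)).
- exact: dvdp0.
- by move=> x y dx dy; rewrite dvdp_addl.
- by move=> s _; rewrite -mulrBr dvdp_mull // dvdX_prod.
Qed.

(** Equal sizes give Sylvester matrices of the same format with congruent entries. The format is a
    parameter of [syl] because the type of the matrix depends on it. *)
Lemma dvdX_resultant K (Q P1 P2 : {poly {poly C}}) :
    size P1 = size P2 -> dvX K (P1 - P2) ->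
  'X^K %| resultant Q P1 - resultant Q P2.
Proof.
move=> eq_sz dvP.
pose syl m n P : 'M[{poly C}]_(m + n) := \matrix_(i, j)
  match fintype.split i with
  | inl k => Q`_(j - k) *+ (k <= j)
  | inr k => P`_(j - k) *+ (k <= j) end.
have syl_res P : resultant Q P = \det (syl (size P).-1 (size Q).-1 P).
  by congr (\det _); apply/matrixP => i j; rewrite Sylvester_mxE !mxE.
rewrite !syl_res eq_sz; apply: dvdX_det => i j; rewrite !mxE.
case: fintype.split => k; first by rewrite subrr dvdp0.
by rewrite -mulrnBl -coefB -mulr_natr dvdp_mulr.
Qed.

Lemma dvdX_mup a k : a != 0 -> ('X^k %| a) = (k <= mup 0 a)%N.
Proof. by move=> a_n0; rewrite mup_geq // subr0. Qed.

Lemma mupX a k : a != 0 -> mup 0 a = k ->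
  exists2 q : {poly C}, q.[0] != 0 & a = 'X^k * q.
Proof.
move=> a_n0; have [m [q]] := multiplicity_XsubC a 0.
rewrite a_n0 /= subr0 => nr_q -> <-; exists q; first exact: nr_q.
have := mup_XsubCX m (0 : C) 0; rewrite subr0 eqxx => mupXm.
by rewrite mupMr // mupXm mulrC.
Qed.

Lemma mupXn q k : q.[0] != 0 -> mup 0 ('X^k * q : {poly C}) = k.
Proof.
move=> q0; rewrite mupMl //.
by have := mup_XsubCX k (0 : C) 0; rewrite subr0 eqxx.
Qed.

Lemma mup_congr K a b : a != 0 -> (mup 0 a < K)%N -> 'X^K %| b - a ->
  b != 0 /\ mup 0 b = mup 0 a.
Proof.
move=> a_n0 lt_aK /dvdpP[z Dz].
have [q q0 Da] := mupX a_n0 erefl.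
have Db : b = 'X^(mup 0 a) * (q + z * 'X^(K - mup 0 a)).
  apply/eqP; rewrite mulrDr -Da mulrCA -exprD subnKC 1?ltnW // -Dz.
  by rewrite addrC subrK.
have r0 : (q + z * 'X^(K - mup 0 a)).[0] != 0.
  by rewrite !hornerE expr0n subn_eq0 leqNgt lt_aK /= mulr0 addr0.
split; last by rewrite Db mupXn.
by rewrite Db mulf_eq0 negb_or monic_neq0 ?monicXn //=; apply: contraNneq r0 => ->;
  rewrite horner0.
Qed.

Lemma mup_comp_Xn N a : (0 < N)%N -> a != 0 ->
  a \Po 'X^N != 0 /\ mup 0 (a \Po 'X^N) = (N * mup 0 a)%N.
Proof.
move=> N_gt0 a_n0; have [q q0 Da] := mupX a_n0 erefl.
have r0 : (q \Po 'X^N).[0] != 0.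
  by rewrite horner_comp hornerXn expr0n gtn_eqF.
have Dc : a \Po 'X^N = 'X^(N * mup 0 a) * (q \Po 'X^N).
  by rewrite {1}Da comp_polyM comp_Xn_poly -exprM.
split; last by rewrite Dc mupXn.
by rewrite Dc mulf_eq0 negb_or monic_neq0 ?monicXn //=; apply: contraNneq r0 => ->;
  rewrite horner0.
Qed.

Lemma deriv_horner P (h : {poly C}) :
  (P.[h])^`() = (map_poly (@deriv C) P).[h] + P^`().[h] * h^`().
Proof.
elim/poly_ind: P => [|P c IH].
  by rewrite map_poly0 deriv0 !horner0 deriv0 mul0r addr0.
have -> : map_poly (@deriv C) (P * 'X + c%:P)
   = map_poly (@deriv C) P * 'X + (c^`())%:P.
  apply/polyP => i; rewrite coef_map_id0 ?deriv0 // !coefD !coefMX !coefC.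
  by rewrite derivD; case: i => [|i] /=; rewrite ?deriv0 ?coef_map_id0 ?deriv0.
rewrite derivD derivC addr0 derivM derivX mulr1 !hornerE derivD derivM IH.
ring.
Qed.

Lemma mup_prod (I : Type) (s : seq I) (F : I -> {poly C}) :
  \prod_(i <- s) F i != 0 ->
  mup 0 (\prod_(i <- s) F i) = (\sum_(i <- s) mup 0 (F i))%N.
Proof.
elim: s => [|i s IH]; first by rewrite !big_nil mupNroot ?root1.
by rewrite !big_cons mulf_eq0 negb_or => /andP[Fi Fs]; rewrite mupM // IH.
Qed.

End Order.

(** * The polar resultant *)

Definition polar (A : comNzRingType) (lam : A) (f : {poly {poly A}}) : {poly A} :=
  resultant (map_poly (@deriv A) f + lam%:P *: f) f^`().

Section Order.
Variable C : numClosedFieldType.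
Implicit Types (P Q g : {poly {poly C}}) (a b : {poly C}).
Local Notation ev0 := (map_poly (horner_eval (0 : C))).
Local Notation ramify N := (map_poly (comp_poly ('X^N : {poly C}))).

Lemma ev0_ramify N P : (0 < N)%N -> ev0 (ramify N P) = ev0 P.
Proof.
move=> N_gt0; apply/polyP => i; rewrite !coef_map /= /horner_eval.
by rewrite horner_comp hornerXn expr0n gtn_eqF.
Qed.

Lemma ev0_horner P (h : {poly C}) : (P.[h]).[0] = (ev0 P).[h.[0]].
Proof. exact: (esym (horner_map (horner_eval (0 : C)) P h)). Qed.

(* With [v_h] the value of [f] along a root [h] of [df/dy], one has
   [dv_h/du = df/du (h)]; hence each root at which [v_h] vanishes contributes
   one less to the order of the polar resultant than to that of the
   discriminant, the other roots contributing nothing. *)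
Lemma polar_order0 (f : {poly {poly C}}) (l : C) (rs : seq C) :
    (1 < size f)%N -> lead_coef f = l%:P -> l != 0 ->
    ev0 f = l *: \prod_(c <- rs) ('X - c%:P) ->
    resultant f f^`() != 0 ->
  let e := mup 0 (resultant f f^`()) in
  let Z := (size rs - size (undup rs))%N in
  [/\ (Z <= e)%N,
      forall lam, lam != 0 -> 'X^(e - Z) %| polar lam f
    & exists bad : seq C, forall lam, lam != 0 -> lam \notin bad ->
        ~~ ('X^((e - Z).+1) %| polar lam f)].
Proof.
move=> sz_f lc_f l_n0 Df D_n0 e Z.
have [n sz_fE] : exists n, size f = n.+2 by case: (size f) sz_f => [|[|n]]; last exists n.
pose kap := l *+ n.+1.
have kap_n0 : kap != 0 by rewrite mulrn_eq0.
have coef_f' : (f^`())`_n = kap%:P.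
  rewrite coef_deriv; have := lc_f; rewrite lead_coefE sz_fE /= => ->.
  by rewrite -polyCMn.
have sz_f' : size f^`() = n.+1.
  apply/eqP; rewrite eqn_leq; apply/andP; split.
    by rewrite -ltnS -sz_fE lt_size_deriv // -size_poly_gt0 sz_fE.
  by rewrite ltnNge; apply/negP => /leq_sizeP/(_ n (leqnn n))/eqP;
    rewrite coef_f' polyC_eq0 (negPf kap_n0).
pose g : {poly {poly C}} := (kap^-1)%:P *: f^`().
have Df' : f^`() = kap%:P *: g.
  by rewrite scalerA -polyCM mulfV // scale1r.
have sz_g : size g = n.+1 by rewrite size_scale ?polyC_eq0 ?invr_eq0.
have mon_g : g \is monic.
  by rewrite monicE lead_coefE sz_g coefZ coef_f' -polyCM mulVf.
(* In the variable [w] the orders to be determined are at most [N * e], which this precision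
   exceeds. *)
have [N [hs [N_gt0 sz_hs dvg]]] := truncated_puiseux e.+2 mon_g sz_g.
set K := (N * e.+2)%N in dvg.
pose Pi : {poly {poly C}} := \prod_(h <- hs) ('X - h%:P).
have sz_Pi : size Pi = n.+1 by rewrite size_prod_XsubC sz_hs.
have lt_eK : (N * e < K)%N by rewrite ltn_mul2l N_gt0 /= ltnW.
pose v (h : {poly C}) : {poly C} := (ramify N f).[h].
pose w (h : {poly C}) : {poly C} := (ramify N (map_poly (@deriv C) f)).[h].
have ramify_n0 P : (exists2 c : C, c != 0 & lead_coef P = c%:P) ->
    comp_poly 'X^N (lead_coef P) != 0.
  by move=> [c c_n0 ->]; rewrite /= comp_polyC polyC_eq0.
have lc_f' : lead_coef f^`() = kap%:P by rewrite lead_coefE sz_f' coef_f'.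
(* Product formula for the resultant with the approximate roots [hs] in place of the roots of the
   derivative, valid modulo [w ^ K]. *)
have resE Q (m : C) : m != 0 -> lead_coef Q = m%:P ->
    'X^K %| (resultant Q f^`()) \Po 'X^N
       - (kap%:P : {poly C}) ^+ (size (ramify N Q)).-1
         * \prod_(h <- hs) (ramify N Q).[h].
  move=> m_n0 lcQ.
  have -> : resultant Q f^`() \Po 'X^N = resultant (ramify N Q) (ramify N f^`()).
    by apply: map_resultant; apply: ramify_n0; [exists m | exists kap].
  rewrite -(@resultant_prod_XsubC _ _ (kap%:P *: Pi) kap%:P hs) ?polyC_eq0 //.
  apply: dvdX_resultant.
    rewrite size_scale ?polyC_eq0 // sz_Pi size_map_poly_id0 ?sz_f' //.
    by apply: ramify_n0; exists kap.
  have -> : ramify N f^`() = kap%:P *: ramify N g.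
    by rewrite Df' linearZ /= comp_polyC.
  by rewrite -scalerBr -mul_polyC mulrC; apply: dvXM.
have ev_gPi : ev0 g = \prod_(c <- [seq h.[0] | h <- hs]) ('X - c%:P).
  rewrite -(ev0_ramify g N_gt0) -[ramify N g](subrK Pi) rmorphD /=.
  have [r Dr _] := dvXP dvg; rewrite -/Pi in Dr.
  rewrite Dr ev0Z hornerXn expr0n eqn0Ngt muln_gt0 N_gt0 /= scale0r add0r.
  rewrite rmorph_prod big_map; apply: eq_bigr => h _.
  by rewrite rmorphB /= map_polyX map_polyC.
have ev_f' : (ev0 f)^`() = kap *: \prod_(c <- [seq h.[0] | h <- hs]) ('X - c%:P).
  rewrite deriv_map Df' -ev_gPi.
  by rewrite ev0Z hornerC.
have count_Z : count (fun h => (v h).[0] == 0) hs = Z.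
  have := count_deriv_roots l_n0 kap_n0 Df ev_f'; rewrite count_map /Z => <-.
  rewrite addnK; apply: eq_count => h /=.
  by rewrite /v ev0_horner ev0_ramify.
(* In the chain rule the term with the derivative in [y] vanishes modulo [w ^ K], since [h] is a
   root to that precision; the factor [N w ^ (N - 1)] is [du/dw]. *)
have dv_deriv h : h \in hs ->
    'X^K %| (v h)^`() - (N%:R * 'X^(N.-1)) * w h.
  move=> h_hs; rewrite deriv_horner.
  have -> : map_poly (@deriv C) (ramify N f) =
      (N%:R * 'X^(N.-1)) *: ramify N (map_poly (@deriv C) f).
    apply/polyP => i.
    rewrite coefZ coef_map_id0 ?deriv0 // [in LHS]coef_map [in RHS]coef_map /=.
    rewrite [in RHS]coef_map_id0 ?deriv0 //= deriv_comp derivXn.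
    by rewrite mulrC mulr_natl.
  rewrite hornerZ addrC addKr deriv_map Df' linearZ /= hornerZ comp_polyC.
  rewrite dvdp_mulr // dvdp_mull // -[ramify N g](subrK Pi) hornerD.
  have /rootP -> : root Pi h by rewrite root_prod_XsubC.
  by have [r -> _] := dvXP dvg; rewrite hornerZ addr0 dvdp_mulr.
have [prod_n0 mup_prod_v] : \prod_(h <- hs) v h != 0 /\
    mup 0 (\prod_(h <- hs) v h) = (N * e)%N.
  have := resE f l l_n0 lc_f; set c := kap%:P ^+ _; rewrite -dvdpNr opprB => dv.
  have [DN_n0 mupDN] := mup_comp_Xn N_gt0 D_n0.
  have [|cv_n0 mup_cv] := mup_congr DN_n0 _ dv; first by rewrite mupDN.
  have c0 : ~~ root c 0.
    by rewrite rootE /c horner_exp hornerC expf_neq0.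
  split; first by apply: contraNneq cv_n0 => ->; rewrite mulr0.
  by rewrite -mupDN -mup_cv mupMr.
have v_n0 h : h \in hs -> v h != 0.
  by move=> h_hs; apply: contraNneq prod_n0 => vh0; rewrite prodf_seq_eq0;
     apply/hasP; exists h; rewrite ?vh0 /=.
have sum_v : (\sum_(h <- hs) mup 0 (v h) = N * e)%N by rewrite -mup_prod.
have le_mv h : h \in hs -> (mup 0 (v h) <= N * e)%N.
  by move=> h_hs; rewrite -sum_v (big_rem h) //= leq_addr.
(* Order of [F lam h] for generic [lam]. Where [v h] vanishes at the origin, [dv_deriv] makes its
   order exceed that of [w h] by [N], so [w h] dominates whatever [lam] is. *)
pose o h := (mup 0 (v h) - (if ((v h).[0%R] == 0)%R then N else 0))%N.
pose F (lam : C) (h : {poly C}) : {poly C} := w h + lam%:P * v h.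
have v0P h : h \in hs -> (v h).[0] == 0 -> [/\ w h != 0,
    mup 0 (v h) = (N + mup 0 (w h))%N & o h = mup 0 (w h)].
  move=> h_hs vh0; have [q q0 Dv] := mupX (v_n0 h h_hs) erefl.
  case Dk: (mup 0 (v h)) Dv => [|k] Dv.
    by move: vh0; rewrite Dv mul1r (negPf q0).
  have r0 : (k.+1%:R *: q + 'X * q^`()).[0] != 0.
    by rewrite !hornerE ?mul0r ?addr0 mulf_neq0 // pnatr_eq0.
  have Dv' : (v h)^`() = 'X^k * (k.+1%:R *: q + 'X * q^`()).
    rewrite Dv derivM derivXn /= exprSr -mul_polyC polyCMn polyC1.
    by rewrite -mulr_natl; ring.
  have v'_n0 : (v h)^`() != 0.
    by rewrite Dv' mulf_eq0 negb_or monic_neq0 ?monicXn //=;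
       apply: contraNneq r0 => ->; rewrite horner0.
  have mup_v' : mup 0 (v h)^`() = k by rewrite Dv' mupXn.
  have lt_kK : (k < K)%N.
    by have := le_mv h h_hs; rewrite Dk => /leq_trans; apply; apply: ltnW.
  have := dv_deriv h h_hs; rewrite -dvdpNr opprB => /(mup_congr v'_n0).
  rewrite mup_v' => /(_ lt_kK)[].
  rewrite mulf_eq0 negb_or => /andP[_ w_n0].
  rewrite -mulrA -polyC_natr mupMr ?rootC ?pnatr_eq0 -?lt0n //.
  rewrite mupM ?w_n0 ?(monic_neq0 (monicXn _ _)) //.
  have := mup_XsubCX N.-1 (0 : C) 0; rewrite subr0 eqxx => -> Dmk.
  have Dk' : k.+1 = (N + mup 0 (w h))%N by rewrite -Dmk -addSn prednK.
  by split; rewrite // /o vh0 Dk Dk' addKn.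
have F_dv lam h : h \in hs -> 'X^(o h) %| F lam h.
  move=> h_hs; have [vh0|vh_n0] := boolP ((v h).[0] == 0); last first.
    have -> : o h = 0%N.
      by rewrite /o (negPf vh_n0) mupNroot.
    exact: dvd1p.
  have [w_n0 Dv ->] := v0P h h_hs vh0.
  apply: dvdp_add; first by rewrite dvdX_mup.
  by apply: dvdp_mull; rewrite dvdX_mup ?v_n0 // Dv leq_addl.
have mup_F lam h : h \in hs -> ((v h).[0] != 0 -> (F lam h).[0] != 0) ->
    F lam h != 0 /\ mup 0 (F lam h) = o h.
  move=> h_hs; have [vh0 _|vh_n0 /(_ isT) F0] := boolP ((v h).[0] == 0); last first.
    split; first by apply: contraNneq F0 => ->; rewrite horner0.
    by rewrite mupNroot // /o (negPf vh_n0) mupNroot.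
  have [w_n0 Dv Do] := v0P h h_hs vh0; rewrite Do.
  apply: (@mup_congr _ (mup 0 (w h)).+1) => //.
  rewrite /F addrC addKr; apply: dvdp_mull; rewrite dvdX_mup ?v_n0 // Dv.
  by rewrite -addn1 addnC leq_add2r.
have sum_o : (\sum_(h <- hs) o h + N * Z = N * e)%N.
  have -> : (N * Z = \sum_(h <- hs) if ((v h).[0%R] == 0)%R then N else 0)%N.
    rewrite -count_Z -sum1_count big_distrr /= -big_mkcond /=.
    by apply: eq_bigr => h _; rewrite muln1.
  rewrite -sum_v -big_split /=.
  apply: eq_big_seq => h h_hs; rewrite /o; case: ifP => vh0.
    have [_ Dv _] := v0P h h_hs vh0.
    by rewrite subnK // Dv leq_addr.
  by rewrite addn0 subn0.
have le_Ze : (Z <= e)%N.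
  by rewrite -(leq_pmul2l N_gt0) -sum_o leq_addl.
have {}sum_o : (\sum_(h <- hs) o h = N * (e - Z))%N.
  by rewrite mulnBr -sum_o addnK.
have le_ZK : (N * (e - Z) < K)%N.
  by rewrite (leq_ltn_trans _ lt_eK) // leq_mul2l leq_subr orbT.
have prod_dv lam : 'X^(N * (e - Z)) %| \prod_(h <- hs) F lam h.
  rewrite -sum_o; elim: (hs) F_dv => [|h s IH] F_dv.
    by rewrite !big_nil dvdpp.
  rewrite !big_cons exprD dvdp_mul ?F_dv ?mem_head // IH // => lam' h' h'_s.
  by rewrite F_dv // in_cons h'_s orbT.
pose Q (lam : C) : {poly {poly C}} := map_poly (@deriv C) f + lam%:P *: f.
have lc_Q lam : lam != 0 -> lead_coef (Q lam) = (lam * l)%:P.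
  move=> lam_n0; have sz_lf : size (lam%:P *: f) = n.+2.
    by rewrite size_scale ?polyC_eq0.
  rewrite /Q lead_coefDr ?lead_coefZ ?lc_f ?polyCM // sz_lf ltnS.
  apply/leq_sizeP => j; rewrite leq_eqVlt coef_map_id0 ?deriv0 //.
  case/predU1P=> [<-|lt_j]; last by rewrite nth_default ?deriv0 // sz_fE.
  by have := lc_f; rewrite lead_coefE sz_fE /= => ->; rewrite derivC.
have hornerQ lam h : (ramify N (Q lam)).[h] = F lam h.
  by rewrite /Q rmorphD /= linearZ /= comp_polyC hornerD hornerZ.
have resQ lam : lam != 0 -> exists2 c : C, c != 0 & 'X^K %|
    polar lam f \Po 'X^N - c%:P * \prod_(h <- hs) F lam h.
  move=> lam_n0; exists (kap ^+ (size (ramify N (Q lam))).-1).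
    by rewrite expf_neq0.
  have := resE (Q lam) (lam * l) (mulf_neq0 lam_n0 l_n0) (lc_Q lam lam_n0).
  rewrite rmorphXn /=; congr (_ %| _ - _ * _).
  by apply: eq_bigr => h _; rewrite hornerQ.
split=> // [lam lam_n0|].
  have [->|pol_n0] := eqVneq (polar lam f) 0; first exact: dvdp0.
  rewrite dvdX_mup // -(leq_pmul2l N_gt0).
  have [pN_n0 <-] := mup_comp_Xn N_gt0 pol_n0; rewrite -dvdX_mup //.
  have [c _ dv] := resQ lam lam_n0.
  rewrite -[_ \Po _](subrK (c%:P * \prod_(h <- hs) F lam h)).
  apply: dvdp_add; last by apply: dvdp_mull; apply: prod_dv.
  by apply: dvdp_trans dv; rewrite dvdp_exp2l // ltnW.
(* The values of [lam] at which [F lam h] vanishes at the origin although [v h] does not. *)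
exists [seq - ((w h).[0] / (v h).[0]) | h <- hs] => lam lam_n0 nbad.
have mupF h : h \in hs -> F lam h != 0 /\ mup 0 (F lam h) = o h.
  move=> h_hs; apply: mup_F => // vh_n0; rewrite !hornerE.
  apply: contra nbad => /eqP eq0; apply/mapP; exists h => //.
  apply: (mulIf vh_n0); rewrite mulNr mulfVK //; apply/eqP.
  by rewrite -addr_eq0 addrC eq0.
have [c c_n0 dv] := resQ lam lam_n0.
have PF_n0 : \prod_(h <- hs) F lam h != 0.
  rewrite prodf_seq_neq0; apply/allP => h h_hs /=.
  by have [-> _] := mupF h h_hs.
have mup_cF : mup 0 (c%:P * \prod_(h <- hs) F lam h) = (N * (e - Z))%N.
  rewrite mupMr ?rootC // mup_prod // -sum_o.
  by apply: eq_big_seq => h /mupF[].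
have cF_n0 : c%:P * \prod_(h <- hs) F lam h != 0.
  by rewrite mulf_neq0 // polyC_eq0.
have [|polN_n0] := mup_congr cF_n0 _ dv; first by rewrite mup_cF.
have pol_n0 : polar lam f != 0.
  by apply: contraNneq polN_n0 => ->; rewrite comp_poly0.
have [_ ->] := mup_comp_Xn N_gt0 pol_n0; rewrite mup_cF => /eqP.
rewrite eqn_pmul2l // => /eqP mup_pol.
by rewrite dvdX_mup // mup_pol ltnn.
Qed.

End Order.

Lemma map_polar (A B : comNzRingType) (phi : {rmorphism A -> B}) lam
    (f : {poly {poly A}}) :
    map_poly phi (lead_coef (map_poly (@deriv A) f + lam%:P *: f)) != 0 ->
    map_poly phi (lead_coef f^`()) != 0 ->
  map_poly phi (polar lam f) = polar (phi lam) (map_poly (map_poly phi) f).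
Proof.
move=> lc1 lc2; rewrite /polar map_resultant // deriv_map rmorphD /=.
congr (resultant (_ + _) _); last by rewrite linearZ /= map_polyC.
by apply/polyP => i; rewrite !coef_map_id0 ?deriv0 ?rmorph0 // deriv_map.
Qed.

Section PolarLead.
Variables (C : numFieldType) (f : {poly {poly C}}) (l : C).
Hypotheses (sz_f : (1 < size f)%N) (lc_f : lead_coef f = l%:P) (l_n0 : l != 0).

(** The leading coefficient of [f] has derivative zero, so [lam f] alone contributes in top
    degree. *)
Lemma lead_coef_polar lam : lam != 0 ->
  lead_coef (map_poly (@deriv C) f + lam%:P *: f) = (lam * l)%:P.
Proof.
move=> lam_n0; have sz_lf : size (lam%:P *: f) = size f.
  by rewrite size_scale ?polyC_eq0.
rewrite lead_coefDr ?lead_coefZ ?lc_f ?polyCM // sz_lf.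
rewrite -(ltn_predK sz_f) ltnS; apply/leq_sizeP => j.
rewrite leq_eqVlt coef_map_id0 ?deriv0 //.
case/predU1P=> [<-|lt_j]; last first.
  by rewrite nth_default ?deriv0 // -(ltn_predK sz_f).
by rewrite -lead_coefE lc_f derivC.
Qed.

Lemma lead_coef_deriv_const : lead_coef f^`() = (l *+ (size f).-1)%:P /\
  size f^`() = (size f).-1.
Proof.
case Dn: (size f) sz_f => [|[|n]] // _.
have coef_f' : (f^`())`_n = (l *+ n.+1)%:P.
  by rewrite coef_deriv; have := lc_f; rewrite lead_coefE Dn /= => ->; rewrite -polyCMn.
have sz_f' : size f^`() = n.+1.
  apply/eqP; rewrite eqn_leq; apply/andP; split.
    by rewrite -ltnS -Dn lt_size_deriv // -size_poly_gt0 Dn.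
  rewrite ltnNge; apply/negP => /leq_sizeP/(_ n (leqnn n))/eqP.
  by rewrite coef_f' polyC_eq0 mulrn_eq0 (negPf l_n0).
by rewrite lead_coefE sz_f' coef_f'.
Qed.

End PolarLead.

Section Shift.
Variables (C : fieldType) (a : C).
Implicit Type p : {poly C}.

Lemma dvdp_shift k p : ('X^k %| p \Po ('X + a%:P)) = (('X - a%:P) ^+ k %| p).
Proof.
apply/idP/idP => /dvdpP[q Dq].
  rewrite -(comp_polyXaddC_K p a) Dq comp_polyM comp_Xn_poly dvdp_mull //.
by rewrite Dq comp_polyM rmorphXn /= comp_polyB comp_polyX comp_polyC addrK dvdp_mull.
Qed.

Lemma mup_shift p : p != 0 -> mup 0 (p \Po ('X + a%:P)) = mup a p.
Proof.
move=> p_n0.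
have pa_n0 : p \Po ('X + a%:P) != 0.
  apply: contraNneq p_n0 => pa0.
  by rewrite -(comp_polyXaddC_K p a) pa0 comp_poly0.
apply/eqP; rewrite eqn_leq mup_geq // -dvdp_shift.
have := @mup_geq _ 0 (p \Po ('X + a%:P)) (mup 0 (p \Po ('X + a%:P))) pa_n0.
rewrite subr0 leqnn => <- /=.
by rewrite mup_geq // subr0 dvdp_shift -mup_geq.
Qed.

End Shift.

(** Translation by [a] in the inner variable commutes with the derivatives and the resultants
    involved, which reduces the claim to the origin. *)
Lemma polar_order (C : numClosedFieldType) (f : {poly {poly C}}) (l a : C) rs :
    (1 < size f)%N -> lead_coef f = l%:P -> l != 0 ->
    map_poly (horner_eval a) f = l *: \prod_(c <- rs) ('X - c%:P) ->
    resultant f f^`() != 0 ->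
  let e := mup a (resultant f f^`()) in
  let Z := (size rs - size (undup rs))%N in
  [/\ (Z <= e)%N,
      forall lam, lam != 0 -> ('X - a%:P) ^+ (e - Z) %| polar lam f
    & exists bad : seq C, forall lam, lam != 0 -> lam \notin bad ->
        ~~ (('X - a%:P) ^+ (e - Z).+1 %| polar lam f)].
Proof.
move=> sz_f lc_f l_n0 Df D_n0 e Z.
pose sh : {rmorphism {poly C} -> {poly C}} := comp_poly ('X + a%:P).
have shK p : comp_poly ('X - a%:P) (sh p) = p by apply: comp_polyXaddC_K.
have sh_eq0 p : (sh p == 0) = (p == 0).
  by apply/eqP/eqP => [sh0|->]; [rewrite -(shK p) sh0 comp_poly0 | apply: comp_poly0].
pose g := map_poly sh f.
have sz_g : size g = size f by rewrite size_map_poly_id0 // sh_eq0 lc_f polyC_eq0.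
have lc_g : lead_coef g = l%:P.
  by rewrite lead_coef_map_eq ?lc_f /= ?comp_polyC // polyC_eq0.
have [lc_f' sz_f'] := lead_coef_deriv_const sz_f lc_f l_n0.
have lk_n0 : l *+ (size f).-1 != 0.
  by rewrite mulrn_eq0 (negPf l_n0) orbF -lt0n -ltnS (ltn_predK sz_f).
have ev_g : map_poly (horner_eval (0 : C)) g = l *: \prod_(c <- rs) ('X - c%:P).
  rewrite -Df; apply/polyP => i; rewrite !coef_map /= /horner_eval.
  by rewrite horner_comp hornerD hornerX hornerC add0r.
have res_sh P : lead_coef P != 0 ->
    sh (resultant P f^`()) = resultant (map_poly sh P) (map_poly sh f^`()).
  by move=> P_n0; rewrite map_resultant // sh_eq0 // lc_f' polyC_eq0.
have sh_f' : map_poly sh f^`() = g^`() by rewrite deriv_map.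
have Dg : resultant g g^`() = sh (resultant f f^`()).
  by rewrite res_sh ?sh_f' // lc_f polyC_eq0.
have Dg_n0 : resultant g g^`() != 0 by rewrite Dg sh_eq0.
have polar_g lam : lam != 0 -> polar lam g = sh (polar lam f).
  move=> lam_n0; rewrite [in RHS]/polar res_sh ?sh_f'; last first.
    by rewrite (lead_coef_polar sz_f lc_f) // polyC_eq0 mulf_neq0.
  congr (resultant _ _); rewrite rmorphD /=; congr (_ + _).
    apply/polyP => i; rewrite !(coef_map, coef_map_id0) ?deriv0 //=.
    by rewrite deriv_comp derivD derivX derivC addr0 mulr1.
  by rewrite linearZ /= /sh comp_polyC.
have mup_g : mup 0 (resultant g g^`()) = e by rewrite Dg mup_shift.
have [] := @polar_order0 C g l rs _ lc_g l_n0 ev_g Dg_n0; first by rewrite sz_g.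
rewrite mup_g -/Z => le_Ze dv [bad badP]; split=> //.
  by move=> lam lam_n0; rewrite -dvdp_shift -[_ \Po _]polar_g // dv.
exists bad => lam lam_n0 nbad; rewrite -dvdp_shift -[_ \Po _]polar_g //.
exact: badP.
Qed.

(** * Complex roots of real polynomials, and the order of the polar resultant over the reals *)

Section Real.
Variable R : rcfType.
Local Notation toC := (map_poly (real_complex R)).

Definition croots (p : {poly R}) : seq R[i] :=
  sval (closed_field_poly_normal (toC p)).

Lemma crootsE (p : {poly R}) :
  toC p = (lead_coef p)%:C%C *: \prod_(c <- croots p) ('X - c%:P).
Proof. by rewrite /croots; case: closed_field_poly_normal => s /= {1}->; rewrite lead_coef_map. Qed.

(** Complex roots are counted, not real ones: constancy of this number is what allows roots of
    nearby polynomials to be matched, and conjugation then singles out the real ones. *)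
Definition ndroots p := size (undup (croots p)).

Lemma size_croots p : p != 0 -> size (croots p) = (size p).-1.
Proof.
move=> p_n0; have := congr1 (fun q : {poly R[i]} => size q) (crootsE p).
rewrite size_map_poly size_scale ?fmorph_eq0 ?lead_coef_eq0 // size_prod_XsubC.
by move=> ->.
Qed.

(** Orders and resultants are unchanged by extension of scalars to [R[i]], where [polar_order]
    applies. *)
Lemma real_polar_order (f : {poly {poly R}}) (l a : R) :
    (1 < size f)%N -> lead_coef f = l%:P -> l != 0 ->
    resultant f f^`() != 0 ->
  let e := mup a (resultant f f^`()) in
  let Z := ((size f).-1 - ndroots (map_poly (horner_eval a) f))%N in
  [/\ (Z <= e)%N,
      forall lam, lam != 0 -> ('X - a%:P) ^+ (e - Z) %| polar lam f
    & exists2 lam, lam != 0 & ~~ (('X - a%:P) ^+ (e - Z).+1 %| polar lam f)].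
Proof.
move=> sz_f lc_f l_n0 D_n0 e Z.
pose F := map_poly toC f; pose q := map_poly (horner_eval a) f.
have toC_n0 x : x != 0 -> (x%:C)%C != 0 :> R[i] by rewrite fmorph_eq0.
have sz_F : size F = size f.
  by rewrite size_map_poly_id0 // lc_f map_polyC polyC_eq0 toC_n0.
have lc_F : lead_coef F = (l%:C)%C%:P.
  by rewrite lead_coef_map_eq lc_f /= map_polyC // polyC_eq0 toC_n0.
have sz_q : size q = size f.
  by rewrite size_map_poly_id0 // lc_f /= /horner_eval hornerC.
have lc_q : lead_coef q = l.
  by rewrite lead_coef_map_eq lc_f /= /horner_eval hornerC.
have q_n0 : q != 0 by rewrite -size_poly_gt0 sz_q ltnW.
have [lc_f' sz_f'] := lead_coef_deriv_const sz_f lc_f l_n0.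
have lk_n0 : l *+ (size f).-1 != 0.
  by rewrite mulrn_eq0 (negPf l_n0) orbF -lt0n -ltnS (ltn_predK sz_f).
have ev_F : map_poly (horner_eval (a%:C)%C) F =
    (l%:C)%C *: \prod_(c <- croots q) ('X - c%:P).
  rewrite -lc_q -crootsE; apply/polyP => i.
  by rewrite !coef_map /= /horner_eval horner_map.
have res_F P : lead_coef P != 0 ->
    toC (resultant P f^`()) = resultant (map_poly toC P) F^`().
  move=> P_n0; rewrite map_resultant ?map_poly_eq0 // ?deriv_map //.
  by rewrite lc_f' polyC_eq0.
have DF : resultant F F^`() = toC (resultant f f^`()).
  by rewrite res_F // lc_f polyC_eq0.
have DF_n0 : resultant F F^`() != 0 by rewrite DF map_poly_eq0.
have toC_dvd k p : (('X - (a%:C)%C%:P) ^+ k %| toC p) = (('X - a%:P) ^+ k %| p).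
  by rewrite -(dvdp_map (real_complex R)) rmorphXn rmorphB /= map_polyX map_polyC.
have mup_F : mup (a%:C)%C (resultant F F^`()) = e.
  apply/eqP; rewrite eqn_leq DF /e; apply/andP; split.
    by rewrite mup_geq // -toC_dvd -mup_geq ?map_poly_eq0.
  by rewrite mup_geq ?map_poly_eq0 // toC_dvd -mup_geq.
have polar_F lam : lam != 0 -> polar (lam%:C)%C F = toC (polar lam f).
  move=> lam_n0; rewrite map_polar ?map_poly_eq0 //.
    by rewrite (lead_coef_polar sz_f lc_f) // polyC_eq0 mulf_neq0.
  by rewrite lc_f' polyC_eq0.
have [] := @polar_order _ F (l%:C)%C (a%:C)%C (croots q) _ lc_F (toC_n0 _ l_n0)
   ev_F DF_n0.
  by rewrite sz_F.
rewrite mup_F size_croots // sz_q -/(ndroots q) -/Z => le_Ze dv [bad badP].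
split=> // [lam lam_n0|].
  by rewrite -toC_dvd -polar_F // dv // toC_n0.
(* Among [size bad + 1] positive integers one avoids [bad], so [lam] can be chosen real. *)
have [n nbad] : exists n : nat, ((n.+1%:R : R)%:C)%C \notin bad.
  pose s := [seq ((n.+1%:R : R)%:C)%C | n <- iota 0 (size bad).+1].
  have uniq_s : uniq s.
    rewrite map_inj_uniq ?iota_uniq // => m n /(fmorph_inj (real_complex R)).
    by move/eqP; rewrite eqr_nat eqSS => /eqP.
  have : ~~ all (mem bad) s.
    apply/negP => /allP sub; have := uniq_leq_size uniq_s sub.
    by rewrite size_map size_iota ltnn.
  by case/allPn => _ /mapP[n _ ->] nbad; exists n.
exists n.+1%:R; first by rewrite pnatr_eq0.
rewrite -toC_dvd -polar_F ?pnatr_eq0 //; apply: badP => //.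
by rewrite toC_n0 // pnatr_eq0.
Qed.

End Real.

(** * Continuity of roots *)

Section RootContinuity.
Variable C : numClosedFieldType.

(** The modulus of [p.[z]] is the product of the distances from [z] to the roots, each at least the
    smallest one. *)
Lemma closest_root (p : {poly C}) (z : C) : p \is monic -> (1 < size p)%N ->
  exists2 x, root p x & `|z - x| ^+ (size p).-1 <= `|p.[z]|.
Proof.
move=> mon_p sz_p; have [rs Dp] := closed_field_poly_normal p.
rewrite (monicP mon_p) scale1r in Dp.
have sz_rs : size rs = (size p).-1 by rewrite Dp size_prod_XsubC.
have [x x_rs min_x] : exists2 x, x \in rs &
    forall y, y \in rs -> `|z - x| <= `|z - y|.
  have : (0 < size rs)%N by rewrite sz_rs -ltnS (ltn_predK sz_p).
  elim: rs {Dp sz_rs} => // x [|y rs] IH _.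
    by exists x; rewrite ?mem_head // => _ /[!inE] /eqP->.
  have [//|u u_rs min_u] := IH.
  have [le_xu|le_ux] := real_leP (normr_real (z - x)) (normr_real (z - u)).
    exists x; rewrite ?mem_head // => v; rewrite inE => /predU1P[->//|/min_u].
    exact: le_trans.
  exists u; first by rewrite inE u_rs orbT.
  by move=> v; rewrite inE => /predU1P[->|/min_u//]; apply: ltW.
exists x; first by rewrite Dp root_prod_XsubC.
rewrite -sz_rs [X in X.[z]]Dp horner_prod normr_prod.
have -> : `|z - x| ^+ size rs = \prod_(y <- rs) `|z - x|.
  by rewrite big_const_seq count_predT iter_mulr_1.
rewrite big_seq [leRHS]big_seq; apply: ler_prod => y y_rs.
by rewrite normr_ge0 hornerXsubC min_x.
Qed.

(** Induction on the limit roots: by [closest_root] a root of [q t] nearest to [z] tends to [z], and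
    dividing by its linear factor preserves convergence of the coefficients. *)
Lemma cvg_roots (T : Type) (F : set_system T) (FF : Filter F) (zs : seq C)
    (q : T -> {poly C}) :
    (forall t, q t \is monic) -> (forall t, size (q t) = (size zs).+1) ->
    (forall i, (fun t => (q t)`_i) @ F --> (\prod_(z <- zs) ('X - z%:P))`_i) ->
  exists w : T -> seq C,
    [/\ forall t, size (w t) = size zs,
        forall t, q t = \prod_(z <- w t) ('X - z%:P)
      & forall i, (i < size zs)%N -> (fun t => (w t)`_i) @ F --> zs`_i].
Proof.
elim: zs q => [|z zs IH] q mon_q sz_q cvg_q.
  exists (fun=> [::]); split=> // t; rewrite big_nil.
  have /eqP := sz_q t; rewrite /= => /eqP/eqP sz1.
  have /monicP := mon_q t; rewrite lead_coefE (eqP sz1) /= => q0.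
  by rewrite [q t]size1_polyC ?(eqP sz1) // q0.
have /choice[w0 w0P] : forall t, exists x,
    root (q t) x /\ `|z - x| ^+ (size zs).+1 <= `|(q t).[z]|.
  move=> t; have [|x rx le_x] := @closest_root (q t) z (mon_q t).
    by rewrite sz_q.
  by exists x; rewrite sz_q in le_x.
have cvg_qz : (fun t => (q t).[z]) @ F --> (0 : C).
  have -> : 0 = (\prod_(y <- z :: zs) ('X - y%:P)).[z].
    by apply/esym/rootP; rewrite root_prod_XsubC mem_head.
  have Dh (p : {poly C}) : size p = (size zs).+2 ->
      p.[z] = \sum_(i < (size zs).+2) p`_i * z ^+ i.
    by move=> sz_p; rewrite horner_coef sz_p.
  under eq_cvg do rewrite Dh ?sz_q //.
  rewrite Dh ?size_prod_XsubC //.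
  apply: (@cvg_big _ _ (+%R : C -> C -> C)) => [|i _].
    exact: add_continuous.
  by apply: cvgM; [exact: cvg_q | exact: cvg_cst].
have cvg_w0 : w0 @ F --> z.
  apply/cvgrPdist_lt => e e_gt0.
  have /cvgrPdist_lt/(_ (e ^+ (size zs).+1)) := cvg_qz.
  move=> /(_ (exprn_gt0 _ e_gt0)); apply: filterS => t; rewrite sub0r normrN.
  have [_ le_w] := w0P t => /(le_lt_trans le_w).
  by rewrite ltr_pXn2r // nnegrE ?normr_ge0 ?ltW.
have /choice[q1 q1P] : forall t, exists q1, q t = q1 * ('X - (w0 t)%:P).
  by move=> t; apply/factor_theorem; case: (w0P t).
have mon_q1 t : q1 t \is monic.
  by move: (mon_q t); rewrite q1P monicMr ?monicXsubC.
have sz_q1 t : size (q1 t) = (size zs).+1.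
  move: (sz_q t); rewrite q1P size_Mmonic ?monicXsubC ?monic_neq0 //.
  by rewrite size_XsubC addn2 => -[].
pose f1 := \prod_(y <- zs) ('X - y%:P).
have sz_f1 : size f1 = (size zs).+1 by rewrite size_prod_XsubC.
(* Synthetic division: the coefficients of the quotient are recovered from the top downwards, hence
   the induction on the distance [k] to the top. *)
have rec (p : {poly C}) c i : p`_i = (p * ('X - c%:P))`_i.+1 + p`_i.+1 * c.
  by rewrite mulrBr coefB coefMX coefMC /= subrK.
have cvg_q1 i : (fun t => (q1 t)`_i) @ F --> f1`_i.
  have [k le_k] : exists k, (size zs < i + k)%N.
    by exists (size zs).+1; rewrite addnS ltnS leq_addl.
  elim: k i le_k => [|k IHk] i le_k.
    rewrite addn0 in le_k; rewrite nth_default ?sz_f1 //.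
    under eq_cvg do rewrite nth_default ?sz_q1 //.
    exact: cvg_cst.
  rewrite (rec f1 z i); under eq_cvg => t do rewrite (rec (q1 t) (w0 t) i) -q1P.
  apply: cvgD; last by apply: cvgM => //; apply: IHk; rewrite addSnnS.
  by have := cvg_q i.+1; rewrite big_cons mulrC.
have [w [sz_w Dw cvg_w]] := IH q1 mon_q1 sz_q1 cvg_q1.
exists (fun t => w0 t :: w t); split=> [t|t|[|i] //= lt_i].
- by rewrite /= sz_w.
- by rewrite big_cons q1P Dw mulrC.
- exact: cvg_w.
Qed.

(** Norm form of [cvg_roots], in which it is applied over [R[i]]. *)
Lemma dist_roots (T : Type) (F : set_system T) (FF : Filter F) (zs : seq C)
    (q : T -> {poly C}) :
    (forall t, q t \is monic) -> (forall t, size (q t) = (size zs).+1) ->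
    (forall i e, 0 < e -> \forall t \near F,
       `|(\prod_(z <- zs) ('X - z%:P))`_i - (q t)`_i| < e) ->
  exists w : T -> seq C,
    [/\ forall t, size (w t) = size zs,
        forall t, q t = \prod_(z <- w t) ('X - z%:P)
      & forall i e, (i < size zs)%N -> 0 < e ->
          \forall t \near F, `|zs`_i - (w t)`_i| < e].
Proof.
move=> mon_q sz_q cvg_q.
have [i|w [sz_w Dw cvg_w]] := @cvg_roots T F FF zs q mon_q sz_q.
  by apply/cvgrPdist_lt; apply: cvg_q.
by exists w; split=> // i e lt_i; have /cvgrPdist_lt := cvg_w i lt_i; apply.
Qed.

End RootContinuity.

(** * Matching of nearby lists of roots *)

Section Matching.
Variable C : numClosedFieldType.
Implicit Types zs ws : seq C.

(** The factor 2 comes from the triangle inequality: two entries at distance less than [e] from a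
    common point coincide. *)
Definition separated (e : C) zs :=
  forall x y, x \in zs -> y \in zs -> `|x - y| < e *+ 2 -> x = y.

Definition close_seq (e : C) ws zs :=
  size ws = size zs /\ forall i, (i < size zs)%N -> `|zs`_i - ws`_i| < e.

Lemma separated_seq zs : exists2 e : C, 0 < e & separated e zs.
Proof.
elim: zs => [|z zs [e e_gt0 sep_e]]; first by exists 1.
suff [d d_gt0 [le_de sep_d]] : exists2 d : C, 0 < d & d <= e /\
    forall y, y \in zs -> `|z - y| < d *+ 2 -> z = y.
  have le2 : d *+ 2 <= e *+ 2 by rewrite lerMn2r.
  exists d => // x y; rewrite !inE => /predU1P[->|x_zs] /predU1P[->|y_zs] //.
  - exact: sep_d.
  - by rewrite distrC => /(sep_d x x_zs)/esym.
  - by move/lt_le_trans/(_ le2)/(sep_e x y x_zs y_zs).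
elim: (zs) => [|y s [d d_gt0 [le_de sep_d]]]; first by exists e.
have [eq_zy|ne_zy] := eqVneq z y.
  by exists d => //; split=> // u; rewrite inE => /predU1P[->//|/sep_d].
have c_gt0 : 0 < `|z - y| / 2 by rewrite divr_gt0 // normr_gt0 subr_eq0.
have half : `|z - y| / 2 *+ 2 = `|z - y| by rewrite -mulr_natr divfK ?pnatr_eq0.
have [le_dc|lt_cd] := real_leP (gtr0_real d_gt0) (gtr0_real c_gt0).
  exists d => //; split=> // u; rewrite inE => /predU1P[->|/sep_d//] lt_d.
  have le_dc2 : d *+ 2 <= `|z - y| by rewrite -half lerMn2r.
  by have := lt_le_trans lt_d le_dc2; rewrite ltxx.
exists (`|z - y| / 2) => //; split=> [|u]; first by rewrite (le_trans (ltW lt_cd)).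
rewrite half inE => /predU1P[->|/sep_d sep_u]; first by rewrite ltxx.
by move=> lt_u; apply: sep_u; rewrite (lt_trans lt_u) // -half ltrMn2r.
Qed.

Lemma close_perm_sep e ws zs : close_seq e ws zs -> separated e zs ->
  forall i j, (i < size zs)%N -> (j < size zs)%N -> ws`_i = ws`_j -> zs`_i = zs`_j.
Proof.
move=> [sz_ws cl] sep i j lt_i lt_j eq_w; apply: sep; rewrite ?mem_nth //.
have -> : zs`_i - zs`_j = (zs`_i - ws`_i) - (zs`_j - ws`_j).
  by rewrite eq_w; ring.
by rewrite (le_lt_trans (ler_normB _ _)) // mulr2n ltrD ?cl.
Qed.

(** Equal entries of [ws] lie over equal entries of [zs], so picking one entry of [ws] over each
    distinct value of [zs] is injective. *)
Lemma close_undup_le e ws zs : close_seq e ws zs -> separated e zs ->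
  (size (undup zs) <= size (undup ws))%N.
Proof.
move=> cl sep; have [sz_ws _] := cl.
rewrite -(size_map (fun z => ws`_(index z zs))); apply: uniq_leq_size.
  rewrite map_inj_in_uniq ?undup_uniq // => x y; rewrite !mem_undup => x_zs y_zs.
  move/(close_perm_sep cl sep); rewrite !index_mem !nth_index //; exact.
move=> x /mapP[z]; rewrite !mem_undup => z_zs ->.
by rewrite mem_nth // sz_ws index_mem.
Qed.

(** With equally many distinct values the injection behind [close_undup_le] is onto: no value of
    [zs] splits, and multiplicities are preserved. *)
Lemma close_matching e ws zs : close_seq e ws zs -> separated e zs ->
    size (undup ws) = size (undup zs) ->
  exists sel : C -> C, [/\ ws = map sel zs, {in zs &, injective sel}
    & forall z, z \in zs -> `|z - sel z| < e].
Proof.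
move=> cl sep eq_sz; have [sz_ws cl_i] := cl.
pose sel z := ws`_(index z zs); pose s := map sel (undup zs).
have inj_sel : {in zs &, injective sel}.
  move=> x y x_zs y_zs /(close_perm_sep cl sep).
  by rewrite !index_mem !nth_index //; apply.
have uniq_s : uniq s.
  rewrite map_inj_in_uniq ?undup_uniq // => x y; rewrite !mem_undup.
  exact: inj_sel.
have sub_s : {subset s <= undup ws}.
  move=> x /mapP[z]; rewrite !mem_undup => z_zs ->.
  by rewrite mem_nth // sz_ws index_mem.
have [|_ eq_s] := uniq_min_size uniq_s sub_s; first by rewrite size_map eq_sz.
exists sel; split=> // [|z z_zs]; last first.
  by rewrite -{1}(nth_index 0 z_zs) cl_i // index_mem.
apply: (@eq_from_nth _ 0); first by rewrite size_map.
move=> i lt_i; rewrite (nth_map 0) -?sz_ws //.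
have : ws`_i \in s by rewrite eq_s mem_undup mem_nth.
case/mapP=> z; rewrite mem_undup => z_zs Dwi; rewrite Dwi.
have := close_perm_sep cl sep _ _ Dwi.
by rewrite -sz_ws lt_i sz_ws index_mem nth_index // => -> .
Qed.

End Matching.

(** * Real roots of a varying real polynomial *)

Section RealRoots.
Local Open Scope complex_scope.
Variable R : realType.
Implicit Types (p : {poly R}) (z : R[i]).
Local Notation toC := (map_poly (real_complex R)).
Local Notation cj := (@conjc R).

Lemma mem_rootsR p x : p != 0 -> (x \in rootsR p) = root p x.
Proof. by move=> p_n0; have := roots_on_rootsR p_n0 x; rewrite inE /= => <-. Qed.

Lemma sorted_rootsR p : sorted <%R (rootsR p).
Proof. exact: sorted_roots. Qed.

Lemma mem_croots p z : p != 0 -> (z \in croots p) = root (toC p) z.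
Proof.
move=> p_n0; rewrite crootsE rootZ ?root_prod_XsubC //.
by rewrite fmorph_eq0 lead_coef_eq0.
Qed.

Lemma real_mem_croots p x : p != 0 -> (x%:C \in croots p) = root p x.
Proof. by move=> p_n0; rewrite mem_croots // fmorph_root. Qed.

Lemma conj_mem_croots p z : p != 0 -> z \in croots p -> cj z \in croots p.
Proof.
move=> p_n0; rewrite !mem_croots // -complex_root_conj.
have -> // : map_poly conjc (toC p) = toC p.
by apply/polyP => i; rewrite [LHS]coef_map !coef_map; apply: conjc_real.
Qed.

Lemma normc_real (x : R) : `|x%:C| = `|x|%:C.
Proof. by rewrite normc_def /= expr0n addr0 sqrtr_sqr. Qed.

Lemma normc_conj z : `|cj z| = `|z|.
Proof. by case: z => a b; rewrite !normc_def /= sqrrN. Qed.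

Lemma real_complexB (x y : R) : (x - y)%:C = x%:C - y%:C.
Proof. exact: rmorphB. Qed.

Lemma conjcB (x y : R[i]) : cj (x - y) = cj x - cj y.
Proof. exact: rmorphB. Qed.

Lemma conjc_fixed z : cj z = z -> z = (complex.Re z)%:C.
Proof.
case: z => a b /= [/eqP]; rewrite eq_sym -addr_eq0 -mulr2n mulrn_eq0 /=.
by move=> /eqP->.
Qed.

Lemma croots_perm p (ws : seq R[i]) : p != 0 ->
  toC p = (lead_coef p)%:C *: \prod_(z <- ws) ('X - z%:P) ->
  perm_eq ws (croots p).
Proof.
move=> p_n0; rewrite crootsE => /(scalerI _) eq_prod; apply: prod_XsubC_eq.
by apply/esym/eq_prod; rewrite fmorph_eq0 lead_coef_eq0.
Qed.

Lemma size_undup_perm (T : eqType) (s t : seq T) :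
  perm_eq s t -> size (undup s) = size (undup t).
Proof. by move=> /perm_mem/perm_undup/perm_size. Qed.


Lemma separated_croots p : exists2 e : R, 0 < e & separated e%:C (croots p).
Proof.
have [e e_gt0 sep] := separated_seq (croots p); exists (complex.Re e).
  by move: e_gt0; rewrite ltcE => /andP[].
by case: e e_gt0 sep => a b; rewrite ltcE /= => /andP[/eqP-> _].
Qed.

Section Family.
Variables (T : Type) (F : set_system T) (FF : Filter F).
Variables (q : T -> {poly R}) (q0 : {poly R}).
Hypotheses (q0_n0 : q0 != 0) (sz_q : \forall t \near F, size (q t) = size q0).
Hypothesis cvg_q : forall i, (fun t => (q t)`_i) @ F --> q0`_i.

Lemma real_family_roots : exists w : T -> seq R[i],
  (\forall t \near F, perm_eq (w t) (croots (q t))) /\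
  (forall e : R, 0 < e -> \forall t \near F, close_seq e%:C (w t) (croots q0)).
Proof.
(* [dist_roots] asks for the right size at every [t], so [q0] replaces the members of wrong size. *)
pose q' t := if size (q t) == size q0 then q t else q0.
have sz_q' t : size (q' t) = size q0 by rewrite /q'; case: ifP => [/eqP|].
have near_q' : \forall t \near F, q' t = q t.
  by apply: filterS sz_q => t eq_sz; rewrite /q' eq_sz eqxx.
have cvg_q' i : (fun t => (q' t)`_i) @ F --> q0`_i.
  apply: (@cvg_trans _ ((q t)`_i @[t --> F])); last exact: cvg_q.
  apply: near_eq_cvg.
  by apply: filterS near_q' => t ->.
have lc_n0 t : lead_coef (q' t) != 0.
  by rewrite lead_coef_eq0 -size_poly_eq0 sz_q' size_poly_eq0.
pose pq t := (lead_coef (q' t))^-1 *: q' t.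
have mon_pq t : toC (pq t) \is monic.
  by rewrite map_monic monicE lead_coefZ mulVf.
have sz_pq t : size (toC (pq t)) = (size (croots q0)).+1.
  rewrite size_map_poly size_scale ?invr_eq0 // sz_q' size_croots //.
  by rewrite prednK // size_poly_gt0.
have cvg_pq i : (fun t => (pq t)`_i) @ F --> (lead_coef q0)^-1 * q0`_i.
  under eq_cvg do rewrite coefZ; apply: cvgM => //.
  apply: cvgV; first by rewrite lead_coef_eq0.
  by under eq_cvg do rewrite lead_coefE sz_q'; apply: cvg_q'.
have prod_q0 : \prod_(z <- croots q0) ('X - z%:P) = toC ((lead_coef q0)^-1 *: q0).
  rewrite linearZ /= crootsE scalerA -rmorphM mulVf ?lead_coef_eq0 //.
  by rewrite rmorph1 scale1r.
have cvg_C i (c : R[i]) : 0 < c -> \forall t \near F,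
    `|(\prod_(z <- croots q0) ('X - z%:P))`_i - (toC (pq t))`_i| < c.
  case: c => e e'; rewrite ltcE /= => /andP[/eqP-> e_gt0].
  have /cvgrPdist_lt/(_ _ e_gt0) := cvg_pq i; apply: filterS => t.
  by rewrite prod_q0 !coef_map !coefZ -rmorphB normc_real ltcR.
have [w [sz_w Dw cvg_w]] := dist_roots FF mon_pq sz_pq cvg_C.
exists w; split.
  apply: filterS near_q' => t eq_q'; apply: croots_perm.
    by rewrite -eq_q' -lead_coef_eq0.
  rewrite -Dw /pq eq_q' linearZ scalerA /= -rmorphM mulfV -?eq_q' //.
  by rewrite rmorph1 scale1r.
move=> e e_gt0.
have e_gt0' : 0 < e%:C by rewrite ltcE /= eqxx.
have all_i : \forall t \near F, forall i : 'I_(size (croots q0)),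
    `|(croots q0)`_i - (w t)`_i| < e%:C.
  by apply: filter_forall => i; apply: cvg_w.
by apply: filterS all_i => t cl; split=> // i lt_i; apply: (cl (Ordinal lt_i)).
Qed.

Lemma ndroots_near_ge : \forall t \near F, (ndroots q0 <= ndroots (q t))%N.
Proof.
have [w [perm_w close_w]] := real_family_roots.
have [e e_gt0 sep] := separated_croots q0.
apply: filterS2 perm_w (close_w e e_gt0) => t /size_undup_perm Dw cl.
by rewrite /ndroots -Dw; apply: close_undup_le sep.
Qed.

(** A real root of [q t] is close to some complex root [z] of [q0], hence also to the conjugate of
    [z]; by separation [z] is its own conjugate. *)
Lemma real_roots_near_root (e : R) : 0 < e ->
  \forall t \near F, forall y, root (q t) y ->
    exists2 c, root q0 c & `|y - c| < e.
Proof.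
move=> e_gt0; have [w [perm_w close_w]] := real_family_roots.
have [e0 e0_gt0 sep] := separated_croots q0.
have m_gt0 : 0 < Num.min e e0 by rewrite lt_min e_gt0.
apply: filterS3 sz_q perm_w (close_w _ m_gt0) => t eq_sz perm_w' [sz_w cl] y ry.
have qt_n0 : q t != 0 by rewrite -size_poly_eq0 eq_sz size_poly_eq0.
have : y%:C \in w t by rewrite (perm_mem perm_w') real_mem_croots.
move=> /(nthP 0)[i lt_i Dy]; rewrite sz_w in lt_i.
have {}cl := cl i lt_i; rewrite Dy in cl.
set z := _`_i in cl; have z_q0 : z \in croots q0 by rewrite mem_nth.
have Dz : cj z = z.
  apply: sep => //; first exact: conj_mem_croots.
  have -> : cj z - z = cj (z - y%:C) - (z - y%:C).
    by rewrite conjcB conjc_real; ring.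
  rewrite (le_lt_trans (ler_normB _ _)) // normc_conj mulr2n ltrD //;
  by rewrite (lt_le_trans cl) // lecR ge_min lexx orbT.
have {}Dz := conjc_fixed Dz.
exists (complex.Re z); first by rewrite -real_mem_croots // -Dz.
by move: cl; rewrite Dz -rmorphB normc_real ltcR distrC lt_min => /andP[].
Qed.

Hypothesis ndroots_q : \forall t \near F, ndroots (q t) = ndroots q0.

Lemma real_family_matching (e : R) : 0 < e ->
  \forall t \near F, exists sel : R[i] -> R[i],
    [/\ perm_eq (map sel (croots q0)) (croots (q t)),
        {in croots q0 &, injective sel}
      & forall z, z \in croots q0 -> `|z - sel z| < e%:C].
Proof.
move=> e_gt0; have [w [perm_w close_w]] := real_family_roots.
have [e0 e0_gt0 sep] := separated_croots q0.
have m_gt0 : 0 < Num.min e e0 by rewrite lt_min e_gt0.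
have le_m : (Num.min e e0)%:C <= e%:C by rewrite lecR ge_min lexx.
have sep_m : separated (Num.min e e0)%:C (croots q0).
  move=> x y x_q y_q lt_m; apply: sep => //; rewrite (lt_le_trans lt_m) //.
  by rewrite lerMn2r lecR ge_min lexx orbT.
apply: filterS3 ndroots_q perm_w (close_w _ m_gt0) => t eq_nd perm_w' cl.
have [|sel [Dw inj_sel cl_sel]] := close_matching cl sep_m.
  by rewrite (size_undup_perm perm_w').
exists sel; split=> //; first by rewrite -Dw.
by move=> z /cl_sel/lt_le_trans; apply.
Qed.

(** By separation the root matched with [a t] is [a0], and an injective matching keeps
    multiplicities. *)
Lemma mup_near (a : T -> R) (a0 : R) : root q0 a0 ->
    (\forall t \near F, root (q t) (a t)) -> a @ F --> a0 ->
  \forall t \near F, mup (a t) (q t) = mup a0 q0.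
Proof.
move=> r_a0 r_a cvg_a; have [e e_gt0 sep] := separated_croots q0.
have mupC p x : p != 0 -> mup x p = count_mem x%:C (croots p).
  move=> p_n0; rewrite -mu_prod_XsubC.
  have -> : \prod_(z <- croots p) ('X - z%:P) = toC ((lead_coef p)^-1 *: p).
    rewrite linearZ /= crootsE scalerA -rmorphM mulVf ?lead_coef_eq0 //.
    by rewrite rmorph1 scale1r.
  have p'_n0 : (lead_coef p)^-1 *: p != 0.
    by rewrite scaler_eq0 invr_eq0 lead_coef_eq0 (negPf p_n0).
  have -> : mup x p = mup x ((lead_coef p)^-1 *: p).
    by rewrite -mul_polyC mupMr // rootC invr_eq0 lead_coef_eq0.
  have toC_dvd k (u : {poly R}) :
      (('X - (x%:C)%:P) ^+ k %| toC u) = (('X - x%:P) ^+ k %| u).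
    by rewrite -(dvdp_map (real_complex R)) rmorphXn rmorphB /= map_polyX map_polyC.
  apply/eqP; rewrite eqn_leq; apply/andP; split.
    by rewrite mup_geq ?map_poly_eq0 // toC_dvd -mup_geq.
  by rewrite mup_geq // -toC_dvd -mup_geq ?map_poly_eq0.
have /cvgrPdist_lt/(_ _ e_gt0) near_a := cvg_a.
apply: filterS2 (real_family_matching e_gt0) (filterI sz_q (filterI r_a near_a)).
move=> t [sel [perm inj_sel cl]] [eq_sz [r_at dist_a]].
have qt_n0 : q t != 0 by rewrite -size_poly_eq0 eq_sz size_poly_eq0.
rewrite !mupC //.
have a0_q : a0%:C \in croots q0 by rewrite real_mem_croots.
have : (a t)%:C \in map sel (croots q0).
  by rewrite (perm_mem perm) real_mem_croots.
case/mapP=> z z_q0 Dat.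
have Dz : z = a0%:C.
  apply: sep => //.
  have -> : z - a0%:C = (z - sel z) - (a0%:C - (a t)%:C) by rewrite Dat; ring.
  rewrite (le_lt_trans (ler_normB _ _)) // mulr2n ltrD ?cl //.
  by rewrite -rmorphB normc_real ltcR.
rewrite -(permP perm) Dat Dz count_map; apply: eq_in_count => y y_q0 /=.
by apply/eqP/eqP => [/inj_sel->|->].
Qed.

(** Separation makes the matching commute with conjugation, so real roots go to real roots and all
    real roots are reached; it also forbids two of them to change order. *)
Lemma rootsR_near (e : R) : 0 < e -> \forall t \near F,
  size (rootsR (q t)) = size (rootsR q0) /\
  forall i, (i < size (rootsR q0))%N ->
    `|(rootsR q0)`_i - (rootsR (q t))`_i| < e.
Proof.
move=> e_gt0; have [e0 e0_gt0 sep] := separated_croots q0.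
have m_gt0 : 0 < Num.min e e0 by rewrite lt_min e_gt0.
apply: filterS2 sz_q (real_family_matching m_gt0) => t eq_sz [sel [perm inj cl]].
have qt_n0 : q t != 0 by rewrite -size_poly_eq0 eq_sz size_poly_eq0.
have cl0 z : z \in croots q0 -> `|z - sel z| < e0%:C.
  by move=> /cl/lt_le_trans; apply; rewrite lecR ge_min lexx orbT.
have sel_q z : z \in croots q0 -> sel z \in croots (q t).
  by move=> z_q0; rewrite -(perm_mem perm) map_f.
have sel_conj z : z \in croots q0 -> cj (sel z) = sel (cj z).
  move=> z_q0; have := conj_mem_croots qt_n0 (sel_q z z_q0).
  rewrite -(perm_mem perm) => /mapP[z' z'_q0 Dz']; rewrite Dz'.
  congr sel; apply: sep => //; first exact: conj_mem_croots.
  have -> : z' - cj z = (z' - sel z') - cj (z - sel z).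
    by rewrite conjcB Dz'; ring.
  by rewrite (le_lt_trans (ler_normB _ _)) // normc_conj mulr2n ltrD ?cl0.
pose s x := complex.Re (sel x%:C).
have root_q0 x : (x \in rootsR q0) = (x%:C \in croots q0).
  by rewrite mem_rootsR // real_mem_croots.
have sE x : x \in rootsR q0 -> sel x%:C = (s x)%:C.
  rewrite root_q0 => x_q0; apply: conjc_fixed.
  by rewrite sel_conj // conjc_real.
have cl_s x : x \in rootsR q0 -> `|x - s x| < Num.min e e0.
  move=> x_q; rewrite -ltcR -normc_real real_complexB -sE //; apply: cl.
  by rewrite -root_q0.
have -> : rootsR (q t) = map s (rootsR q0).
  apply: (irr_sorted_eq lt_trans (@ltxx _ _)); first exact: sorted_rootsR.
    suff homo_s : {in rootsR q0 &, {homo s : x y / x < y}}.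
      by apply: (homo_sorted_in homo_s) (sorted_rootsR q0); apply/allP.
    move=> x y x_q y_q lt_xy; rewrite ltNge; apply/negP => le_s.
    have : x%:C = y%:C.
      apply: sep; [by rewrite -root_q0 | by rewrite -root_q0 |].
      rewrite -real_complexB normc_real -rmorphMn ltcR.
      move: (cl_s _ x_q) (cl_s _ y_q); rewrite !lt_min => /andP[_] c1 /andP[_].
      by move: c1; rewrite !ltr_norml mulr2n => /andP[c1 c2] /andP[c3 c4]; lra.
    by case=> eq_xy; rewrite eq_xy ltxx in lt_xy.
  move=> y; apply/idP/mapP => [|[x x_q ->]]; last first.
    rewrite mem_rootsR // -real_mem_croots // -sE //; apply: sel_q.
    by rewrite -root_q0.
  rewrite mem_rootsR // -real_mem_croots // -(perm_mem perm) => /mapP[z z_q Dy].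
  have Dz : cj z = z.
    apply: inj => //; first exact: conj_mem_croots.
    by rewrite -sel_conj // -Dy conjc_real.
  have {}Dz := conjc_fixed Dz.
  exists (complex.Re z); first by rewrite root_q0 -Dz.
  by rewrite /s -Dz -Dy.
rewrite size_map; split=> // i lt_i; rewrite (nth_map 0) //.
by have := cl_s _ (mem_nth 0 lt_i); rewrite lt_min => /andP[].
Qed.

End Family.

End RealRoots.

(** * Fibred homeomorphisms of the plane *)

Section PiecewiseLinear.
Variable R : realType.
Implicit Types (a b : nat -> R) (x y z : R).

(* [x] truncated to the interval [0, l], for [0 <= l]. *)
Definition clamp x l : R := (`|x| - `|x - l| + l) / 2.

Lemma clamp_le0 x l : 0 <= l -> x <= 0 -> clamp x l = 0.
Proof. by move=> l_ge0 x_le0; rewrite /clamp !ler0_norm; lra. Qed.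

Lemma clamp_mid x l : 0 <= x -> x <= l -> clamp x l = x.
Proof. by move=> x_ge0 le_xl; rewrite /clamp ger0_norm ?ler0_norm; lra. Qed.

Lemma clamp_ge x l : 0 <= l -> l <= x -> clamp x l = l.
Proof. by move=> l_ge0 le_lx; rewrite /clamp !ger0_norm; lra. Qed.

(** Piecewise linear interpolation with nodes [a i] and values [b i], of slope 1 outside the nodes,
    hence of bounded displacement. Each further node changes the slope by a clamped term, so
    continuity in the nodes and values can be read off the formula. *)
Fixpoint pl a b n y : R :=
  match n with
  | 0 => y
  | 1 => y + (b 0%N - a 0%N)
  | (n'.+1 as n1).+1 => pl a b n1 y +
      ((b n1 - b n') / (a n1 - a n') - 1) * clamp (y - a n') (a n1 - a n')
  end.

Definition increasing_upto n a := forall i, (i.+1 < n)%N -> a i < a i.+1.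

Lemma increasing_uptoW n a : increasing_upto n.+1 a -> increasing_upto n a.
Proof. by move=> inc_a i lt_i; apply: inc_a; apply: ltnW. Qed.

Lemma increasing_upto_lt n a i j : increasing_upto n a ->
  (i < j)%N -> (j < n)%N -> a i < a j.
Proof.
move=> inc_a; elim: j => // j IH; rewrite ltnS leq_eqVlt => /predU1P[->|lt_ij].
  exact: inc_a.
by move=> lt_j; apply: lt_trans (IH lt_ij (ltnW lt_j)) (inc_a _ lt_j).
Qed.

Section Props.
Variables (a b : nat -> R).

(** The clauses are proved together: slope 1 above the last node gives the values on the interval
    added next. *)
Lemma pl_spec n : increasing_upto n.+1 a -> increasing_upto n.+1 b ->
  [/\ {homo pl a b n.+1 : y z / y < z},
      forall i, (i <= n)%N -> pl a b n.+1 (a i) = b i,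
      forall y, a n <= y -> pl a b n.+1 y = b n + (y - a n)
    & forall B, (forall i, (i <= n)%N -> `|b i - a i| <= B) ->
        forall y, `|pl a b n.+1 y - y| <= B].
Proof.
elim: n => [|n IH] inc_a inc_b.
  split=> /= [y z|i|y _|B leB y].
  - by rewrite ltrD2r.
  - by rewrite leqn0 => /eqP->; ring.
  - by ring.
  - by rewrite addrC addKr leB.
have [IH1 IH2 IH3 IH4] := IH (increasing_uptoW inc_a) (increasing_uptoW inc_b).
have lt_a : 0 < a n.+1 - a n by rewrite subr_gt0 inc_a.
have lt_b : 0 < b n.+1 - b n by rewrite subr_gt0 inc_b.
set s := (b n.+1 - b n) / (a n.+1 - a n).
have s_gt0 : 0 < s by rewrite divr_gt0.
have sE : s * (a n.+1 - a n) = b n.+1 - b n by rewrite divfK // gt_eqF.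
have Dpl y : pl a b n.+2 y =
    pl a b n.+1 y + (s - 1) * clamp (y - a n) (a n.+1 - a n) by [].
have low y : y <= a n -> pl a b n.+2 y = pl a b n.+1 y.
  by move=> le_y; rewrite Dpl clamp_le0 ?mulr0 ?addr0 ?subr_le0 // ltW.
have mid y : a n <= y -> y <= a n.+1 -> pl a b n.+2 y = b n + s * (y - a n).
  move=> le_y1 le_y2; rewrite Dpl IH3 // clamp_mid ?subr_ge0 ?lerD2r //; ring.
have top y : a n.+1 <= y -> pl a b n.+2 y = b n.+1 + (y - a n.+1).
  move=> le_y; rewrite Dpl IH3; last by move: lt_a; lra.
  rewrite clamp_ge ?lerD2r // ?ltW //.
  by rewrite mulrBl sE mul1r; ring.
have b_n : pl a b n.+2 (a n) = b n by rewrite low // IH2.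
have midtop y z : a n <= y -> y < z -> pl a b n.+2 y < pl a b n.+2 z.
  move=> le_y lt_yz; have [le_z|lt_z] := leP z (a n.+1).
    rewrite !mid ?(le_trans le_y) ?(le_trans _ le_z) // ?ltW //.
    by rewrite ltrD2l ltr_pM2l // ltrD2r.
  rewrite (top z) ?ltW //; have [le_y2|lt_y2] := leP y (a n.+1).
    rewrite mid //; have : s * (y - a n) <= s * (a n.+1 - a n).
      by rewrite ler_pM2l // lerD2r.
    by rewrite sE; move: lt_z; lra.
  by rewrite top ?ltW //; move: lt_yz; lra.
split; last 1 first.
- move=> B leB y; have leB' i : (i <= n)%N -> `|b i - a i| <= B.
    by move=> le_i; apply: leB; apply: leqW.
  have [le_y|lt_y] := leP y (a n); first by rewrite low // IH4.
  have [le_y2|lt_y2] := leP y (a n.+1).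
    rewrite (mid _ (ltW lt_y) le_y2).
    (* Between two nodes the displacement is the convex combination, with weight [t], of the
       displacements at these nodes. *)
    pose t := (y - a n) / (a n.+1 - a n).
    have tE : t * (a n.+1 - a n) = y - a n by rewrite divfK // gt_eqF.
    have t_ge0 : 0 <= t by apply: divr_ge0; rewrite ltW // subr_gt0.
    have t_le1 : t <= 1 by rewrite ler_pdivrMr // mul1r lerD2r.
    have -> : b n + s * (y - a n) - y =
       (1 - t) * (b n - a n) + t * (b n.+1 - a n.+1).
      rewrite -tE mulrCA sE -[y](subrK (a n)) -tE; ring.
    clearbody t; have t1_ge0 : 0 <= 1 - t by rewrite subr_ge0.
    rewrite (le_trans (ler_normD _ _)) // !normrM (ger0_norm t_ge0) (ger0_norm t1_ge0).
    have -> : B = (1 - t) * B + t * B by ring.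
    by rewrite lerD // ler_wpM2l // leB.
  rewrite (top _ (ltW lt_y2)).
  have -> : b n.+1 + (y - a n.+1) - y = b n.+1 - a n.+1 by ring.
  exact: leB.
- move=> y z lt_yz; have [le_y|lt_y] := leP (a n) y; first exact: midtop.
  have [le_z|lt_z] := leP z (a n); first by rewrite !low ?IH1 // ltW.
  apply: lt_trans (midtop _ _ (lexx _) lt_z).
  by rewrite b_n low ?ltW // -(IH2 n) // IH1.
- move=> i; rewrite leq_eqVlt => /predU1P[->|]; first by rewrite top // subrr addr0.
  rewrite ltnS => le_i; rewrite low ?IH2 //.
  move: le_i; rewrite leq_eqVlt => /predU1P[->//|lt_i].
  by rewrite ltW // (increasing_upto_lt inc_a).
- exact: top.
Qed.

Variable n : nat.
Hypotheses (inc_a : increasing_upto n a) (inc_b : increasing_upto n b).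

Lemma pl_homo : {homo pl a b n : y z / y < z}.
Proof. by case: n inc_a inc_b => [|k] ia ib //; case: (pl_spec ia ib). Qed.

Lemma pl_node i : (i < n)%N -> pl a b n (a i) = b i.
Proof. by case: n inc_a inc_b => [|k] ia ib //; case: (pl_spec ia ib) => _ + _ _; apply. Qed.

Lemma pl_dist B : 0 <= B -> (forall i, (i < n)%N -> `|b i - a i| <= B) ->
  forall y, `|pl a b n y - y| <= B.
Proof.
case: n inc_a inc_b => [|k] ia ib B_ge0; first by rewrite /= => _ y; rewrite subrr normr0.
by case: (pl_spec ia ib) => _ _ _; apply.
Qed.

End Props.

Lemma pl_bounded a b n : increasing_upto n a -> increasing_upto n b ->
  exists B, forall y, `|pl a b n y - y| <= B.
Proof.
move=> inc_a inc_b; exists (\sum_(i < n) `|b i - a i|).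
apply: pl_dist => // [|i lt_i]; first exact: sumr_ge0.
by rewrite (bigD1 (Ordinal lt_i)) //= lerDl sumr_ge0.
Qed.

Lemma cvg_pl (T : Type) (F : set_system T) (FF : Filter F)
    (a b : nat -> T -> R) (a0 b0 : nat -> R) (y : T -> R) y0 n :
    increasing_upto n a0 ->
    (forall i, (i < n)%N -> a i @ F --> a0 i) ->
    (forall i, (i < n)%N -> b i @ F --> b0 i) ->
    y @ F --> y0 ->
  (fun t => pl (a^~ t) (b^~ t) n (y t)) @ F --> pl a0 b0 n y0.
Proof.
move=> inc_a cvg_a cvg_b cvg_y; elim: n inc_a cvg_a cvg_b => [|[|n] IH] // inc_a cvg_a cvg_b.
  by apply: cvgD => //; apply: cvgB; [apply: cvg_b | apply: cvg_a].
rewrite [pl _ _ n.+2]/=; apply: cvgD.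
  by apply: IH => [|i lt_i|i lt_i]; [apply: increasing_uptoW | apply/cvg_a/ltnW
   | apply/cvg_b/ltnW].
have cvg_da : (fun t => a n.+1 t - a n t) @ F --> a0 n.+1 - a0 n.
  by apply: cvgB; apply: cvg_a.
apply: cvgM.
  apply: cvgB; last exact: cvg_cst.
  apply: cvgM; first by apply: cvgB; apply: cvg_b.
  by apply: cvgV; rewrite // subr_eq0 gt_eqF ?inc_a.
apply: cvgM; last exact: cvg_cst.
have cvg_ya : (fun t => y t - a n t) @ F --> y0 - a0 n.
  by apply: cvgB => //; apply: cvg_a.
by apply: cvgD => //; apply: cvgB; apply: cvg_norm => //; apply: cvgB.
Qed.

End PiecewiseLinear.

Lemma cvg_app (T : Type) (V U : topologicalType) (F : set_system T)
    (FF : Filter F) (f : T -> V) (h : V -> U) (a : V) :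
  f @ F --> a -> continuous h -> (fun t => h (f t)) @ F --> h a.
Proof. by move=> cvg_f cont_h; exact: (@continuous_cvg T V U F FF f h a (cont_h a) cvg_f). Qed.

Lemma cvg_prod (T : Type) (U V : topologicalType) (F : set_system T)
    (FF : Filter F) (f : T -> U) (g : T -> V) (a : U) (b : V) :
  f @ F --> a -> g @ F --> b -> (fun t => (f t, g t)) @ F --> (a, b).
Proof. exact: (@cvg_pair T U V F (nbhs a) (nbhs b)). Qed.

Lemma fst_cvg (U V : topologicalType) (p : U * V) : (fun p => p.1) @ p --> p.1.
Proof. by case: p => x y; apply: cvg_fst. Qed.

Lemma snd_cvg (U V : topologicalType) (p : U * V) : (fun p => p.2) @ p --> p.2.
Proof. by case: p => x y; apply: cvg_snd. Qed.

Lemma near_fst (U V : topologicalType) (x : U) (y : V) (P : U -> Prop) :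
  (\forall x1 \near x, P x1) -> \forall p \near (x, y), P p.1.
Proof. by move=> nearP; apply: (@fst_cvg U V (x, y) P nearP). Qed.

Section FiberedHomeo.
Variable R : realType.
Implicit Types (x y z : R).

(** The value at [z - B] is at most [z] and the value at [z + B] at least [z]. *)
Lemma bounded_displacement_surj (f : R -> R) (B : R) : continuous f ->
  (forall y, `|f y - y| <= B) -> forall z, exists y, f y = z.
Proof.
move=> cont_f fB z.
have B_ge0 : 0 <= B by apply: le_trans (fB 0).
have le_ab : z - B <= z + B by lra.
have [||c _ <-] := @IVT R f (z - B) (z + B) z le_ab; last by exists c.
  exact: continuous_subspaceT.
have := fB (z - B); have := fB (z + B).
rewrite !ler_norml => /andP[h1 _] /andP[_ h2].
by rewrite ge_min le_max; apply/andP; split; apply/orP; [left|right]; lra.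
Qed.

(** By monotonicity [K] stays within [e] of [y0] as soon as [z] lies strictly between the values of
    [H (x, _)] at [y0 - e] and [y0 + e], an open condition on [(x, z)]. *)
Lemma continuous_fiber_inverse (H K : R * R -> R) : continuous H ->
    (forall x, {homo (fun y => H (x, y)) : y z / y < z}) ->
    (forall p, H (p.1, K p) = p.2) ->
  continuous K.
Proof.
move=> cont_H inc_H HK [x0 z0]; apply/cvgrPdist_lt => e e_gt0.
set y0 := K (x0, z0); have Hy0 : H (x0, y0) = z0 by have := HK (x0, z0).
have mono_H x y z : (H (x, y) < H (x, z)) -> y < z.
  move=> lt_H; rewrite ltNge le_eqVlt; apply/negP.
  by case/predU1P=> [eq_zy|/(inc_H x)/(lt_trans lt_H)]; [move: lt_H; rewrite eq_zy|];
    rewrite ltxx.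
have cont_x y : (fun p : R * R => H (p.1, y)) @ (x0, z0) --> H (x0, y).
  apply: (@cvg_app _ _ _ _ _ (fun p : R * R => (p.1, y)) H); last exact: cont_H.
  by apply: cvg_prod; [exact: fst_cvg | exact: cvg_cst].
have cont_z : (fun p : R * R => p.2) @ (x0, z0) --> z0 by exact: snd_cvg.
have lo : \forall p \near (x0, z0), 0 < p.2 - H (p.1, y0 - e).
  have cv : (fun p : R * R => p.2 - H (p.1, y0 - e)) @ (x0, z0) -->
     z0 - H (x0, y0 - e) by apply: cvgB.
  apply: (cvgr_gt _ cv).
  by rewrite subr_gt0 -Hy0; apply: inc_H; rewrite ltrBlDr ltrDl.
have hi : \forall p \near (x0, z0), 0 < H (p.1, y0 + e) - p.2.
  have cv : (fun p : R * R => H (p.1, y0 + e) - p.2) @ (x0, z0) -->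
     H (x0, y0 + e) - z0 by apply: cvgB.
  apply: (cvgr_gt _ cv).
  by rewrite subr_gt0 -Hy0; apply: inc_H; rewrite ltrDl.
apply: filterS2 lo hi => p; rewrite !subr_gt0 -(HK p) => /mono_H lo /mono_H hi.
by rewrite ltr_norml; apply/andP; split; lra.
Qed.

Lemma fibered_homeo (phi : R -> R) (H : R * R -> R) :
    continuous phi -> {homo phi : x y / x < y} ->
    (exists B, forall x, `|phi x - x| <= B) ->
    continuous H -> (forall x, {homo (fun y => H (x, y)) : y z / y < z}) ->
    (forall x, exists B, forall y, `|H (x, y) - y| <= B) ->
  exists f g : R * R -> R * R, [/\ continuous f, continuous g, cancel f g,
    cancel g f & forall p, f p = (phi p.1, H p)].
Proof.
move=> cont_phi inc_phi [B phiB] cont_H inc_H HB.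
have inj_homo (u : R -> R) : {homo u : x y / x < y} -> injective u.
  move=> inc_u x y eq_u; apply/eqP; rewrite eq_le !leNgt.
  by apply/andP; split; apply/negP => /inc_u; rewrite eq_u ltxx.
have cont_Hx x : continuous (fun y => H (x, y)).
  move=> y; apply: (@cvg_app _ _ _ _ _ (fun y => (x, y)) H); last exact: cont_H.
  by apply: cvg_prod; [exact: cvg_cst | exact: cvg_id].
have /choice[ps psK] := bounded_displacement_surj cont_phi phiB.
have /choice[K HK] : forall p : R * R, exists y, H (p.1, y) = p.2.
  move=> [x z] /=; have [C HC] := HB x.
  exact: (bounded_displacement_surj (cont_Hx x) HC).
have cont_K := continuous_fiber_inverse cont_H inc_H HK.
(* The inverse of [phi] is treated as the fibre inverse of a map that does not depend on the first
   coordinate. *)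
have cont_ps2 : continuous (ps \o snd : R * R -> R).
  apply: (@continuous_fiber_inverse (phi \o snd)) => [p|x y z|p] /=.
  - by apply: (@cvg_app _ _ _ _ _ snd phi); [exact: snd_cvg | exact: cont_phi].
  - exact: inc_phi.
  - exact: psK.
have cont_ps : continuous ps.
  move=> x; apply: (@cvg_app _ _ _ _ _ (fun x => (x, x)) (ps \o snd) (x, x)).
    by apply: cvg_prod; exact: cvg_id.
  exact: cont_ps2.
exists (fun p => (phi p.1, H p)), (fun p => (ps p.1, K (ps p.1, p.2))).
split=> // [p|p|[x y]|[u z]] /=.
- apply: cvg_prod; last exact: cont_H.
  by apply: (@cvg_app _ _ _ _ _ fst phi); [exact: fst_cvg | exact: cont_phi].
- have cont_ps1 : (fun p => ps p.1) @ p --> ps p.1.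
    by apply: (@cvg_app _ _ _ _ _ fst ps); [exact: fst_cvg | exact: cont_ps].
  apply: cvg_prod => //.
  apply: (@cvg_app _ _ _ _ _ (fun p => (ps p.1, p.2)) K); last exact: cont_K.
  by apply: cvg_prod => //; exact: snd_cvg.
- have -> : ps (phi x) = x by apply: (inj_homo phi inc_phi); rewrite psK.
  by congr (_, _); apply: (inj_homo _ (inc_H x)); rewrite (HK (x, _)).
- by rewrite psK (HK (ps u, z)).
Qed.

(** Increasing maps of bounded displacement are stable under convex combination; the weight [t] is 0
    at the earlier nodes and 1 at the new one. *)
Lemma interpolate_fibers m (al : nat -> R) (psi : nat -> R -> R) :
    increasing_upto m al ->
    (forall j, (j < m)%N -> [/\ continuous (psi j),
       {homo psi j : y z / y < z} & exists B, forall y, `|psi j y - y| <= B]) ->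
  exists Theta : R * R -> R, [/\ continuous Theta,
    forall x, {homo (fun y => Theta (x, y)) : y z / y < z},
    forall x, exists B, forall y, `|Theta (x, y) - y| <= B
    & forall j y, (j < m)%N -> Theta (al j, y) = psi j y].
Proof.
elim: m => [|m IH] inc_al psiP.
  exists snd; split; [exact: snd_cvg | by move=> x y z | | by move=> j y].
  by move=> x; exists 0 => y; rewrite subrr normr0.
have [|j lt_j|Th [cont_Th inc_Th ThB Th_al]] := IH.
- exact: increasing_uptoW.
- by apply: psiP; apply: ltnW.
have [t [cont_t t_ge0 t_le1 t_0 t_1]] : exists t : R -> R, [/\ continuous t,
    forall x, 0 <= t x, forall x, t x <= 1,
    forall j, (j < m)%N -> t (al j) = 0 & t (al m) = 1].
  case: m {IH psiP Th_al} inc_al => [|m] inc_al.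
    by exists (fun=> 1); split=> // x; exact: cvg_cst.
  have l_gt0 : 0 < al m.+1 - al m by rewrite subr_gt0 inc_al.
  set l := al m.+1 - al m in l_gt0.
  have clamp_ge0 x : 0 <= clamp x l.
    have [le_x|lt_x] := leP x 0; first by rewrite clamp_le0 // ltW.
    have [le_xl|lt_xl] := leP x l; first by rewrite clamp_mid // ltW.
    by rewrite clamp_ge // ltW.
  have clamp_le x : clamp x l <= l.
    have [le_x|lt_x] := leP x 0; first by rewrite clamp_le0 // ltW.
    have [le_xl|lt_xl] := leP x l; first by rewrite clamp_mid // ltW.
    by rewrite clamp_ge // ltW.
  exists (fun x => clamp (x - al m) l / l); split.
  - move=> x; apply: cvgM; last exact: cvg_cst.
    apply: cvgM; last exact: cvg_cst.
    have cx : (fun x => x - al m) @ x --> x - al m.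
      by apply: cvgB; [exact: cvg_id | exact: cvg_cst].
    apply: cvgD; last exact: cvg_cst.
    apply: cvgB; apply: cvg_norm => //.
    by apply: cvgB => //; exact: cvg_cst.
  - by move=> x; rewrite divr_ge0 // ltW.
  - by move=> x; rewrite ler_pdivrMr // mul1r.
  - move=> j lt_j; rewrite clamp_le0 ?mul0r ?(ltW l_gt0) // subr_le0.
    move: lt_j; rewrite ltnS leq_eqVlt => /predU1P[->//|lt_j].
    by rewrite ltW // (increasing_upto_lt inc_al) // ltnW.
  - by rewrite clamp_mid // ?divff ?gt_eqF // ltW.
have [cont_psi inc_psi [B psiB]] := psiP m (ltnSn m).
exists (fun p => (1 - t p.1) * Th p + t p.1 * psi m p.2); split.
- move=> p; have ct : (fun p => t p.1) @ p --> t p.1.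
    by apply: (@cvg_app _ _ _ _ _ fst t); [exact: fst_cvg | exact: cont_t].
  apply: cvgD; apply: cvgM => //.
  + by apply: cvgB => //; exact: cvg_cst.
  + exact: cont_Th.
  + by apply: (@cvg_app _ _ _ _ _ snd (psi m)); [exact: snd_cvg | exact: cont_psi].
- move=> x y z lt_yz /=; have := inc_psi _ _ lt_yz; have := inc_Th x _ _ lt_yz.
  rewrite /= => lt1 lt2; have [t0|tn0] := eqVneq (t x) 0.
    by rewrite t0 subr0 !mul1r !mul0r !addr0.
  have t_gt0 : 0 < t x by rewrite lt_def tn0 t_ge0.
  apply: ler_ltD; first by apply: ler_wpM2l; [rewrite subr_ge0 | apply: ltW].
  by rewrite ltr_pM2l.
- move=> x; have [B' ThB'] := ThB x; exists (B' + B) => y /=.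
  have -> : (1 - t x) * Th (x, y) + t x * psi m y - y =
     (1 - t x) * (Th (x, y) - y) + t x * (psi m y - y) by ring.
  rewrite (le_trans (ler_normD _ _)) // lerD // normrM ger0_norm ?subr_ge0 //.
    by rewrite -[leRHS]mul1r ler_pM ?subr_ge0 // gerBl.
  by rewrite -[leRHS]mul1r ler_pM.
- move=> j y; rewrite ltnS leq_eqVlt => /predU1P[->|lt_j] /=.
    by rewrite t_1 subrr mul0r add0r mul1r.
  by rewrite t_0 // subr0 mul1r mul0r addr0 Th_al.
Qed.

End FiberedHomeo.

(** * A homeomorphism from ordered lists of roots *)

Section RootHomeo.
Variable R : realType.
Implicit Types (x y z : R).

(** Equality is encoded by the two strict comparisons: [x] is the critical point of index [j]
    exactly when [x'] is. *)
Definition same_position m (al al' : nat -> R) x x' :=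
  forall j, (j < m)%N -> (x < al j) = (x' < al' j) /\ (al j < x) = (al' j < x').

Definition continuous_list (S : R -> seq R) x := forall e, 0 < e ->
  \forall x1 \near x, size (S x1) = size (S x) /\
    forall i, (i < size (S x))%N -> `|(S x)`_i - (S x1)`_i| < e.

Lemma continuous_list_cvg (S : R -> seq R) x i : continuous_list S x ->
  (i < size (S x))%N -> (fun x => (S x)`_i) @ x --> (S x)`_i.
Proof.
move=> cont_S lt_i; apply/cvgrPdist_lt => e /cont_S.
by apply: filterS => x1 [_]; apply.
Qed.

Lemma sorted_increasing_upto (s : seq R) : sorted <%R s ->
  increasing_upto (size s) (nth 0 s).
Proof. by move=> /(sortedP 0) sorted_s i; apply: sorted_s. Qed.

Lemma homo_lt_mono (u : R -> R) : {homo u : x y / x < y} -> {mono u : x y / x < y}.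
Proof. by move=> inc_u; apply: leW_mono; apply: le_mono. Qed.

Variables (S S' : R -> seq R) (m : nat) (al al' : nat -> R).
Hypotheses (inc_al : increasing_upto m al) (inc_al' : increasing_upto m al').
Hypotheses (sorted_S : forall x, sorted <%R (S x)).
Hypotheses (sorted_S' : forall x, sorted <%R (S' x)).
Hypothesis size_S : forall x x', same_position m al al' x x' ->
  size (S x) = size (S' x').
Hypothesis cont_S : forall x, (forall j, (j < m)%N -> x != al j) ->
  continuous_list S x.
Hypothesis cont_S' : forall x, (forall j, (j < m)%N -> x != al' j) ->
  continuous_list S' x.
(** The index [k] is common to [S] and [S']: corresponding branches end at corresponding points of
    the critical fibres. *)
Hypothesis critical_S : forall j, (j < m)%N -> forall e, 0 < e ->
  exists2 d, 0 < d & forall x x', same_position m al al' x x' ->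
    `|x - al j| < d -> `|x' - al' j| < d ->
    forall i, (i < size (S x))%N -> exists2 k, (k < size (S (al j)))%N &
      `|(S x)`_i - (S (al j))`_k| < e /\ `|(S' x')`_i - (S' (al' j))`_k| < e.

(* The [Theta_x] of [interpolate_fibers] already match the critical fibres; on
   the other fibres they are corrected by the piecewise linear map sending
   [Theta_x (S x)_i] to [(S' (phi x))_i], whose displacement vanishes as [x] tends
   to a critical point. *)
Lemma root_homeo : exists f g : R * R -> R * R,
  [/\ continuous f, continuous g, cancel f g, cancel g f
    & forall x y, (y \in S x) = ((f (x, y)).2 \in S' (f (x, y)).1)].
Proof.
pose phi := pl al al' m.
have inc_phi : {homo phi : x y / x < y} by apply: pl_homo.
have mono_phi := homo_lt_mono inc_phi.
have phi_al j : (j < m)%N -> phi (al j) = al' j by apply: pl_node.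
have cont_phi : continuous phi.
  move=> x; apply: (@cvg_pl _ _ _ _ (fun i _ => al i) (fun i _ => al' i)) => //.
  - by move=> i _; apply: cvg_cst.
  - by move=> i _; apply: cvg_cst.
have pos_phi x : same_position m al al' x (phi x).
  by move=> j lt_j; rewrite -(phi_al j lt_j) !mono_phi.
have sz_phi x : size (S x) = size (S' (phi x)) by apply: size_S.
have sz_al j : (j < m)%N -> size (S (al j)) = size (S' (al' j)).
  by move=> lt_j; rewrite -(phi_al j lt_j).
pose psi j := pl (nth 0 (S (al j))) (nth 0 (S' (al' j))) (size (S (al j))).
have inc_S x : increasing_upto (size (S x)) (nth 0 (S x)).
  exact: sorted_increasing_upto.
have inc_S' x : increasing_upto (size (S x)) (nth 0 (S' (phi x))).
  by rewrite sz_phi; apply: sorted_increasing_upto.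
have [|Th [cont_Th inc_Th ThB Th_al]] := @interpolate_fibers R m al psi inc_al.
  move=> j lt_j; have inc_Sj' : increasing_upto (size (S (al j))) (nth 0 (S' (al' j))).
    by rewrite -(phi_al j lt_j).
  split; [|exact: pl_homo|exact: pl_bounded].
  move=> y; apply: (@cvg_pl _ _ _ _ (fun i _ => nth 0 (S (al j)) i)
     (fun i _ => nth 0 (S' (al' j)) i)) => //.
  - by move=> i _; apply: cvg_cst.
  - by move=> i _; apply: cvg_cst.
pose a x i := Th (x, (S x)`_i).
pose b x i := (S' (phi x))`_i.
have inc_a x : increasing_upto (size (S x)) (a x).
  by move=> i lt_i; apply: inc_Th; apply: inc_S.
pose H p := pl (a p.1) (b p.1) (size (S p.1)) (Th p).
have inc_H x : {homo (fun y => H (x, y)) : y z / y < z}.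
  by move=> y z lt_yz; apply: pl_homo (inc_Th x _ _ lt_yz).
have HB x : exists B, forall y, `|H (x, y) - y| <= B.
  have [B ThBx] := ThB x; have [B' plB'] := pl_bounded (inc_a x) (inc_S' x).
  exists (B' + B) => y.
  have -> : H (x, y) - y = (H (x, y) - Th (x, y)) + (Th (x, y) - y) by ring.
  by rewrite (le_trans (ler_normD _ _)) // lerD // ?plB' ?ThBx.
have cont_H : continuous H.
  move=> [x0 y0].
  have [crit|ncrit] := pselect (exists2 j, (j < m)%N & x0 = al j); last first.
    have nc x j : x = x0 -> (j < m)%N -> x != al j.
      by move=> -> lt_j; apply/eqP => eq_x; apply: ncrit; exists j.
    have cS : continuous_list S x0 by apply: cont_S => j; apply: nc.
    have cS' : continuous_list S' (phi x0).
      apply: cont_S' => j lt_j; rewrite -(phi_al j lt_j).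
      by rewrite (inj_eq (inc_inj (le_mono inc_phi))) nc.
    have near_sz : \forall p \near (x0, y0), size (S p.1) = size (S x0).
      apply: (@near_fst _ _ x0 y0 (fun x => size (S x) = size (S x0))).
      by have := cS 1 ltr01; apply: filterS => x [].
    (* The number of nodes is frozen at its value at [x0], near which it is constant, so that
       [cvg_pl] applies. *)
    pose G p := pl (a p.1) (b p.1) (size (S x0)) (Th p).
    apply: (@cvg_trans _ (G @ (x0, y0))).
      by apply: near_eq_cvg; apply: filterS near_sz => p eq_sz; rewrite /G /H eq_sz.
    suff : G @ (x0, y0) --> pl (a x0) (b x0) (size (S x0)) (Th (x0, y0)) by [].
    apply: (@cvg_pl R _ (nbhs (x0, y0)) _ (fun i (p : R * R) => a p.1 i)
       (fun i p => b p.1 i)).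
    - exact: inc_a.
    - move=> i lt_i; apply: (@cvg_app _ _ _ _ _ (fun p : R * R => (p.1, (S p.1)`_i)) Th) => //.
      apply: cvg_prod; first exact: fst_cvg.
      have cv := continuous_list_cvg cS lt_i.
      exact: (cvg_comp _ _ (@fst_cvg _ _ (x0, y0)) cv).
    - move=> i lt_i; rewrite sz_phi in lt_i.
      have cv := continuous_list_cvg cS' lt_i.
      have cv2 : (fun p : R * R => phi p.1) @ (x0, y0) --> phi x0.
        apply: (@cvg_app _ _ _ _ _ (fun p : R * R => p.1) phi) => //.
        exact: fst_cvg.
      exact: (cvg_comp _ _ cv2 cv).
    - exact: cont_Th.
  have [j lt_j Dx0] := crit.
  (* Over a critical point the nodes and values of the correction coincide, so it is the
     identity. *)
  have H0 : H (x0, y0) = Th (x0, y0).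
    apply/eqP; rewrite -subr_eq0 -normr_le0; apply: pl_dist => //.
    move=> i lt_i; rewrite /a /b Dx0 /= Th_al // /psi pl_node ?phi_al ?subrr ?normr0 //.
    - by rewrite -(phi_al j lt_j).
    - by rewrite -Dx0.
  apply/cvgrPdist_lt => e e_gt0.
  (* Two errors of [e / 8] bound the correction by [e / 4]; the variation of [Th] takes [e / 2]. *)
  have e8_gt0 : 0 < e / 8 by rewrite divr_gt0.
  have Th_c k : (k < size (S (al j)))%N -> Th (al j, (S (al j))`_k) = (S' (al' j))`_k.
    by move=> lt_k; rewrite Th_al // /psi pl_node // -(phi_al j lt_j).
  have [d1 [d1_gt0 d1P]] : exists d1 : R, 0 < d1 /\
      forall k x y, (k < size (S (al j)))%N -> `|x - al j| < d1 ->
        `|y - (S (al j))`_k| < d1 -> `|(S' (al' j))`_k - Th (x, y)| < e / 8.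
    have near_d : \forall d \near (0 : R)^'+,
        forall k : 'I_(size (S (al j))), forall x y, `|x - al j| < d ->
        `|y - (S (al j))`_k| < d -> `|(S' (al' j))`_k - Th (x, y)| < e / 8.
      apply: filter_forall => k.
      have /cvgrPdist_lt/(_ _ e8_gt0) := cont_Th (al j, (S (al j))`_k).
      move=> /nbhs_ballP[d0 /= d0_gt0 d0P].
      have := nbhs_right_lt d0_gt0; apply: filterS => d lt_d x y dx dy.
      have := d0P (x, y); rewrite Th_c //; apply; split; rewrite /ball /= distrC;
      exact: lt_trans lt_d.
    have [d [d_gt0 dP]] := filter_ex (filterI (nbhs_right_gt (0 : R)) near_d).
    by exists d; split=> // k x y lt_k; apply: (dP (Ordinal lt_k)).
  have m_gt0 : 0 < Num.min d1 (e / 8) by rewrite lt_min d1_gt0.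
  have [d d_gt0 dP] := critical_S lt_j m_gt0.
  have near_x : \forall p \near (x0, y0), [/\ `|p.1 - al j| < d, `|p.1 - al j| < d1
      & `|phi p.1 - al' j| < d].
    have near_x0 : \forall x \near x0, [/\ `|x - al j| < d, `|x - al j| < d1
      & `|phi x - al' j| < d].
      have dist_id d' : 0 < d' -> \forall x \near x0, `|x - al j| < d'.
        by move=> d'_gt0; rewrite -Dx0; have /cvgrPdist_lt/(_ _ d'_gt0) := @cvg_id _ (nbhs x0);
           apply: filterS => x; rewrite distrC.
      have /cvgrPdist_lt/(_ _ d_gt0) := cont_phi x0.
      apply: filterS3 (dist_id _ d_gt0) (dist_id _ d1_gt0) => x h1 h2.
      by rewrite Dx0 phi_al // distrC => h3.
    exact: (@near_fst _ _ x0 y0 (fun x => [/\ `|x - al j| < d, `|x - al j| < d1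
      & `|phi x - al' j| < d])).
  have e2_gt0 : 0 < e / 2 by rewrite divr_gt0.
  have /cvgrPdist_lt/(_ _ e2_gt0) := cont_Th (x0, y0).
  apply: filterS2 near_x => -[x y] /= [h1 h2 h3] near_Th.
  have le_H : `|H (x, y) - Th (x, y)| <= e / 4.
    apply: pl_dist => // [|i lt_i]; first by rewrite divr_ge0 // ltW.
    have [k lt_k [c1 c2]] := dP x (phi x) (pos_phi x) h1 h3 i lt_i.
    rewrite lt_min in c1; case/andP: c1 => c1 _.
    rewrite lt_min in c2; case/andP: c2 => _ c2.
    have := d1P k x _ lt_k h2 c1; rewrite -/(a x i) => c3.
    have -> : b x i - a x i = (b x i - (S' (al' j))`_k) + ((S' (al' j))`_k - a x i).
      by ring.
    apply: le_trans (ler_normD _ _) _; rewrite -/(b x i) in c2.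
    have -> : e / 4 = e / 8 + e / 8 by lra.
    by apply: lerD; apply: ltW.
  have -> : H (x0, y0) - H (x, y) =
      (Th (x0, y0) - Th (x, y)) - (H (x, y) - Th (x, y)) by rewrite H0; ring.
  by rewrite (le_lt_trans (ler_normB _ _)) //; move: near_Th le_H; lra.
have [|f [g [cont_f cont_g fK gK fE]]] :=
  fibered_homeo cont_phi inc_phi _ cont_H inc_H HB; first exact: pl_bounded.
exists f, g; split=> // x y; rewrite fE /=.
have HS i : (i < size (S x))%N -> H (x, (S x)`_i) = (S' (phi x))`_i.
  by move=> lt_i; rewrite /H /= -/(a x i) pl_node.
apply/idP/idP => [y_S|].
  have lt_i : (index y (S x) < size (S x))%N by rewrite index_mem.
  by rewrite -{1}(nth_index 0 y_S) HS // mem_nth // -sz_phi.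
move=> /(nthP 0)[k]; rewrite -sz_phi => lt_k; rewrite -HS // => eq_H.
by rewrite -(inc_inj (le_mono (inc_H x)) eq_H) mem_nth.
Qed.

End RootHomeo.

Lemma size_deriv_char0 (A : idomainType) (P : {poly A}) :
  (forall n, n.+1%:R != 0 :> A) -> size P^`() = (size P).-1.
Proof.
move=> charA; have [le1|gt1] := leqP (size P) 1.
  rewrite [P]size1_polyC // derivC size_poly0 size_polyC.
  by case: eqP.
case Dn: (size P) gt1 => [|[|n]] // _; apply/eqP; rewrite eqn_leq; apply/andP; split.
  by rewrite -ltnS -Dn lt_size_deriv // -size_poly_gt0 Dn.
rewrite ltnNge; apply/negP => /leq_sizeP/(_ n (leqnn n))/eqP.
rewrite coef_deriv -mulr_natr mulf_eq0 (negPf (charA n)) orbF.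
have -> : P`_n.+1 = lead_coef P by rewrite lead_coefE Dn.
by rewrite lead_coef_eq0 -size_poly_eq0 Dn.
Qed.

Lemma lead_coef_deriv_char0 (A : idomainType) (P : {poly A}) :
    (forall n, n.+1%:R != 0 :> A) -> (1 < size P)%N ->
  lead_coef P^`() = lead_coef P *+ (size P).-1.
Proof.
move=> charA gt1; rewrite lead_coefE size_deriv_char0 // coef_deriv lead_coefE.
by case: (size P) gt1 => [|[|n]].
Qed.

(** * Specialization of the parameters *)

(** The last column of the Sylvester matrix contains only zeros and multiples of the leading
    coefficient. Used by contraposition: a specialization under which the discriminant survives
    preserves the degree. *)
Lemma Dres_lead0 (A : idomainType) (B : comNzRingType) (phi : {rmorphism A -> B})
    (P : {poly A}) : (forall n, n.+1%:R != 0 :> A) -> (1 < size P)%N ->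
  phi (lead_coef P) = 0 -> phi (Dres P) = 0.
Proof.
move=> charA gt1 lc0; case Dn: (size P) gt1 => [|[|n]] // _.
have sz' : size P^`() = n.+1 by rewrite size_deriv_char0 // Dn.
have P0 k : (n < k)%N -> phi P`_k = 0.
  rewrite leq_eqVlt => /predU1P[<-|lt_k]; last by rewrite nth_default ?rmorph0 ?Dn.
  by rewrite -lc0 lead_coefE Dn.
rewrite /Dres /resultant -det_map_mx.
have lt_j : (((size P^`()).-1 + (size P).-1).-1 < (size P^`()).-1 + (size P).-1)%N.
  by rewrite prednK // Dn addnS.
rewrite (expand_det_col _ (Ordinal lt_j)) big1 // => i _.
rewrite mxE Sylvester_mxE /=; case: splitP => k Dk.
  rewrite rmorphMn /= P0 ?mul0rn ?mul0r //.
  by have := ltn_ord k; move: (nat_of_ord k) => l; rewrite sz' Dn /=; clear; lia.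
rewrite rmorphMn /= coef_deriv rmorphMn /= P0 ?mul0rn ?mul0r //.
by have := ltn_ord k; move: (nat_of_ord k) => l; rewrite sz' Dn /=; clear; lia.
Qed.

Lemma map_Dres (A : idomainType) (B : idomainType)
    (phi : {rmorphism {poly A} -> B}) (P : {poly {poly A}}) :
    (forall n, n.+1%:R != 0 :> B) -> (1 < size P)%N ->
  phi (lead_coef P) != 0 -> phi (Dres P) = Dres (map_poly phi P).
Proof.
move=> charB gt1 lc_n0.
have charA n : n.+1%:R != 0 :> {poly A}.
  by apply: contraNneq (charB n) => n0; rewrite -(rmorph_nat phi) n0 rmorph0.
rewrite /Dres map_resultant ?deriv_map // lead_coef_deriv_char0 // rmorphMn /=.
by rewrite -mulr_natr mulf_neq0 //; case: (size P) gt1 => [|[|n]] //= _.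
Qed.

Section Specialize.
Variables (A1 : idomainType) (K : rcfType).
Local Notation A := {poly A1}.
Variable E : {rmorphism A -> K}.
Variables (F : {poly {poly A}}) (M : {poly A}) (c0 : A).
Hypotheses (sz_F : (1 < size F)%N) (lc_F : lead_coef F = c0%:P).
Hypothesis M_dvd : exists k, Dres F = k * M.
Hypothesis dvd_M : exists n k, M ^+ n = k * Dres F.
Hypothesis sz_M : (1 < size M)%N.
Hypothesis E_M : E (Dres M) != 0.

Local Notation X := (map_poly E).
Local Notation Y := (map_poly (map_poly E)).

Let charK n : n.+1%:R != 0 :> K. Proof. by rewrite pnatr_eq0. Qed.
Let charA n : n.+1%:R != 0 :> A.
Proof. by apply: contraNneq (charK n) => n0; rewrite -(rmorph_nat E) n0 rmorph0. Qed.
Let charKX n : n.+1%:R != 0 :> {poly K}.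
Proof. by rewrite -polyC_natr polyC_eq0. Qed.
Let charAX n : n.+1%:R != 0 :> {poly A}.
Proof. by rewrite -polyC_natr polyC_eq0. Qed.

Lemma spec_lead_M : E (lead_coef M) != 0.
Proof. by apply: contraNneq E_M => lc0; rewrite Dres_lead0. Qed.

Lemma spec_M_neq0 : X M != 0.
Proof.
apply: contraNneq spec_lead_M => XM0.
by rewrite lead_coefE -(coef_map E) XM0 coef0.
Qed.

Lemma spec_G_neq0 : X (Dres F) != 0.
Proof.
have [n [k Dk]] := dvd_M; apply: contraNneq spec_M_neq0 => XG0.
have := congr1 X Dk; rewrite rmorphM rmorphXn /= XG0 mulr0 => /eqP.
by rewrite expf_eq0 => /andP[].
Qed.

(** Otherwise [Dres_lead0] makes the whole discriminant of [F] specialize to 0, and with it a power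
    of [M]. *)
Lemma spec_c0 : E c0 != 0.
Proof.
apply: contraNneq spec_G_neq0 => Ec0.
rewrite (Dres_lead0 (phi := X) charAX sz_F) //.
by rewrite lc_F [LHS]map_polyC /= Ec0.
Qed.

Lemma spec_size_F : size (Y F) = size F.
Proof. by rewrite size_map_poly_id0 // lc_F map_polyC polyC_eq0 spec_c0. Qed.

Lemma spec_lead_F : lead_coef (Y F) = (E c0)%:P.
Proof.
by rewrite lead_coef_map_eq lc_F /= map_polyC // polyC_eq0 spec_c0.
Qed.

Lemma spec_G : X (Dres F) = Dres (Y F).
Proof. by apply: map_Dres => //; rewrite lc_F /= map_polyC polyC_eq0 spec_c0. Qed.

Lemma spec_size_M : size (X M) = size M.
Proof. by rewrite size_map_poly_id0 ?spec_lead_M. Qed.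

(** The leading coefficient of [Dres F] divides a power of that of [M], which survives. *)
Lemma spec_size_G : size (X (Dres F)) = size (Dres F).
Proof.
have [n [k Dk]] := dvd_M; rewrite size_map_poly_id0 //.
have := congr1 (E \o lead_coef) Dk; rewrite /= lead_coef_exp lead_coefM.
rewrite rmorphXn rmorphM /= => eq_lc; apply: contraNneq spec_lead_M => lc0.
by have /eqP := eq_lc; rewrite lc0 mulr0 expf_eq0 => /andP[].
Qed.

Lemma spec_G_dvd : (exists n, X (Dres F) %| X M ^+ n) /\ X M %| X (Dres F).
Proof.
have [[k Dk] [n [k' Dk']]] := (M_dvd, dvd_M); split; last first.
  by rewrite Dk rmorphM dvdp_mull.
by exists n; rewrite -rmorphXn Dk' rmorphM dvdp_mull.
Qed.

Lemma root_dvdp_exp (L : fieldType) (q1 q2 : {poly L}) n x :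
  q1 %| q2 ^+ n -> root q1 x -> root q2 x.
Proof.
rewrite -!dvdp_XsubCl => dv /dvdp_trans/(_ dv).
by rewrite !dvdp_XsubCl !rootE horner_exp expf_eq0 => /andP[].
Qed.

Lemma spec_root_G x : root (X (Dres F)) x = root (X M) x.
Proof.
have [[n dvn] dvM] := spec_G_dvd; apply/idP/idP; first exact: root_dvdp_exp dvn.
exact: (@root_dvdp_exp _ _ _ 1).
Qed.

Lemma ndroots_coprime (q : {poly K}) : coprimep q q^`() -> ndroots q = (size q).-1.
Proof.
move=> cop; have q_n0 : q != 0.
  apply: contraTneq cop => ->.
  by rewrite deriv0 /coprimep gcd0p size_poly0.
rewrite /ndroots undup_id ?size_croots // -separable_prod_XsubC.
have : separable_poly (map_poly (real_complex K) q).
  by rewrite separable_poly.unlock deriv_map coprimep_map.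
have lc_n0 : (lead_coef q)%:C%C != 0 by rewrite fmorph_eq0 lead_coef_eq0.
by rewrite !separable_poly.unlock crootsE derivZ coprimepZl ?coprimepZr.
Qed.

Lemma Dres_coprime (q : {poly K}) : q != 0 -> Dres q != 0 -> coprimep q q^`().
Proof.
move=> q_n0; rewrite resultant_eq0 -leqNgt coprimep_def => le1.
by rewrite eqn_leq le1 size_poly_gt0 gcdp_eq0 (negPf q_n0).
Qed.

Lemma spec_ndroots_M : ndroots (X M) = (size M).-1.
Proof.
rewrite ndroots_coprime ?spec_size_M //; apply: Dres_coprime.
  exact: spec_M_neq0.
by rewrite -map_Dres // spec_lead_M.
Qed.

(** Both divisibilities between [M] and [Dres F] survive specialization, so the two have the same
    complex roots, and those of [M] are simple. *)
Lemma spec_ndroots_G : ndroots (X (Dres F)) = (size M).-1.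
Proof.
rewrite -spec_ndroots_M; apply/perm_size/perm_undup => z.
have mem (q : {poly K}) : q != 0 ->
    (z \in croots q) = root (map_poly (real_complex K) q) z.
  move=> q_n0; rewrite crootsE rootZ ?root_prod_XsubC //.
  by rewrite fmorph_eq0 lead_coef_eq0.
rewrite !mem ?spec_M_neq0 ?spec_G_neq0 //.
have [[n dvn] dvM] := spec_G_dvd; apply/idP/idP; last first.
  by apply: (@root_dvdp_exp _ _ _ 1); rewrite expr1 dvdp_map.
rewrite -(dvdp_map (real_complex K)) rmorphXn /= in dvn.
exact: root_dvdp_exp dvn.
Qed.

Local Notation fiber x := (map_poly (horner_eval x) (Y F)).

Lemma spec_size_fiber x : size (fiber x) = size F.
Proof.
by rewrite size_map_poly_id0 ?spec_size_F // spec_lead_F /= /horner_eval hornerC spec_c0.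
Qed.

Lemma spec_fiber_neq0 x : fiber x != 0.
Proof. by rewrite -size_poly_gt0 spec_size_fiber ltnW. Qed.

Lemma spec_ndroots_fiber x : ~~ root (X M) x -> ndroots (fiber x) = (size F).-1.
Proof.
rewrite -spec_root_G spec_G => nr.
rewrite ndroots_coprime ?spec_size_fiber //; apply: Dres_coprime.
  exact: spec_fiber_neq0.
rewrite -map_Dres //; first by rewrite spec_size_F.
by rewrite spec_lead_F /= /horner_eval hornerC spec_c0.
Qed.

Lemma ndroots_le (q : {poly K}) : q != 0 -> (ndroots q <= (size q).-1)%N.
Proof. by move=> q_n0; rewrite -size_croots // size_undup. Qed.

Lemma spec_polar lam : E lam != 0 -> X (polar lam F) = polar (E lam) (Y F).
Proof.
move=> lam_n0; have lam_n0A : lam != 0 by apply: contraNneq lam_n0 => ->; rewrite rmorph0.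
have c0_n0 : c0 != 0 by apply: contraNneq spec_c0 => ->; rewrite rmorph0.
apply: map_polar.
  have -> : lead_coef (map_poly (@deriv A) F + lam%:P *: F) = (lam * c0)%:P.
    have sz_lf : size (lam%:P *: F) = size F by rewrite size_scale ?polyC_eq0.
    rewrite lead_coefDr ?lead_coefZ ?lc_F ?polyCM // sz_lf.
    rewrite -(ltn_predK sz_F) ltnS; apply/leq_sizeP => j.
    rewrite leq_eqVlt coef_map_id0 ?deriv0 //.
    case/predU1P=> [<-|lt_j]; last first.
      by rewrite nth_default ?deriv0 // -(ltn_predK sz_F).
    by rewrite -lead_coefE lc_F derivC.
  by rewrite map_polyC polyC_eq0 /= rmorphM mulf_neq0 // spec_c0.
rewrite lead_coef_deriv_char0 // lc_F -mulr_natr -polyC_natr -polyCM map_polyC.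
rewrite polyC_eq0 /= rmorphM rmorph_nat mulf_neq0 ?spec_c0 //.
by rewrite pnatr_eq0; case: (size F) sz_F => [|[|n]].
Qed.

End Specialize.

(** * Continuity in the parameters *)

Section Evaluation.
Variable R : realType.

Lemma dvdXn_coef (Q : {poly R}) k :
  reflect (forall i, (i < k)%N -> Q`_i = 0) ('X^k %| Q).
Proof.
apply: (iffP idP) => [/dvdpP[q ->] i lt_i|Q0]; first by rewrite coefMXn lt_i.
rewrite -(poly_take_drop k Q) dvdp_addr ?dvdp_mull //.
suff -> : take_poly k Q = 0 by rewrite dvdp0.
by apply/polyP => i; rewrite coef_take_poly coef0; case: ifP => // /Q0.
Qed.

(** Nondivisibility means that some Taylor coefficient at [a0] of index below [k] is nonzero; with
    degrees bounded by [N] it is a finite sum, continuous in the polynomial and in the point. *)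
Lemma near_ndvdp (T : Type) (F : set_system T) (FF : Filter F) (N k : nat)
    (P : T -> {poly R}) (P0 : {poly R}) (a : T -> R) (a0 : R) :
    (forall t, (size (P t) <= N)%N) -> (size P0 <= N)%N ->
    (forall i, (fun t => (P t)`_i) @ F --> P0`_i) -> a @ F --> a0 ->
    ~~ (('X - a0%:P) ^+ k %| P0) ->
  \forall t \near F, ~~ (('X - (a t)%:P) ^+ k %| P t).
Proof.
move=> sz_P sz_P0 cvg_P cvg_a; rewrite -dvdp_shift => ndv.
have [i lt_ik ne_i] : exists2 i, (i < k)%N & (P0 \Po ('X + a0%:P))`_i != 0.
  apply: contrapT => nex; case/negP: ndv; apply/dvdXn_coef => i lt_i.
  by apply/eqP; apply: contrapT => /negP ne_i; apply: nex; exists i.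
have coefE (Q : {poly R}) b : (size Q <= N)%N ->
    (Q \Po ('X + b%:P))`_i = \sum_(l < N) Q`_l * (('X + b%:P) ^+ l)`_i.
  move=> sz_Q; rewrite coef_comp_poly.
  rewrite (big_ord_widen _ (fun l => Q`_l * (('X + b%:P) ^+ l)`_i) sz_Q).
  rewrite big_mkcond; apply: eq_bigr => l _; case: ltnP => // le_l.
  by rewrite nth_default ?mul0r.
have cvg_Xa l n : (fun t => (('X + (a t)%:P) ^+ l)`_n) @ F --> (('X + a0%:P) ^+ l)`_n.
  elim: l n => [|l IH] n; first exact: cvg_cst.
  rewrite exprSr mulrDr coefD coefMC coefMX.
  under eq_cvg do rewrite exprSr mulrDr coefD coefMC coefMX.
  apply: cvgD; last by apply: cvgM; [exact: IH | exact: cvg_a].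
  by case: n => [|n] /=; [exact: cvg_cst | exact: IH].
have cvg_i : (fun t => (P t \Po ('X + (a t)%:P))`_i) @ F --> (P0 \Po ('X + a0%:P))`_i.
  rewrite coefE //; under eq_cvg do rewrite coefE //.
  apply: (@cvg_big _ _ (+%R : R -> R -> R)) => [|l _]; first exact: add_continuous.
  by apply: cvgM; [exact: cvg_P | exact: cvg_Xa].
apply: filterS (cvgr_neq0 _ cvg_i ne_i) => t ne_t.
rewrite -dvdp_shift; apply: contra ne_t => /dvdXn_coef/(_ i lt_ik)->.
exact: eqxx.
Qed.

(** The evaluation [eval_ts] as a ring morphism, so that it can be mapped over polynomials and
    through resultants. *)
Definition evts (p : R * R) : {rmorphism {poly {poly R}} -> R} :=
  horner_eval p.1 \o horner_eval (p.2)%:P.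

Lemma continuous_horner (c : {poly R}) : continuous (horner c).
Proof.
elim/poly_ind: c => [|c a IH] x; rewrite /continuous_at.
  by under eq_cvg do rewrite horner0; rewrite horner0; exact: cvg_cst.
rewrite hornerMXaddC; under eq_cvg do rewrite hornerMXaddC.
by apply: cvgD; [apply: cvgM; [exact: IH | exact: cvg_id] | exact: cvg_cst].
Qed.

Lemma continuous_evts (q : {poly {poly R}}) : continuous (fun p => evts p q).
Proof.
elim/poly_ind: q => [|q c IH] p; rewrite /continuous_at.
  by under eq_cvg do rewrite rmorph0; rewrite rmorph0; exact: cvg_cst.
have evE p1 : evts p1 (q * 'X + c%:P) = evts p1 q * p1.2 + c.[p1.1].
  by rewrite /evts /= /horner_eval hornerMXaddC hornerD hornerM hornerC.
rewrite evE; under eq_cvg do rewrite evE.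
apply: cvgD; first by apply: cvgM; [exact: IH | exact: snd_cvg].
by apply: (@cvg_app _ _ _ _ _ fst (horner c)); [exact: fst_cvg | exact: continuous_horner].
Qed.

Lemma continuous_evxts (c : {poly {poly {poly R}}}) :
  continuous (fun z : R * (R * R) => (map_poly (evts z.2) c).[z.1]).
Proof.
elim/poly_ind: c => [|c q IH] z; rewrite /continuous_at.
  by under eq_cvg do rewrite map_poly0 horner0; rewrite map_poly0 horner0; exact: cvg_cst.
have evE z1 : (map_poly (evts z1.2) (c * 'X + q%:P)).[z1.1] =
    (map_poly (evts z1.2) c).[z1.1] * z1.1 + evts z1.2 q.
  by rewrite rmorphD rmorphM /= map_polyX map_polyC hornerMXaddC.
rewrite evE; under eq_cvg do rewrite evE.
apply: cvgD; first by apply: cvgM; [exact: IH | exact: fst_cvg].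
by apply: (@cvg_app _ _ _ _ _ snd (fun p => evts p q)); [exact: snd_cvg | exact: continuous_evts].
Qed.

End Evaluation.

(** * Critical points and fibres over good parameters *)

Section Family.
Variables (R : realType) (F : {poly {poly {poly {poly R}}}}).
Variables (M : {poly {poly {poly R}}}) (c0 : {poly {poly R}}).
Hypotheses (sz_F : (1 < size F)%N) (lc_F : lead_coef F = c0%:P).
Hypothesis M_dvd : exists k, Dres F = k * M.
Hypothesis dvd_M : exists n k, M ^+ n = k * Dres F.
Hypothesis sz_M : (1 < size M)%N.
Implicit Types (p : R * R) (x y : R).

Definition good p := evts p (Dres M) != 0.
Definition fiber p x : {poly R} :=
  map_poly (horner_eval x) (map_poly (map_poly (evts p)) F).
Local Notation M_ p := (map_poly (evts p) M).
Local Notation S p x := (rootsR (fiber p x)).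

Lemma fiber_coef p x i : (fiber p x)`_i = (map_poly (evts p) F`_i).[x].
Proof. by rewrite !coef_map. Qed.

Lemma size_fiber p x : good p -> size (fiber p x) = size F.
Proof. by move=> good_p; apply: (spec_size_fiber sz_F lc_F dvd_M sz_M good_p). Qed.

Lemma fiber_neq0 p x : good p -> fiber p x != 0.
Proof. by move=> good_p; rewrite -size_poly_gt0 size_fiber // ltnW. Qed.

Lemma M_neq0 p : good p -> M_ p != 0.
Proof. by move=> good_p; apply: (spec_M_neq0 sz_M good_p). Qed.

Section Limit.
(** One abstract filter covers all limits taken later: [x] alone at fixed [p], [p] alone, both
    jointly, and [x] following a critical point. *)
Variables (T : Type) (Fl : set_system T) (FF : Filter Fl).
Variables (pt : T -> R * R) (p0 : R * R).
Hypotheses (good_p0 : good p0) (cvg_p : pt @ Fl --> p0).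

Lemma near_good : \forall t \near Fl, good (pt t).
Proof.
have cv : (fun t => evts (pt t) (Dres M)) @ Fl --> evts p0 (Dres M).
  by apply: (@cvg_app _ _ _ _ _ pt (fun p => evts p _)) => //; apply: continuous_evts.
exact: (cvgr_neq0 _ cv good_p0).
Qed.

Lemma cvg_spec (c : {poly {poly {poly R}}}) i :
  (fun t => (map_poly (evts (pt t)) c)`_i) @ Fl --> (map_poly (evts p0) c)`_i.
Proof.
rewrite coef_map; under eq_cvg do rewrite coef_map.
by apply: (@cvg_app _ _ _ _ _ pt (fun p => evts p c`_i)) => //; apply: continuous_evts.
Qed.

Lemma cvg_spec_horner (c : {poly {poly {poly R}}}) (xt : T -> R) x0 :
    xt @ Fl --> x0 ->
  (fun t => (map_poly (evts (pt t)) c).[xt t]) @ Fl --> (map_poly (evts p0) c).[x0].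
Proof.
move=> cvg_x; apply: (@cvg_app _ _ _ _ _ (fun t => (xt t, pt t))
  (fun z : R * (R * R) => (map_poly (evts z.2) c).[z.1]) (x0, p0)).
  exact: cvg_prod.
exact: continuous_evxts.
Qed.

Lemma near_rootsR_M (e : R) : 0 < e -> \forall t \near Fl,
  size (rootsR (M_ (pt t))) = size (rootsR (M_ p0)) /\
  forall i, (i < size (rootsR (M_ p0)))%N ->
    `|(rootsR (M_ p0))`_i - (rootsR (M_ (pt t)))`_i| < e.
Proof.
apply: rootsR_near; first exact: M_neq0.
- apply: filterS near_good => t good_t.
  by rewrite (spec_size_M sz_M good_t) (spec_size_M sz_M good_p0).
- exact: cvg_spec.
- apply: filterS near_good => t good_t.
  by rewrite (spec_ndroots_M sz_M good_t) (spec_ndroots_M sz_M good_p0).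
Qed.

Variables (xt : T -> R) (x0 : R).
Hypothesis cvg_x : xt @ Fl --> x0.

Lemma near_size_fiber : \forall t \near Fl, size (fiber (pt t) (xt t)) = size (fiber p0 x0).
Proof. by apply: filterS near_good => t good_t; rewrite !size_fiber. Qed.

Lemma cvg_fiber i : (fun t => (fiber (pt t) (xt t))`_i) @ Fl --> (fiber p0 x0)`_i.
Proof.
rewrite fiber_coef; under eq_cvg do rewrite fiber_coef.
exact: cvg_spec_horner.
Qed.

Lemma near_fiber_root (e : R) : 0 < e -> \forall t \near Fl,
  forall y, y \in S (pt t) (xt t) -> exists2 c, c \in S p0 x0 & `|y - c| < e.
Proof.
move=> e_gt0.
have := real_roots_near_root FF (fiber_neq0 x0 good_p0) near_size_fiber cvg_fiber e_gt0.
apply: filterS2 near_good => t good_t near_t y.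
rewrite mem_rootsR ?fiber_neq0 // => /near_t[c rc lt_c].
by exists c; rewrite // mem_rootsR ?fiber_neq0.
Qed.

Lemma near_rootsR_fiber (e : R) :
    (\forall t \near Fl, ndroots (fiber (pt t) (xt t)) = ndroots (fiber p0 x0)) ->
  0 < e -> \forall t \near Fl, size (S (pt t) (xt t)) = size (S p0 x0) /\
    forall i, (i < size (S p0 x0))%N -> `|(S p0 x0)`_i - (S (pt t) (xt t))`_i| < e.
Proof.
move=> nd; apply: rootsR_near => //; first exact: fiber_neq0.
- exact: near_size_fiber.
- exact: cvg_fiber.
Qed.

Lemma near_rootsR_noncritical (e : R) : ~~ root (M_ p0) x0 -> 0 < e ->
  \forall t \near Fl, size (S (pt t) (xt t)) = size (S p0 x0) /\
    forall i, (i < size (S p0 x0))%N -> `|(S p0 x0)`_i - (S (pt t) (xt t))`_i| < e.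
Proof.
move=> nr; apply: near_rootsR_fiber.
have near_nr : \forall t \near Fl, ~~ root (M_ (pt t)) (xt t).
  rewrite rootE in nr.
  by apply: filterS (cvgr_neq0 _ (@cvg_spec_horner M _ _ cvg_x) nr) => t; rewrite rootE.
apply: filterS2 near_good near_nr => t good_t nr_t.
rewrite (spec_ndroots_fiber sz_F lc_F M_dvd dvd_M sz_M good_t nr_t).
by rewrite (spec_ndroots_fiber sz_F lc_F M_dvd dvd_M sz_M good_p0 nr).
Qed.

End Limit.

Definition crit p j : R := (rootsR (M_ p))`_j.
Definition ncrit p := size (rootsR (M_ p)).

Lemma cvg_crit p0 j : good p0 -> (j < ncrit p0)%N ->
  (crit^~ j) @ p0 --> crit p0 j.
Proof.
move=> good_p0 lt_j; apply/cvgrPdist_lt => e e_gt0.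
by apply: filterS (near_rootsR_M _ good_p0 (@cvg_id _ (nbhs p0)) e_gt0) => p [_]; apply.
Qed.

Lemma near_ncrit p0 : good p0 -> \forall p \near p0, ncrit p = ncrit p0.
Proof.
move=> good_p0.
by apply: filterS (near_rootsR_M _ good_p0 (@cvg_id _ (nbhs p0)) ltr01) => p [].
Qed.

Lemma root_crit p j : good p -> (j < ncrit p)%N -> root (M_ p) (crit p j).
Proof. by move=> good_p lt_j; rewrite -mem_rootsR ?M_neq0 // mem_nth. Qed.

(* The number of distinct roots is lower semicontinuous since roots are
   continuous. By [real_polar_order] it is read off the order of a generic polar
   resultant at the critical point, and this order is upper semicontinuous. *)
Lemma ndroots_critical p0 j : good p0 -> (j < ncrit p0)%N ->
  \forall p \near p0, ndroots (fiber p (crit p j)) = ndroots (fiber p0 (crit p0 j)).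
Proof.
move=> good_p0 lt_j.
have id_p0 : (fun p : R * R => p) @ p0 --> p0 by apply: cvg_id.
have cvg_a := cvg_crit good_p0 lt_j.
have ge_nd : \forall p \near p0,
    (ndroots (fiber p0 (crit p0 j)) <= ndroots (fiber p (crit p j)))%N.
  apply: (ndroots_near_ge _ (fiber_neq0 (crit p0 j) good_p0)
   (near_size_fiber _ good_p0 id_p0 _ _) (@cvg_fiber _ _ _ _ _ id_p0 _ _ cvg_a)).
pose G p := map_poly (evts p) (Dres F).
have near_p0 : \forall p \near p0, good p by apply: (near_good _ good_p0 id_p0).
have G_n0 : G p0 != 0 by apply: (spec_G_neq0 dvd_M sz_M good_p0).
have near_sG : \forall p \near p0, size (G p) = size (G p0).
  apply: filterS near_p0 => p good_p.
  by rewrite (spec_size_G dvd_M sz_M good_p) (spec_size_G dvd_M sz_M good_p0).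
have near_nG : \forall p \near p0, ndroots (G p) = ndroots (G p0).
  apply: filterS near_p0 => p good_p.
  rewrite (spec_ndroots_G M_dvd dvd_M sz_M good_p).
  by rewrite (spec_ndroots_G M_dvd dvd_M sz_M good_p0).
have near_rG : \forall p \near p0, root (G p) (crit p j).
  apply: filterS2 near_p0 (near_ncrit good_p0) => p good_p eq_m.
  by rewrite (spec_root_G (evts p) M_dvd dvd_M) root_crit ?eq_m.
(* The discriminant keeps its number of distinct roots, so the multiplicity is carried along the
   moving root [crit p j]. *)
have near_e : \forall p \near p0, mup (crit p j) (G p) = mup (crit p0 j) (G p0).
  apply: (@mup_near R _ (nbhs p0) (nbhs_filter p0) G (G p0) G_n0) => //.
  - exact: cvg_spec.
  - by rewrite (spec_root_G (evts p0) M_dvd dvd_M) root_crit.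
have order p : good p -> let f := map_poly (map_poly (evts p)) F in
   let Z := ((size F).-1 - ndroots (fiber p (crit p j)))%N in
   let e := mup (crit p j) (G p) in
  [/\ (Z <= e)%N,
      forall lam, lam != 0 -> ('X - (crit p j)%:P) ^+ (e - Z) %| polar lam f
    & exists2 lam, lam != 0 & ~~ (('X - (crit p j)%:P) ^+ (e - Z).+1 %| polar lam f)].
  move=> good_p f Z e.
  have c_n0 := spec_c0 sz_F lc_F dvd_M sz_M good_p.
  have lc_f := spec_lead_F sz_F lc_F dvd_M sz_M good_p.
  have sz_f := spec_size_F sz_F lc_F dvd_M sz_M good_p.
  have Gf : G p = resultant f f^`() := spec_G sz_F lc_F dvd_M sz_M good_p.
  have := @real_polar_order R f (evts p c0) (crit p j).
  rewrite sz_f -Gf; apply=> //.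
  exact: (spec_G_neq0 dvd_M sz_M good_p).
(* This [lam] is generic at [p0] only. At nearby [p] just the divisibility is used, which holds for
   every nonzero [lam]. *)
have [le_Z0 _ [lam lam_n0 ndv]] := order p0 good_p0.
pose lamA : {poly {poly R}} := lam%:P%:P.
have EL p : evts p lamA = lam by rewrite /= /horner_eval !hornerC.
have polarE p : good p -> map_poly (evts p) (polar lamA F) =
    polar lam (map_poly (map_poly (evts p)) F).
  move=> good_p; rewrite (spec_polar sz_F lc_F dvd_M sz_M good_p) EL //.
pose k := (mup (crit p0 j) (G p0) -
        ((size F).-1 - ndroots (fiber p0 (crit p0 j)))).+1.
have near_ndv : \forall p \near p0,
    ~~ (('X - (crit p j)%:P) ^+ k %| map_poly (evts p) (polar lamA F)).
  apply: (@near_ndvdp R _ (nbhs p0) (nbhs_filter p0) (size (polar lamA F)) k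
    (fun p => map_poly (evts p) (polar lamA F)) (map_poly (evts p0) (polar lamA F))
    (crit^~ j) (crit p0 j)) => //.
  - by move=> p; apply: size_poly.
  - exact: size_poly.
  - exact: cvg_spec.
  - by rewrite polarE.
apply: filterS2 ge_nd (filterI near_p0 (filterI near_e near_ndv)).
move=> p le_nd [good_p [eq_e ndv_p]].
have [le_Z dv _] := order p good_p.
apply/eqP; rewrite eqn_leq le_nd andbT leqNgt; apply/negP => gt_nd.
case/negP: ndv_p; rewrite polarE //; apply: dvdp_trans (dv lam lam_n0).
rewrite dvdp_exp2l // eq_e.
have := ndroots_le (fiber_neq0 (crit p j) good_p); rewrite size_fiber //.
rewrite /k; move: le_Z0 gt_nd => /=.
by move: (mup _ _) (ndroots _) (ndroots _) (size F).-1 => e n1 n2 N; clear; lia.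
Qed.

End Family.

(** * Branches near a critical line *)

(** The points of [A] satisfying [P] form a relatively open and closed subset. *)
Lemma connected_locally_constant (T : topologicalType) (A : set T) (P : T -> Prop) :
    connected A -> (forall z, A z -> P z -> \forall z1 \near z, P z1) ->
    (forall z, A z -> ~ P z -> \forall z1 \near z, ~ P z1) ->
  forall x y, A x -> A y -> P x -> P y.
Proof.
move=> conn_A openP openN x y Ax Ay Px.
suff eqA : A `&` [set z | P z] = A by have [] : (A `&` [set z | P z]) y by rewrite eqA.
apply: conn_A; first by exists x.
- exists ([set z | P z]°); first exact: open_interior.
  apply/seteqP; split=> z [Az Pz]; split=> //; last exact: interior_subset Pz.
  exact: openP Az Pz.
- exists (~` ([set z | ~ P z]°)); first exact/open_closedC/open_interior.
  apply/seteqP; split=> z [Az Pz]; split=> //.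
    by move=> /interior_subset; apply.
  by apply: contrapT => nPz; apply: Pz; apply: openN Az nPz.
Qed.

Lemma segment_locally_constant (R : realType) (P : R -> Prop) (a b : R) :
    (forall z, a <= z <= b -> P z -> \forall z1 \near z, P z1) ->
    (forall z, a <= z <= b -> ~ P z -> \forall z1 \near z, ~ P z1) ->
  forall x y, a <= x <= b -> a <= y <= b -> P x -> P y.
Proof.
have memE z : `[a, b]%classic z = (a <= z <= b) by rewrite /= in_itv.
move=> openP openN x y x_ab y_ab.
by apply: (connected_locally_constant (@segment_connected R a b)) => [z|z||];
   rewrite memE //; [apply: openP | apply: openN].
Qed.

Section Noncritical.
Variables (R : realType) (F : {poly {poly {poly {poly R}}}}).
Variables (M : {poly {poly {poly R}}}) (c0 : {poly {poly R}}).
Hypotheses (sz_F : (1 < size F)%N) (lc_F : lead_coef F = c0%:P).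
Hypothesis M_dvd : exists k, Dres F = k * M.
Hypothesis dvd_M : exists n k, M ^+ n = k * Dres F.
Hypothesis sz_M : (1 < size M)%N.
Implicit Types (p : R * R) (x y : R).
Local Notation M_ p := (map_poly (evts p) M).
Local Notation S p x := (rootsR (fiber F p x)).
Local Notation good := (good M).
Local Notation crit := (crit M).
Local Notation ncrit := (ncrit M).

Definition noncritical p x := forall j, (j < ncrit p)%N -> x != crit p j.

Lemma noncritical_root p x : good p -> noncritical p x -> ~~ root (M_ p) x.
Proof.
move=> good_p nc; apply/negP; rewrite -mem_rootsR; last exact: (M_neq0 sz_M good_p).
by move=> /(nthP 0)[j lt_j Dx]; case/eqP: (nc j lt_j); exact: esym Dx.
Qed.

Lemma fiber_continuous p x : good p -> noncritical p x ->
  continuous_list (fun x => S p x) x.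
Proof.
move=> good_p nc e e_gt0.
have cst_p : (fun _ : R => p) @ x --> p by apply: cvg_cst.
have id_x : (fun z : R => z) @ x --> x by apply: cvg_id.
exact: (near_rootsR_noncritical sz_F lc_F M_dvd dvd_M sz_M _ good_p cst_p id_x
  (noncritical_root good_p nc) e_gt0).
Qed.

Definition same_side p x x' := forall j, (j < ncrit p)%N ->
  (x < crit p j) = (x' < crit p j).

Lemma same_side_between p x x' : noncritical p x -> noncritical p x' ->
  same_side p x x' -> forall z, Num.min x x' <= z <= Num.max x x' ->
  noncritical p z /\ same_side p x z.
Proof.
move=> nx nx' side z z_x; suff side_z j : (j < ncrit p)%N ->
    z != crit p j /\ (x < crit p j) = (z < crit p j).
  by split=> j /side_z[].
move=> lt_j; have := side j lt_j; have := nx j lt_j; have := nx' j lt_j.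
move: z_x; rewrite ge_min le_max.
by case: (ltrgtP x (crit p j)) => //; case: (ltrgtP x' (crit p j)) => //;
   case: (ltrgtP z (crit p j)) => //; lra.
Qed.

(** No critical point lies between [x] and [x'], so the number of roots is locally constant on the
    segment joining them. *)
Lemma same_side_size p x x' : good p -> noncritical p x -> noncritical p x' ->
  same_side p x x' -> size (S p x) = size (S p x').
Proof.
move=> good_p nx nx' side.
pose P z := size (S p z) = size (S p x).
have x_in : Num.min x x' <= x <= Num.max x x' by rewrite ge_min le_max lexx.
have x'_in : Num.min x x' <= x' <= Num.max x x' by rewrite ge_min le_max lexx !orbT.
apply/esym; apply: (@segment_locally_constant R P _ _ _ _ x x' x_in x'_in) => //.
- move=> z /(same_side_between nx nx' side)[nz _] Pz.
  by apply: filterS (fiber_continuous good_p nz ltr01) => z1 /= [eq_z _]; rewrite /P eq_z.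
- move=> z /(same_side_between nx nx' side)[nz _] nPz.
  by apply: filterS (fiber_continuous good_p nz ltr01) => z1 /= [eq_z _]; rewrite /P eq_z.
Qed.

(** The factor 4 covers the largest sum of errors, [e + 2 e + e] in [near_nth_eq]. *)
Definition well_separated (e : R) (s : seq R) := forall k l,
  (k < size s)%N -> (l < size s)%N -> `|s`_k - s`_l| < 4 * e -> k = l.

Lemma ex_well_separated (s : seq R) : uniq s -> exists2 e, 0 < e & well_separated e s.
Proof.
move=> uniq_s.
have near_e : \forall e \near (0 : R)^'+, forall kl : 'I_(size s) * 'I_(size s),
    `|s`_(kl.1) - s`_(kl.2)| < 4 * e -> kl.1 = kl.2.
  apply: filter_forall => -[k l] /=; have [->|ne_kl] := eqVneq k l.
    by apply: nearW.
  have gt0 : 0 < `|s`_k - s`_l| / 4.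
    by rewrite divr_gt0 // normr_gt0 subr_eq0 nth_uniq.
  apply: filterS (nbhs_right_le gt0) => e; rewrite ler_pdivlMr // mulrC => le_e lt_e.
  by have := le_lt_trans le_e lt_e; rewrite ltxx.
have [e [e_gt0 eP]] := filter_ex (filterI (nbhs_right_gt (0 : R)) near_e).
exists e => // k l lt_k lt_l lt_e.
by have /(congr1 val) := eP (Ordinal lt_k, Ordinal lt_l) lt_e.
Qed.

(** Along the segment the root of index [i] moves continuously and is always within [e] of some
    point of [C]; well separated points leave it no way to pass from one to another. *)
Lemma branch_same_index p x x' (C : seq R) e i k : good p ->
    noncritical p x -> noncritical p x' -> same_side p x x' ->
    0 < e -> well_separated e C ->
    (forall z, Num.min x x' <= z <= Num.max x x' ->
       forall y, y \in S p z -> exists2 c, c \in C & `|y - c| < e) ->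
    (i < size (S p x))%N -> (k < size C)%N -> `|(S p x)`_i - C`_k| < e ->
  `|(S p x')`_i - C`_k| < e.
Proof.
move=> good_p nx nx' side e_gt0 sep_C near_C lt_i lt_k.
pose P z := `|(S p z)`_i - C`_k| < e.
have x_in : Num.min x x' <= x <= Num.max x x' by rewrite ge_min le_max lexx.
have x'_in : Num.min x x' <= x' <= Num.max x x' by rewrite ge_min le_max lexx !orbT.
have lt_iz z : Num.min x x' <= z <= Num.max x x' -> (i < size (S p z))%N.
  move=> /(same_side_between nx nx' side)[nz side_z].
  by rewrite -(same_side_size good_p nx nz side_z).
have step z l : Num.min x x' <= z <= Num.max x x' ->
    `|(S p z)`_i - C`_l| < e -> \forall z1 \near z, `|(S p z1)`_i - C`_l| < e.
  move=> z_in lt_z; have [nz _] := same_side_between nx nx' side z_in.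
  have d_gt0 : 0 < e - `|(S p z)`_i - C`_l| by rewrite subr_gt0.
  apply: filterS (fiber_continuous good_p nz d_gt0) => z1 /= [_ /(_ i (lt_iz z z_in))].
  set u := (S p z)`_i; set v := (S p z1)`_i => lt_uv.
  have -> : v - C`_l = (u - C`_l) - (u - v) by ring.
  by rewrite (le_lt_trans (ler_normB _ _)) // -ltrBrDl.
apply: (@segment_locally_constant R P _ _ _ _ x x' x_in x'_in) => z z_in; first exact: step.
move=> nPz; have [_ /(nthP 0)[l lt_l <-] lt_zl] := near_C z z_in _ (mem_nth 0 (lt_iz z z_in)).
apply: filterS (step z l z_in lt_zl) => z1 lt_z1 Pz1; apply: nPz; rewrite /P.
suff -> : k = l by [].
apply: sep_C => //.
have -> : C`_k - C`_l = ((S p z1)`_i - C`_l) - ((S p z1)`_i - C`_k) by ring.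
by rewrite (le_lt_trans (ler_normB _ _)) //; move: lt_z1 Pz1; rewrite /P; lra.
Qed.

End Noncritical.

Section CriticalBranches.
Variables (R : realType) (F : {poly {poly {poly {poly R}}}}).
Variables (M : {poly {poly {poly R}}}) (c0 : {poly {poly R}}).
Hypotheses (sz_F : (1 < size F)%N) (lc_F : lead_coef F = c0%:P).
Hypothesis M_dvd : exists k, Dres F = k * M.
Hypothesis dvd_M : exists n k, M ^+ n = k * Dres F.
Hypothesis sz_M : (1 < size M)%N.
Implicit Types (p : R * R) (x y : R).
Local Notation M_ p := (map_poly (evts p) M).
Local Notation S p x := (rootsR (fiber F p x)).
Local Notation good := (good M).
Local Notation crit := (crit M).
Local Notation ncrit := (ncrit M).
Local Notation noncritical := (noncritical M).

Lemma near_critical_fiber p0 j e : good p0 -> (j < ncrit p0)%N -> 0 < e ->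
  \forall p \near p0, size (S p (crit p j)) = size (S p0 (crit p0 j)) /\
    forall i, (i < size (S p0 (crit p0 j)))%N ->
      `|(S p0 (crit p0 j))`_i - (S p (crit p j))`_i| < e.
Proof.
move=> good_p0 lt_j e_gt0.
have id_p0 : (fun p : R * R => p) @ p0 --> p0 by apply: cvg_id.
have cvg_a := cvg_crit sz_M good_p0 lt_j.
apply: (near_rootsR_fiber sz_F lc_F dvd_M sz_M _ good_p0 id_p0 cvg_a) e_gt0.
exact: (ndroots_critical sz_F lc_F M_dvd dvd_M sz_M good_p0 lt_j).
Qed.

Lemma increasing_crit p : increasing_upto (ncrit p) (crit p).
Proof. exact: sorted_increasing_upto (sorted_rootsR _). Qed.

Lemma near_nth_eq (C C' : seq R) (y e : R) k : well_separated e C ->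
    (k < size C)%N -> size C' = size C ->
    (forall i, (i < size C)%N -> `|C`_i - C'`_i| < e) -> `|y - C`_k| < 2 * e ->
  forall c, c \in C' -> `|y - c| < e -> c = C'`_k.
Proof.
move=> sep lt_k eq_sz near_C lt_y c /(nthP 0)[l]; rewrite eq_sz => lt_l <- lt_c.
suff -> : k = l by [].
apply: sep => //.
have -> : C`_k - C`_l = (y - C'`_l) - (y - C`_k) - (C`_l - C'`_l) by ring.
apply: le_lt_trans (ler_normB _ _) _.
have := near_C l lt_l; have := ler_normB (y - C'`_l) (y - C`_k); lra.
Qed.

Lemma dist_between (x y z a d : R) : `|x - a| < d -> `|y - a| < d ->
  Num.min x y <= z <= Num.max x y -> `|z - a| < d.
Proof.
rewrite ge_min le_max !ltr_norml => /andP[h1 h2] /andP[h3 h4] /andP[].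
by case/orP=> h5 /orP[h6|h6]; apply/andP; split; lra.
Qed.

(* [kf] depends only on [p0]: in a box around the critical point in which the roots
   stay close to those of the critical fibre of [p0], a branch keeps its
   neighbour along the whole segment from the sample point [xs]. *)
Lemma branch_limit p0 j (b : bool) : good p0 -> (j < ncrit p0)%N ->
  exists kf : nat -> nat, \forall p \near p0, forall e, 0 < e ->
    exists2 d, 0 < d & forall x, `|x - crit p j| < d -> x != crit p j ->
      (crit p j < x) = b -> forall i, (i < size (S p x))%N ->
        (kf i < size (S p0 (crit p0 j)))%N /\
        `|(S p x)`_i - (S p (crit p j))`_(kf i)| < e.
Proof.
move=> good_p0 lt_j; pose al := crit p0 j; pose C := S p0 al.
have id_p0 : (fun p : R * R => p) @ p0 --> p0 by apply: cvg_id.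
have uniq_root (q : {poly R}) : uniq (rootsR q).
  exact: (sorted_uniq lt_trans (@ltxx _ _) (sorted_rootsR q)).
have [e e_gt0 sep_C] := ex_well_separated (uniq_root (fiber F p0 al)).
have [g g_gt0 sep_crit] := ex_well_separated (uniq_root (M_ p0)).
have near_box : \forall z \near (al, p0), forall y, y \in S z.2 z.1 ->
    exists2 c, c \in C & `|y - c| < e.
  exact: (near_fiber_root sz_F lc_F dvd_M sz_M _ good_p0
    (@snd_cvg _ _ (al, p0)) (@fst_cvg _ _ (al, p0)) e_gt0).
case: near_box => [[A B] /= [nearA nearB] AB].
have /nbhs_ballP[d0 /= d0_gt0 ballA] := nearA.
(* With [d <= 2 * g] the other critical points of [p0] are at distance at least [2 * d], so they
   stay out of the window of radius [d] when they move by less than [d / 4]. *)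
pose d := Num.min d0 (2 * g).
have d_gt0 : 0 < d by rewrite lt_min d0_gt0 mulr_gt0.
have le_dg : d <= 2 * g by rewrite ge_min lexx orbT.
(* A sample abscissa on the side [b], fixed once for all nearby [p]. *)
pose xs := al + (if b then d / 2 else - (d / 2)).
have xs_al : `|xs - al| = d / 2.
  by rewrite /xs addrC addKr; case: (b); rewrite ?normrN gtr0_norm // divr_gt0.
have far l : (l < ncrit p0)%N -> l != j -> 2 * d <= `|crit p0 l - al|.
  move=> lt_l ne_lj; apply: (@le_trans _ _ (4 * g)); first by move: le_dg; lra.
  by rewrite leNgt; apply: contra ne_lj => lt_g; apply/eqP/(sep_crit l j).
have nc_xs : noncritical p0 xs.
  move=> l lt_l; have [->|ne_lj] := eqVneq l j.
    rewrite -subr_eq0 -normr_eq0 xs_al; move: d_gt0; lra.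
  apply: contraTneq (far l lt_l ne_lj) => <-; rewrite xs_al -ltNge.
  by move: d_gt0; lra.
have /choice[kf kfP] : forall i, exists k, (i < size (S p0 xs))%N ->
    (k < size C)%N /\ `|(S p0 xs)`_i - C`_k| < e.
  move=> i; have [lt_i|] := boolP (i < size (S p0 xs))%N; last by exists 0%N.
  have xs_A : A xs.
    by apply: ballA; rewrite /ball /= distrC xs_al; move: d_gt0; rewrite lt_min => /andP[];
       have : d <= d0 by [rewrite ge_min lexx]; lra.
  have [c /(nthP 0)[k lt_k <-] lt_c] := AB (xs, p0) (conj xs_A (nbhs_singleton nearB))
    _ (mem_nth 0 lt_i).
  by exists k.
exists kf.
have d4_gt0 : 0 < d / 4 by rewrite divr_gt0.
have near1 : \forall p \near p0, good p by apply: (near_good _ good_p0 id_p0).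
have near2 : \forall p \near p0, ncrit p = ncrit p0 /\
    forall l, (l < ncrit p0)%N -> `|crit p0 l - crit p l| < d / 4.
  exact: (near_rootsR_M sz_M _ good_p0 id_p0 d4_gt0).
have cst_xs : (fun _ : R * R => xs) @ p0 --> xs by apply: cvg_cst.
have near3 : \forall p \near p0, size (S p xs) = size (S p0 xs) /\
    forall i, (i < size (S p0 xs))%N -> `|(S p0 xs)`_i - (S p xs)`_i| < e.
  exact: (near_rootsR_noncritical sz_F lc_F M_dvd dvd_M sz_M _ good_p0 id_p0 cst_xs
    (noncritical_root sz_M good_p0 nc_xs) e_gt0).
have near4 := near_critical_fiber good_p0 lt_j e_gt0.
have near5 : \forall p \near p0, B p by exact: nearB.
apply: filterS3 (filterI near1 near2) (filterI near3 near4) near5.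
move=> p [good_p [eq_m near_al]] [[sz_xs near_xs] [sz_C near_C]] Bp.
have lt_jp : (j < ncrit p)%N by rewrite eq_m.
have near_j := near_al j lt_j; rewrite -/al in near_j.
have window x : `|x - al| < d -> x != crit p j -> (crit p j < x) = b ->
    noncritical p x /\ same_side M p xs x.
  move=> lt_x ne_x side_x; suff side l : (l < ncrit p)%N ->
      x != crit p l /\ (xs < crit p l) = (x < crit p l).
    by split=> l /side[].
  rewrite eq_m => lt_l; have [->|ne_lj] := eqVneq l j.
    split=> //; have -> : (x < crit p j) = ~~ b.
      by rewrite -side_x; case: ltrgtP ne_x.
    move: near_j; rewrite ltr_norml /xs => /andP[]; case: (b) => /= h1 h2.
      by apply/negbTE; rewrite -leNgt; move: h1 h2 d_gt0; lra.
    by move: h1 h2 d_gt0; lra.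
  have := near_al l lt_l; have := far l lt_l ne_lj; move: lt_x.
  rewrite ler_normr !ltr_norml /xs => /andP[h1 h2] far_l /andP[h3 h4].
  have [h5|h5] : crit p l > al + d \/ crit p l < al - d.
    by case/orP: far_l => h; [left|right]; move: h h3 h4 d_gt0; lra.
  - split; first by rewrite lt_eqF //; lra.
    have -> : x < crit p l by lra.
    by case: (b); move: h5 d_gt0; lra.
  - split; first by rewrite gt_eqF //; lra.
    have -> : (x < crit p l) = false by apply/negbTE; rewrite -leNgt; lra.
    by apply/negbTE; rewrite -leNgt; case: (b); move: h5 d_gt0; lra.
have in_box x : `|x - al| < d -> forall y, y \in S p x -> exists2 c, c \in C & `|y - c| < e.
  move=> lt_x; apply: (AB (x, p)); split=> //=; apply: ballA.
  by rewrite /ball /= distrC (lt_le_trans lt_x) // ge_min lexx.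
have lt_xs : `|xs - al| < d by rewrite xs_al; move: d_gt0; lra.
have ne_xs : xs != crit p j /\ (crit p j < xs) = b.
  move: near_j; rewrite ltr_norml /xs => /andP[]; case: (b) => /= h1 h2.
    by split; [rewrite gt_eqF //|]; move: h1 h2 d_gt0; lra.
  split; first by rewrite lt_eqF //; move: h1 h2 d_gt0; lra.
  by apply/negbTE; rewrite -leNgt; move: h1 h2 d_gt0; lra.
have nc_xsp : noncritical p xs by case: (window xs lt_xs ne_xs.1 ne_xs.2).
(* Over [xs] the root for [p] is within [e] of the root for [p0] and of some point of [C]; with the
   choice of [kf] this makes three errors, less than the separation [4 * e]. *)
have xs_k i : (i < size (S p xs))%N -> (kf i < size C)%N /\ `|(S p xs)`_i - C`_(kf i)| < e.
  move=> lt_i; have lt_i0 := lt_i; rewrite sz_xs in lt_i0.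
  have [lt_k lt_ck] := kfP i lt_i0; split=> //.
  have [_ /(nthP 0)[l lt_l <-] lt_cl] := in_box xs lt_xs _ (mem_nth 0 lt_i).
  suff -> : kf i = l by [].
  apply: sep_C => //.
  set u := (S p xs)`_i in lt_cl *; set v := (S p0 xs)`_i in lt_ck.
  have := near_xs i lt_i0; rewrite -/u -/v => lt_uv.
  have -> : C`_(kf i) - C`_l = (v - u) - (v - C`_(kf i)) + (u - C`_l) by ring.
  apply: le_lt_trans (ler_normD _ _) _.
  have := ler_normB (v - u) (v - C`_(kf i)); lra.
(* [e1] is the requested precision; [e] serves to identify which root of the critical fibre is
   approached. *)
move=> e1 e1_gt0; have m_gt0 : 0 < Num.min e1 e by rewrite lt_min e1_gt0.
have cst_p : (fun _ : R => p) @ crit p j --> p by apply: cvg_cst.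
have id_x : (fun z : R => z) @ crit p j --> crit p j by apply: cvg_id.
have near_x : \forall x \near crit p j, forall y, y \in S p x ->
    exists2 c, c \in S p (crit p j) & `|y - c| < Num.min e1 e.
  exact: (near_fiber_root sz_F lc_F dvd_M sz_M _ good_p cst_p id_x m_gt0).
have /nbhs_ballP[d1 /= d1_gt0 d1P] := near_x.
(* The critical point has moved by less than [d / 4], so radius [d / 2] around it stays inside the
   window around [al]. *)
exists (Num.min d1 (d / 2)); first by rewrite lt_min d1_gt0 divr_gt0.
move=> x; rewrite lt_min => /andP[lt_x1 lt_x2] ne_x side_x i lt_i.
have lt_x : `|x - al| < d.
  have -> : x - al = (x - crit p j) - (al - crit p j) by ring.
  by apply: le_lt_trans (ler_normB _ _) _; move: lt_x2 near_j d_gt0; lra.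
have [nc_x same_x] := window x lt_x ne_x side_x.
have lt_ixs : (i < size (S p xs))%N.
  by rewrite (same_side_size sz_F lc_F M_dvd dvd_M sz_M good_p nc_xsp nc_x same_x).
have [lt_k lt_ck] := xs_k i lt_ixs; split=> //.
have lt_xk : `|(S p x)`_i - C`_(kf i)| < e.
  apply: (branch_same_index sz_F lc_F M_dvd dvd_M sz_M good_p nc_xsp nc_x same_x
    e_gt0 sep_C _ lt_ixs lt_k lt_ck).
  by move=> z /(dist_between lt_xs lt_x); apply: in_box.
have [c c_p] : exists2 c, c \in S p (crit p j) & `|(S p x)`_i - c| < Num.min e1 e.
  by apply: (d1P x); [rewrite /ball /= distrC | apply: mem_nth].
rewrite lt_min => /andP[lt_c1 lt_ce].
suff <- : c = (S p (crit p j))`_(kf i) by [].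
apply: (near_nth_eq sep_C lt_k sz_C near_C _ c_p lt_ce).
by move: lt_xk e_gt0; lra.
Qed.

End CriticalBranches.

(** * Homeomorphisms between curves at nearby parameters *)

Section NearHomeo.
Variables (R : realType) (F : {poly {poly {poly {poly R}}}}).
Variables (M : {poly {poly {poly R}}}) (c0 : {poly {poly R}}).
Hypotheses (sz_F : (1 < size F)%N) (lc_F : lead_coef F = c0%:P).
Hypothesis M_dvd : exists k, Dres F = k * M.
Hypothesis dvd_M : exists n k, M ^+ n = k * Dres F.
Hypothesis sz_M : (1 < size M)%N.
Implicit Types (p : R * R) (x y : R).
Local Notation M_ p := (map_poly (evts p) M).
Local Notation S p x := (rootsR (fiber F p x)).
Local Notation good := (good M).
Local Notation crit := (crit M).
Local Notation ncrit := (ncrit M).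
Local Notation noncritical := (noncritical M).

Definition same_pattern p (B : {ffun 'I_(ncrit p) -> bool}) x :=
  noncritical p x /\ forall j : 'I_(ncrit p), (x < crit p j) = B j.

Lemma near_noncritical p0 x : good p0 -> noncritical p0 x ->
  \forall p \near p0, [/\ size (S p x) = size (S p0 x), noncritical p x
    & forall j, (j < ncrit p0)%N -> (x < crit p j) = (x < crit p0 j)].
Proof.
move=> good_p0 nc_x.
have id_p0 : (fun p : R * R => p) @ p0 --> p0 by apply: cvg_id.
have cst_x : (fun _ : R * R => x) @ p0 --> x by apply: cvg_cst.
have near1 : \forall p \near p0, size (S p x) = size (S p0 x) /\
    forall i, (i < size (S p0 x))%N -> `|(S p0 x)`_i - (S p x)`_i| < 1.
  exact: (near_rootsR_noncritical sz_F lc_F M_dvd dvd_M sz_M _ good_p0 id_p0 cst_x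
    (noncritical_root sz_M good_p0 nc_x) ltr01).
have near2 : \forall p \near p0, forall j : 'I_(ncrit p0),
    x != crit p j /\ (x < crit p j) = (x < crit p0 j).
  apply: (@filter_forall _ _ _ _ (nbhs_filter p0)) => j.
  have cvg_j : (fun p => crit p j) @ p0 --> crit p0 j.
    by apply: (cvg_crit sz_M good_p0 (ltn_ord j)).
  case: (ltgtP x (crit p0 j)) (nc_x j (ltn_ord j)) => // [lt_x|gt_x] _.
    have near_lt : \forall p \near p0, x < crit p j by apply: (cvgr_gt _ cvg_j).
    by apply: filterS near_lt => p lt_xp; rewrite lt_eqF.
  have near_gt : \forall p \near p0, crit p j < x by apply: (cvgr_lt _ cvg_j).
  by apply: filterS near_gt => p gt_xp; rewrite gt_eqF // ltNge ltW.
apply: filterS3 near1 near2 (near_ncrit sz_M good_p0) => p [sz_x _] pos_x eq_m.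
split=> // [j|j lt_j]; last by case: (pos_x (Ordinal lt_j)).
by rewrite eq_m => lt_j; case: (pos_x (Ordinal lt_j)).
Qed.

(* The noncritical intervals are encoded by their patterns [B] of positions with
   respect to the critical points, so that one sample point is chosen in each. *)
Lemma near_same_size p0 : good p0 -> \forall p \near p0, forall x x',
  same_position (ncrit p0) (crit p0) (crit p) x x' -> size (S p0 x) = size (S p x').
Proof.
move=> good_p0; pose pattern := {ffun 'I_(ncrit p0) -> bool}.
have /choice[sam samP] : forall B : pattern, exists z,
    (exists x, same_pattern B x) -> same_pattern B z.
  move=> B; have [[x Bx]|nex] := pselect (exists x, same_pattern B x).
    by exists x.
  by exists 0 => /nex.
have near1 : \forall p \near p0, forall B : pattern, same_pattern B (sam B) ->
    [/\ size (S p (sam B)) = size (S p0 (sam B)), noncritical p (sam B)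
    & forall j, (j < ncrit p0)%N -> (sam B < crit p j) = (sam B < crit p0 j)].
  apply: (@filter_forall _ _ _ _ (nbhs_filter p0)) => B.
  have [Bs|nBs] := pselect (same_pattern B (sam B)); last by apply: nearW.
  by apply: filterS (near_noncritical good_p0 Bs.1).
have near2 : \forall p \near p0, forall j : 'I_(ncrit p0),
    size (S p (crit p j)) = size (S p0 (crit p0 j)).
  apply: (@filter_forall _ _ _ _ (nbhs_filter p0)) => j.
  apply: filterS (near_critical_fiber sz_F lc_F M_dvd dvd_M sz_M good_p0 (ltn_ord j) ltr01).
  by move=> p [].
have id_p0 : (fun p : R * R => p) @ p0 --> p0 by apply: cvg_id.
have near3 : \forall p \near p0, good p by apply: (near_good _ good_p0 id_p0).
apply: filterS3 (filterI near1 near2) near3 (near_ncrit sz_M good_p0).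
move=> p [sam_p crit_p] good_p eq_m x x' pos.
have [[j [lt_j Dx]]|nex] := pselect (exists j, (j < ncrit p0)%N /\ x = crit p0 j).
  have [] := pos j lt_j; rewrite Dx ltxx.
  by case: ltgtP => // -> _ _; rewrite (crit_p (Ordinal lt_j)).
have nc_x : noncritical p0 x.
  by move=> j lt_j; apply/eqP => Dx; apply: nex; exists j.
have nc_x' : noncritical p x'.
  move=> j; rewrite eq_m => lt_j; have [] := pos j lt_j; have := nc_x j lt_j.
  by case: (ltgtP x (crit p0 j)) => //; case: (ltgtP x' (crit p j)).
pose B : pattern := [ffun j : 'I_(ncrit p0) => x < crit p0 j].
have Bx : same_pattern B x by split=> // j; rewrite ffunE.
have Bs : same_pattern B (sam B) by apply: samP; exists x.
have [sz_s nc_s pos_s] := sam_p B Bs.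
have side0 : same_side M p0 x (sam B).
  by move=> j lt_j; rewrite (Bx.2 (Ordinal lt_j)) (Bs.2 (Ordinal lt_j)).
have side1 : same_side M p (sam B) x'.
  move=> j; rewrite eq_m => lt_j; rewrite pos_s // -(side0 j lt_j).
  by case: (pos j lt_j).
rewrite (same_side_size sz_F lc_F M_dvd dvd_M sz_M good_p0 nc_x Bs.1 side0).
by rewrite -sz_s (same_side_size sz_F lc_F M_dvd dvd_M sz_M good_p nc_s nc_x' side1).
Qed.

(** The functions [kf] of [branch_limit] are chosen at [p0] and serve both [p0] and [p]: they supply
    the common index asked for by [critical_S]. *)
Lemma near_homeo p0 : good p0 -> \forall p \near p0,
  exists f g : R * R -> R * R, [/\ continuous f, continuous g, cancel f g, cancel g f
    & forall x y, (y \in S p0 x) = ((f (x, y)).2 \in S p (f (x, y)).1)].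
Proof.
move=> good_p0.
have id_p0 : (fun p : R * R => p) @ p0 --> p0 by apply: cvg_id.
have near_g : \forall p \near p0, good p by apply: (near_good _ good_p0 id_p0).
pose limits p (jb : 'I_(ncrit p0) * bool) (kf : nat -> nat) := forall e, 0 < e ->
    exists2 d, 0 < d & forall x, `|x - crit p jb.1| < d -> x != crit p jb.1 ->
      (crit p jb.1 < x) = jb.2 -> forall i, (i < size (S p x))%N ->
        (kf i < size (S p0 (crit p0 jb.1)))%N /\
        `|(S p x)`_i - (S p (crit p jb.1))`_(kf i)| < e.
have /choice[kf kfP] : forall jb, exists kf, \forall p \near p0, limits p jb kf.
  move=> [j b].
  exact: (branch_limit sz_F lc_F M_dvd dvd_M sz_M b good_p0 (ltn_ord j)).
have near_kf : \forall p \near p0, forall jb, limits p jb (kf jb).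
  exact: (@filter_forall _ _ _ _ (nbhs_filter p0)).
have kf_p0 jb : limits p0 jb (kf jb) by apply: (nbhs_singleton (kfP jb)).
apply: filterS3 (near_same_size good_p0) (filterI near_g near_kf) (near_ncrit sz_M good_p0).
move=> p size_p [good_p kf_p] eq_m.
apply: (@root_homeo R (fun x => S p0 x) (fun x => S p x) (ncrit p0) (crit p0) (crit p)).
- exact: increasing_crit.
- by rewrite -eq_m; apply: increasing_crit.
- by move=> x; apply: sorted_rootsR.
- by move=> x; apply: sorted_rootsR.
- exact: size_p.
- by move=> x nc; apply: (fiber_continuous sz_F lc_F M_dvd dvd_M sz_M good_p0).
- move=> x nc; apply: (fiber_continuous sz_F lc_F M_dvd dvd_M sz_M good_p).
  by move=> j; rewrite eq_m; apply: nc.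
move=> j lt_j e e_gt0; pose jo := Ordinal lt_j.
have [d1 d1_gt0 d1P] := kf_p0 (jo, true) e e_gt0.
have [d2 d2_gt0 d2P] := kf_p0 (jo, false) e e_gt0.
have [d3 d3_gt0 d3P] := kf_p (jo, true) e e_gt0.
have [d4 d4_gt0 d4P] := kf_p (jo, false) e e_gt0.
exists (Num.min (Num.min d1 d2) (Num.min d3 d4)).
  by rewrite !lt_min d1_gt0 d2_gt0 d3_gt0.
move=> x x' pos; rewrite !lt_min => /andP[/andP[x1 x2] _] /andP[_ /andP[x3 x4]] i lt_i.
have lt_i' : (i < size (S p x'))%N by rewrite -(size_p x x' pos).
have [pos1 pos2] := pos j lt_j.
have [Dx|ne_x] := eqVneq x (crit p0 j).
  have Dx' : x' = crit p j.
    by move: pos1 pos2; rewrite Dx ltxx; case: ltgtP.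
  by exists i; rewrite -?Dx // -Dx' !subrr normr0.
have ne_x' : x' != crit p j.
  by move: ne_x pos1 pos2; case: (ltgtP x) => // _ _; case: (ltgtP x').
case side : (crit p0 j < x).
  have [lt_k c1] := d1P x x1 ne_x side i lt_i.
  have [_ c2] := d3P x' x3 ne_x' (esym (etrans (esym side) pos2)) i lt_i'.
  by exists (kf (jo, true) i).
have [lt_k c1] := d2P x x2 ne_x side i lt_i.
have [_ c2] := d4P x' x4 ne_x' (esym (etrans (esym side) pos2)) i lt_i'.
by exists (kf (jo, false) i).
Qed.

End NearHomeo.

(** * From nearby parameters to a connected component *)

Local Open Scope classical_set_scope.

Lemma same_topology_type_sym (Z1 Z2 : set (RR * RR)) :
  same_topology_type Z1 Z2 -> same_topology_type Z2 Z1.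
Proof.
move=> [f [g [cont_f cont_g fK gK <-]]]; exists g, f; split=> //.
apply/seteqP; split=> [_ [_ [x Z1x <-] <-]|x Z1x]; first by rewrite fK.
by exists (f x); [exists x | rewrite fK].
Qed.

Lemma same_topology_type_trans (Z1 Z2 Z3 : set (RR * RR)) :
  same_topology_type Z1 Z2 -> same_topology_type Z2 Z3 -> same_topology_type Z1 Z3.
Proof.
move=> [f [g [cont_f cont_g fK gK <-]]] [h [k [cont_h cont_k hK kK <-]]].
exists (h \o f), (g \o k); split; last by rewrite image_comp.
- by move=> x; apply: continuous_comp; [exact: cont_f | exact: cont_h].
- by move=> x; apply: continuous_comp; [exact: cont_k | exact: cont_g].
- exact: can_comp.
- exact: can_comp.
Qed.

(** Symmetry and transitivity turn the local relation into openness both of the class of [p] and of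
    its complement. *)
Lemma connected_component_locally_constant (T : topologicalType) (A : set T)
    (r : T -> T -> Prop) (p q : T) :
    (forall x, A x -> r x x) -> (forall x y, r x y -> r y x) ->
    (forall x y z, r x y -> r y z -> r x z) ->
    (forall x, A x -> \forall y \near x, r x y) ->
  connected_component A p q -> r p q.
Proof.
move=> r_refl r_sym r_trans near_r [C [Cp CA conn_C] Cq].
apply: (connected_locally_constant (P := r p) conn_C) Cp Cq (r_refl p (CA p Cp)) => x Cx rx.
  by apply: filterS (near_r x (CA x Cx)) => y; apply: r_trans.
apply: filterS (near_r x (CA x Cx)) => y rxy rpy.
exact/rx/(r_trans _ _ _ rpy)/r_sym.
Qed.

(** The curve substitutes [y] before [x], the fibre [x] before [y]; evaluation at [x] is a ring
    morphism, so the order is immaterial. *)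
Lemma curve_fiber (F : P_all) (p : RR * RR) (x y : RR) :
  curve F p.1 p.2 (x, y) <-> (fiber F p x).[y] = 0.
Proof.
rewrite /curve /= /fiber.
have -> : spec_ts F p.1 p.2 = map_poly (map_poly (evts p)) F by [].
have -> : y = horner_eval x y%:P by rewrite /horner_eval hornerC.
by rewrite horner_map /horner_eval hornerC.
Qed.

Theorem theorem15 (F : P_all) (M : P_xts) (Rp : P_ts) :
  squarefree F ->
  (forall c : P_ts, rdvd ((c%:P)%:P : P_all) F -> c \is a GRing.unit) ->
  (size (lead_coef F) <= 1)%N ->
  (if (size F <= 1)%N then M = 0 else is_sqfree_part (Dres F) M) ->
  Rp = (if (size M <= 1)%N then 0 else Dres M) ->
  Rp != 0 ->
  forall p q : RR * RR,
    q \in connected_component (~` [set ts | eval_ts Rp ts.1 ts.2 = 0]) p ->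
    same_topology_type (curve F p.1 p.2) (curve F q.1 q.2).
Proof.
move=> _ _ sz_lc HM DR R_n0 p q; rewrite inE.
(* The conventions for degenerate degrees all lead to [Rp = 0], so [R_n0] excludes them, as it does
   a zero discriminant. *)
have sz_M : (1 < size M)%N.
  by rewrite ltnNge; apply: contra R_n0 => le1; rewrite DR le1.
have {DR} DR : Rp = Dres M by rewrite DR leqNgt sz_M.
have M_n0 : M != 0 by apply: contraTneq sz_M => ->; rewrite size_poly0.
have sz_F : (1 < size F)%N.
  by rewrite ltnNge; apply: contra M_n0 => le1; rewrite le1 in HM; rewrite HM.
move: HM; rewrite leqNgt sz_F /= /is_sqfree_part; case: eqP => [_ M0|_ [M_dvd dvd_M _]].
  by rewrite M0 eqxx in M_n0.
have lc_F : lead_coef F = ((lead_coef F)`_0)%:P by apply: size1_polyC.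
apply: (@connected_component_locally_constant _ _
  (fun p q => same_topology_type (curve F p.1 p.2) (curve F q.1 q.2))) => {p q}.
- move=> p _; exists id, id; split=> //; [by move=> x; apply: cvg_id..|].
  by rewrite image_id.
- by move=> p q; apply: same_topology_type_sym.
- by move=> p q r; apply: same_topology_type_trans.
move=> p Ap; have good_p : good M p by apply/eqP => /= R0; apply: Ap; rewrite /= DR.
have id_p : (fun p : RR * RR => p) @ p --> p by apply: cvg_id.
have near_g : \forall q \near p, good M q by apply: (near_good _ good_p id_p).
have near_h : \forall q \near p, exists f g : RR * RR -> RR * RR,
    [/\ continuous f, continuous g, cancel f g, cancel g f
    & forall x y, (y \in rootsR (fiber F p x)) =
       ((f (x, y)).2 \in rootsR (fiber F q (f (x, y)).1))].
  exact: (near_homeo sz_F lc_F M_dvd dvd_M sz_M good_p).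
have curveE r x y : good M r -> curve F r.1 r.2 (x, y) <-> y \in rootsR (fiber F r x).
  move=> good_r; rewrite mem_rootsR; last exact: (fiber_neq0 sz_F lc_F dvd_M sz_M x good_r).
  by rewrite curve_fiber; split=> [/eqP|/eqP].
apply: filterS2 near_g near_h => q good_q [f [g [cont_f cont_g fK gK fE]]].
exists f, g; split=> //; apply/seteqP; split=> [_ [[x y] Cp <-]|z Cq].
  by case Df: (f (x, y)) => [u v]; apply/curveE => //; move: (fE x y);
     rewrite Df => <-; apply/curveE.
exists (g z); last exact: gK.
case Dg: (g z) => [x y]; apply/curveE => //; rewrite fE -Dg gK.
by apply/curveE; rewrite -?surjective_pairing.
Qed.
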